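(* Let $$I(x,t):=\left|\mathcal{F}^{-1}\left(e^{it\Psi(\xi)}\,\mathcal{F}\big(\sqrt{n}\,\chi_\Omega e^{-i\phi}\big)(\xi)\right)(x)\right|^2,$$ let $$I(x):=I(x,1)=\left|\mathcal{F}^{-1}\left(e^{i\Psi(\xi)}\,\mathcal{F}\big(\sqrt{n}\,\chi_\Omega e^{-i\phi}\big)(\xi)\right)(x)\right|^2,$$ and let $\Psi$ be such that $\Psi(\xi)\,\mathcal{F}(\chi_\Omega e^{-i\phi})(\xi)\in L_2(\mathbb{R}^N)$. Furthermore, assume that $\chi_\Omega\cos(\phi)\in D(\mathcal{G}_\Psi)$ and $\chi_\Omega\sin(\phi)\in D(\mathcal{G}_\Psi)$, and that $\Psi$ is even, $\Psi(-\xi)=\Psi(\xi)$ for all $\xi\in\mathbb{R}^N$. Then there holds $$I(x)-n\chi_\Omega(x)\;\approx\;\frac{\partial}{\partial t}I(x,t)\Big|_{t=0}=-2n\,\chi_\Omega(x)\sin(\phi(x))\,\mathcal{G}_\Psi\big(\chi_\Omega\cos(\phi)\big)(x)+2n\,\chi_\Omega(x)\cos(\phi(x))\,\mathcal{G}_\Psi\big(\chi_\Omega\sin(\phi)\big)(x).$$ If instead $\Psi$ is odd, i.e., if $\Psi(-\xi)=-\Psi(\xi)$ for all $\xi\in\mathbb{R}^N$, then $$I(x)-n\chi_\Omega(x)\;\approx\;\frac{\partial}{\partial t}I(x,t)\Big|_{t=0}=2n\,\chi_\Omega(x)\cos(\phi(x))\,\mathcal{G}_\Psi\big(\chi_\O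mega\cos(\phi)\big)(x)+2n\,\chi_\Omega(x)\sin(\phi(x))\,\mathcal{G}_\Psi\big(\chi_\Omega\sin(\phi)\big)(x).$$
   Context: The Fourier transform is normalized as $(\mathcal{F}u)(\xi)=\int_{\mathbb{R}^N} e^{-2\pi i \xi\cdot x}u(x)\,dx$, $(\mathcal{F}^{-1}u)(x)=\int_{\mathbb{R}^N} e^{2\pi i x\cdot\xi}u(\xi)\,d\xi$. Here $t\in[0,1]$, $\phi:\mathbb{R}^N\to\mathbb{R}$ is the wavefront aberration, $\Omega\subset\mathbb{R}^N$ is the aperture with indicator function $\chi_\Omega$, such that $\chi_\Omega e^{-i\phi}\in L_2(\mathbb{R}^N)$, $n>0$ is a constant (spatial average incoming flux), and $\Psi:\mathbb{R}^N\to\mathbb{R}$ is a $t$-independent shape function; $I(x)$ is the intensity measured by the wavefront sensor. The operator $\mathcal{G}_\Psi$ is $\mathcal{G}_\Psi(v):=\mathcal{F}^{-1}(\Psi\,\mathcal{F}(v))$ with domain $D(\mathcal{G}_\Psi)=\{v\in L_2(\mathbb{R}^N):\mathcal{F}^{-1}(\Psi\mathcal{F}(v))\in L_2(\mathbb{R}^N)\}$ and values in $L_2(\mathbb{R}^N)$. The symbol $\approx$ is used informally: since $I(x,0)=n\chi_\Omega(x)$, the quantity $I(x)-n\chi_\Omega(x)=I(x,1)-I(x,0)$ is the forward difference quotient $(I(x,\tau)-I(x,0))/\tau$ with $\tau=1$, taken as an approximation of the derivative $\frac{\partial}{\partial t}I(x,t)|_{t=0}=\lim_{\tau\to0}(I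(x,\tau)-I(x,0))/\tau$.
   Formalization: In the odd case the printed right-hand side lacks a factor i (for odd Ψ it is purely imaginary, the derivative real); the formula proved is i times the printed one. The t-derivative at 0 is taken as a limit in L_1, since I(·,t) is defined only almost everywhere. *)

(* Defs.v *)
From HB Require Import structures.
From mathcomp Require Import all_boot all_order all_algebra.
From mathcomp Require Import all_classical all_reals all_analysis.
From mathcomp Require Import complex.

Set Implicit Arguments.
Unset Strict Implicit.
Unset Printing Implicit Defensive.

Import Order.TTheory GRing.Theory Num.Theory.
Import numFieldNormedType.Exports.

Local Open Scope classical_set_scope.
Local Open Scope ring_scope.
Local Open Scope complex_scope.

(* Not derivable by canonical-structure inference: the library's instance for
   products of subprobabilities shadows the one for sigma-finite measures. *)
Lemma product_sigma_finite d1 d2 (T1 : measurableType d1)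
    (T2 : measurableType d2) (R : realType)
    (m1 : {sigma_finite_measure set T1 -> \bar R})
    (m2 : {sigma_finite_measure set T2 -> \bar R}) :
  sigma_finite setT (m1 \x m2)%E.
Proof.
have /sigma_finiteP[F [TF ndF Foo]] := sigma_finiteT m1.
have /sigma_finiteP[G [TG ndG Goo]] := sigma_finiteT m2.
exists (fun n => F n `*` G n).
  rewrite -setXTT TF TG predeqE => -[x y]; split.
    move=> [/= [n _ Fnx] [k _ Gky]]; exists (maxn n k) => //; split.
    - by move: x Fnx; exact/subsetPset/ndF/leq_maxl.
    - by move: y Gky; exact/subsetPset/ndG/leq_maxr.
  by move=> [n _ []/= ? ?]; split; exists n.
move=> k; have [? ?] := Foo k; have [? ?] := Goo k.
split; first exact: measurableX.
by rewrite product_measure1E// lte_mul_pinfty// ge0_fin_numE.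
Qed.

(* R^N is N.-tuple R with the product of the Borel sigma-algebras. The library
   has no Lebesgue measure there, so it is built as an iterated product,
   transported along (x, v) |-> x :: v. *)
Section lebesgue_cons.
Context {R : realType} (N : nat).
Variable mu : {sigma_finite_measure set (N.-tuple R) -> \bar R}.

Definition cons_vec (p : measurableTypeR R * N.-tuple R) : N.+1.-tuple R :=
  [tuple of p.1 :: p.2].

Definition uncons_vec (v : N.+1.-tuple R) : measurableTypeR R * N.-tuple R :=
  (thead v, [tuple of behead v]).

Lemma cons_vecK : cancel cons_vec uncons_vec.
Proof.
by case=> x v; rewrite /uncons_vec /cons_vec theadE; congr pair; apply: val_inj.
Qed.

Lemma measurable_cons_vec : measurable_fun [set: _] cons_vec.
Proof. exact: measurable_cons measurable_fst measurable_snd. Qed.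

Lemma measurable_uncons_vec : measurable_fun [set: _] uncons_vec.
Proof.
apply/measurable_fun_pairP; split => /=.
  exact: (@measurable_tnth _ (measurableTypeR R)).
exact: (@measurable_behead _ (measurableTypeR R)).
Qed.

Definition lebesgue_cons : set (N.+1.-tuple R) -> \bar R :=
  pushforward (@lebesgue_measure R \x mu)%E cons_vec.

Let lebesgue_cons0 : lebesgue_cons set0 = 0%E.
Proof. by rewrite /lebesgue_cons /pushforward preimage_set0 measure0. Qed.

Let lebesgue_cons_ge0 A : (0 <= lebesgue_cons A)%E.
Proof. exact: (measure_ge0 (lebesgue_measure \x mu)%E). Qed.

Let lebesgue_cons_sigma_additive : semi_sigma_additive lebesgue_cons.
Proof.
move=> F mF tF mUF; rewrite /lebesgue_cons /pushforward preimage_bigcup.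
apply: measure_semi_sigma_additive.
- by move=> n; rewrite -[X in measurable X]setTI; exact: measurable_cons_vec.
- apply/trivIsetP => /= i j _ _ ij; rewrite -preimage_setI.
  by move/trivIsetP : tF => /(_ _ _ _ _ ij) ->//; rewrite preimage_set0.
- rewrite -preimage_bigcup -[X in measurable X]setTI.
  exact: measurable_cons_vec.
Qed.

HB.instance Definition _ := isMeasure.Build _ _ _ lebesgue_cons
  lebesgue_cons0 lebesgue_cons_ge0 lebesgue_cons_sigma_additive.

Let lebesgue_cons_sigma_finite : sigma_finite setT lebesgue_cons.
Proof.
have [F FT Foo] := product_sigma_finite (@lebesgue_measure R) mu.
exists (fun i => uncons_vec @^-1` F i).
  by rewrite -preimage_bigcup -FT preimage_setT.
move=> i; have [mFi Fioo] := Foo i; split.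
  by rewrite -[X in measurable X]setTI; exact: measurable_uncons_vec.
rewrite /lebesgue_cons /pushforward -comp_preimage.
by rewrite (_ : uncons_vec \o cons_vec = id)//; apply/funext => p; exact: cons_vecK.
Qed.

HB.instance Definition _ := Measure_isSigmaFinite.Build _ _ _ lebesgue_cons
  lebesgue_cons_sigma_finite.

End lebesgue_cons.

Fixpoint lebesgue_vec (R : realType) (N : nat) :
    {sigma_finite_measure set (N.-tuple R) -> \bar R} :=
  if N is N'.+1 then lebesgue_cons (lebesgue_vec R N')
  else @dirac _ _ ([tuple] : 0.-tuple R) R.

Section fourier.
Context {R : realType} {N : nat}.
Implicit Types (x xi v : N.-tuple R) (f g h : N.-tuple R -> R[i]).

Local Notation mu := (lebesgue_vec R N).

Definition dotp x xi : R := \sum_(i < N) tnth x i * tnth xi i.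

Definition opp_vec x : N.-tuple R := [tuple - tnth x i | i < N].

Definition cis (a : R) : R[i] := cos a +i* sin a.

Definition absc (z : R[i]) : R := Normc.normc z.

(* Lebesgue measurability: the sigma-algebra of R^N is the uncompleted Borel one,
   and a Lebesgue-measurable function is one equal a.e. to a Borel one. *)
Definition lebesgue_measurable f : Prop :=
  exists g, [/\ measurable_fun setT (fun x => complex.Re (g x)),
                measurable_fun setT (fun x => complex.Im (g x)) &
                f = g %[ae mu]].

Definition normLp (p : \bar R) f : \bar R :=
  Lnorm mu p (fun x => (absc (f x))%:E).

Definition Lp (p : \bar R) f : Prop :=
  lebesgue_measurable f /\ (normLp p f < +oo)%E.

Definition cintegral (D : set (N.-tuple R)) f : R[i] :=
  (\int[mu]_(x in D) complex.Re (f x)) +i* (\int[mu]_(x in D) complex.Im (f x)).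

Definition cube (k : nat) : set (N.-tuple R) :=
  [set x | forall i, `|tnth x i| <= k%:R].

Definition truncated_fourier (s : R) (k : nat) f xi : R[i] :=
  cintegral (cube k) (fun x => cis (s * (2 * pi * dotp xi x)) * f x).

(* g is the L_2-Fourier transform of f, with exponent -2 pi i xi.x for s = -1
   and +2 pi i xi.x for s = 1. On L_2 the defining integral is a limit in the
   mean of integrals over an exhaustion. *)
Definition is_fourier (s : R) f g : Prop :=
  [/\ Lp 2%:E f, Lp 2%:E g &
      normLp 2%:E (fun xi => truncated_fourier s k f xi - g xi)
        @[k --> \oo] --> 0%E].

(* One representative of the a.e.-class (0 when f is not in L_2). *)
Definition fourier f : N.-tuple R -> R[i] :=
  xget (fun=> 0) [set g | is_fourier (-1) f g].

Definition fourier_inv f : N.-tuple R -> R[i] :=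
  xget (fun=> 0) [set g | is_fourier 1 f g].

(* For real-valued f this is a.e. real when Psi is even, but a.e. purely
   imaginary when Psi is odd. *)
Definition multiplier_op (Psi : N.-tuple R -> R) f : N.-tuple R -> R[i] :=
  fourier_inv (fun xi => (Psi xi)%:C * fourier f xi).

(* The inverse transform is required to exist in L_2, rather than testing the
   value of [multiplier_op], whose default value 0 is trivially in L_2. *)
Definition multiplier_dom (Psi : N.-tuple R -> R) f : Prop :=
  Lp 2%:E f /\ exists w, is_fourier 1 (fun xi => (Psi xi)%:C * fourier f xi) w.

Definition intensity (n : R) (Omega : set (N.-tuple R))
    (phi Psi : N.-tuple R -> R) (t : R) x : R :=
  absc (fourier_inv (fun xi => cis (t * Psi xi) *
    fourier (fun y => (Num.sqrt n * \1_Omega y)%:C * cis (- phi y)) xi) x) ^+ 2.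

Definition diff_quotient (I : R -> N.-tuple R -> R) (tau : R) x : R :=
  (I tau x - I 0 x) / tau.

(* The slices I t are only defined up to null sets depending on t, so the
   derivative in t is the one of t |-> I t as a map into L_1. *)
Definition has_L1_derivative_at0 (I : R -> N.-tuple R -> R)
    (D : N.-tuple R -> R[i]) : Prop :=
  [/\ forall t, Lp 1%:E (fun x => (I t x)%:C), Lp 1%:E D &
      normLp 1%:E (fun x => (diff_quotient I tau x)%:C - D x)
        @[tau --> 0^'] --> 0%E].

End fourier.

(* Main.v *)
(* The square root of n times the pupil function is u = c - i s with c, s real, and
   the intensity is |U t|^2, where U t is the L_2-inverse transform of
   exp (i t Psi) F u. By the L_2-bound for the Fourier transform and dominated
   convergence, (U t - U 0) / t tends in L_2 to i W, W being the inverse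
   transform of Psi F u, so |U t|^2 is differentiable in L_1 at 0 with derivative
   2 Re (conj u i W). By linearity W = G c - i G s, and conjugating and reflecting
   the transforms shows that G maps real functions to real ones when Psi is even
   and to purely imaginary ones when Psi is odd; the two formulas follow.

   The L_2-theory rests on Parseval's identity damped by the weight
   exp (- e sum_i |xi_i|), whose transform is a product of Poisson kernels.
   Letting e tend to 0, Schur's test gives |F f| <= |f| for compactly supported f,
   hence F on L_2 by completeness. Testing against indicators of boxes, on which
   the Poisson integrals are explicit arctangents, gives Parseval's identity and
   the inversion formula. *)

Require Import Defs.
From HB Require Import structures.
From mathcomp Require Import all_boot all_order all_algebra.
From mathcomp Require Import all_classical all_reals all_analysis.
From mathcomp Require Import measurable_realfun.
From mathcomp Require Import complex ring lra.

Set Implicit Arguments.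
Unset Strict Implicit.
Unset Printing Implicit Defensive.

Import Order.TTheory GRing.Theory Num.Theory.
Import numFieldNormedType.Exports.

Local Open Scope classical_set_scope.
Local Open Scope ring_scope.
Local Open Scope complex_scope.

(** * Complex-valued integrals *)

(** The weight is a product over the coordinates, and in each coordinate its transform is a rational
    function with an arctangent as primitive. Bounds on the mass of the kernel and its limits over
    boxes are thus one-variable facts, multiplied up to R^N. Parseval's identity is set up with one
    function the indicator of a box; boxes form a pi-system generating the Borel sets, so pairings
    with them already determine an L_2 function almost everywhere.

    Lengths are measured by the squared norm [nrm2]. The constants lost in its triangle inequality
    are harmless, since the derivative at 0 only asks that the transform be bounded on L_2.

    [fourier] picks an arbitrary representative and [Psi] is any function, so statements about
    transforms go through the relation [is_fourier], which is stable under a.e. equality, and are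
    proved on Borel representatives.

    For odd [Psi] the functions G c and G s are purely imaginary; the factor ['i] in the second
    formula is what makes the derivative real. *)

Section complex_numbers.
Context {R : realType}.
Implicit Types (a b : R) (z w : R[i]).

Lemma eq_complexP z w :
  complex.Re z = complex.Re w -> complex.Im z = complex.Im w -> z = w.
Proof. by case: z w => [? ?] [? ?] /= -> ->. Qed.

Lemma ReM z w : complex.Re (z * w) =
  complex.Re z * complex.Re w - complex.Im z * complex.Im w.
Proof. by case: z w => [? ?] []. Qed.

Lemma ImM z w : complex.Im (z * w) =
  complex.Re z * complex.Im w + complex.Im z * complex.Re w.
Proof. by case: z w => [? ?] []. Qed.

Lemma ReD z w : complex.Re (z + w) = complex.Re z + complex.Re w.
Proof. by case: z w => [? ?] []. Qed.

Lemma ImD z w : complex.Im (z + w) = complex.Im z + complex.Im w.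
Proof. by case: z w => [? ?] []. Qed.

Lemma ReN z : complex.Re (- z) = - complex.Re z.
Proof. by case: z. Qed.

Lemma ImN z : complex.Im (- z) = - complex.Im z.
Proof. by case: z. Qed.

Lemma ReC a : complex.Re a%:C = a. Proof. by []. Qed.

Lemma ImC a : complex.Im a%:C = 0. Proof. by []. Qed.

Lemma Re_conjc z : complex.Re (conjc z) = complex.Re z.
Proof. by case: z. Qed.

Lemma Im_conjc z : complex.Im (conjc z) = - complex.Im z.
Proof. by case: z. Qed.

Lemma Re_cis a : complex.Re (cis a) = cos a. Proof. by []. Qed.

Lemma Im_cis a : complex.Im (cis a) = sin a. Proof. by []. Qed.

Definition ReImE := (ReM, ImM, ReD, ImD, ReN, ImN, ReC, ImC, Re_conjc, Im_conjc,
  Re_cis, Im_cis).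

Lemma absc_ge0 z : 0 <= absc z.
Proof. by case: z => x y; exact: sqrtr_ge0. Qed.

Lemma absc_sqr z : absc z ^+ 2 = complex.Re z ^+ 2 + complex.Im z ^+ 2.
Proof. by case: z => x y; rewrite /absc /= sqr_sqrtr// addr_ge0 ?sqr_ge0. Qed.

Lemma abscM z w : absc (z * w) = absc z * absc w.
Proof. exact: ComplexField.Normc.normcM. Qed.

Lemma absc0 : absc (0 : R[i]) = 0.
Proof. exact: ComplexField.Normc.normc0. Qed.

Lemma abscN z : absc (- z) = absc z.
Proof. exact: normcN. Qed.

Lemma abscB z w : absc (z - w) = absc (w - z).
Proof. by rewrite -abscN opprB. Qed.

Lemma abscD z w : absc (z + w) <= absc z + absc w.
Proof. exact: le_normcD. Qed.

Lemma absc0_eq0 z : absc z = 0 -> z = 0.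
Proof. exact: ComplexField.Normc.eq0_normc. Qed.

Lemma absc_cis a : absc (cis a) = 1.
Proof.
apply/eqP; rewrite -(@eqrXn2 _ 2) ?absc_ge0//.
by rewrite absc_sqr expr1n Re_cis Im_cis cos2Dsin2.
Qed.

Lemma absc_real a : absc a%:C = `|a|.
Proof. by rewrite /absc /= expr0n addr0 sqrtr_sqr. Qed.

Lemma absc_conj z : absc (conjc z) = absc z.
Proof. by case: z => x y; rewrite /absc /= sqrrN. Qed.

Lemma absc_i : absc ('i%C : R[i]) = 1.
Proof. by rewrite /absc /= expr0n expr1n add0r sqrtr1. Qed.

Lemma normr_Re_le z : `|complex.Re z| <= absc z.
Proof.
rewrite -(@ler_pXn2r _ 2) ?nnegrE ?absc_ge0//.
by rewrite absc_sqr real_normK ?num_real// lerDl sqr_ge0.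
Qed.

Lemma normr_Im_le z : `|complex.Im z| <= absc z.
Proof.
rewrite -(@ler_pXn2r _ 2) ?nnegrE ?absc_ge0//.
by rewrite absc_sqr real_normK ?num_real// lerDr sqr_ge0.
Qed.

Lemma sqr_abscD_le z w : absc (z + w) ^+ 2 <= 2 * absc z ^+ 2 + 2 * absc w ^+ 2.
Proof.
have := abscD z w; have := absc_ge0 (z + w).
have := absc_ge0 z; have := absc_ge0 w.
move: (absc z) (absc w) (absc (z + w)) => a b c b0 a0 c0 cab.
apply: (@le_trans _ _ ((a + b) ^+ 2)).
  by apply: lerXn2r; rewrite ?nnegrE ?addr_ge0.
by have := sqr_ge0 (a - b); lra.
Qed.

Lemma mul_conjc z : z * conjc z = (absc z ^+ 2)%:C.
Proof.
by apply: eq_complexP; rewrite !ReImE ?absc_sqr; ring.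
Qed.

Lemma conjcM z w : conjc (z * w) = conjc z * conjc w.
Proof. exact: rmorphM. Qed.

Lemma cisD a b : cis (a + b) = cis a * cis b.
Proof.
by apply: eq_complexP; rewrite !ReImE ?cosD ?sinD; ring.
Qed.

Lemma cis0 : cis (0 : R) = 1.
Proof. by apply: eq_complexP; rewrite !ReImE ?cos0 ?sin0. Qed.

Lemma conj_cis a : conjc (cis a) = cis (- a).
Proof. by apply: eq_complexP; rewrite !ReImE ?cosN ?sinN. Qed.

End complex_numbers.

Section ae_integral.
Context d (T : measurableType d) (R : realType).
Variable mu : {measure set T -> \bar R}.
Local Open Scope ereal_scope.

Import HBNNSimple.

(* No measurability is assumed: a simple function below f can be cut off on a
   null set where f and g differ without changing its integral. *)
Lemma ge0_ae_le_integral (f g : T -> \bar R) :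
  (forall x, 0 <= f x) -> (forall x, 0 <= g x) ->
  {ae mu, forall x, f x <= g x} -> \int[mu]_x f x <= \int[mu]_x g x.
Proof.
move=> f0 g0 [M [mM M0 fgM]].
rewrite (ge0_integralTE _ f0) (ge0_integralTE _ g0).
apply: ge_ereal_sup => _ [h /= hf <-].
pose h' : {nnsfun T >-> R} := mul_nnsfun h (indic_nnsfun R (measurableC mM)).
have h'E x : h' x = (h x * \1_(~` M) x)%R by [].
apply: (@le_trans _ _ (sintegral mu h')); last first.
  apply: ereal_sup_ubound; exists h' => // x.
  rewrite h'E indicE; case: (boolP (x \in ~` M)) => xM; last by rewrite mulr0.
  rewrite mulr1; apply: (le_trans (hf x)); apply: contrapT => nfg.
  by move: xM; rewrite inE; apply; exact: fgM.
rewrite -!integralT_nnsfun.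
have -> : \int[mu]_x (h x)%:E = \int[mu]_x (h' x)%:E; last by [].
apply: ge0_ae_eq_integral => //.
- exact/measurable_EFinP.
- by apply/measurable_EFinP/measurable_funM.
- by move=> x _; rewrite lee_fin.
- by move=> x _; rewrite lee_fin.
exists M; split => // x; apply: contra_notP => xM /= _; congr EFin.
by rewrite [RHS](_ : _ = (h x * \1_(~` M) x)%R)// indicE mem_set// mulr1.
Qed.

Lemma ae_eq_ge0_integral (f g : T -> \bar R) :
  (forall x, 0 <= f x) -> (forall x, 0 <= g x) ->
  f = g %[ae mu] -> \int[mu]_x f x = \int[mu]_x g x.
Proof.
move=> f0 g0 fg; apply/eqP; rewrite eq_le; apply/andP; split;
  apply: ge0_ae_le_integral => //; move: fg; apply: filterS => x /=;
  by move=> ->.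
Qed.

Lemma ae_eq_integralT (f g : T -> \bar R) :
  f = g %[ae mu] -> \int[mu]_x f x = \int[mu]_x g x.
Proof.
move=> fg; rewrite integralE [RHS]integralE.
congr (_ - _); apply: ae_eq_ge0_integral => //; move: fg;
  by apply: filterS => x /= fg _; rewrite ?funeposE ?funenegE fg.
Qed.

Lemma ae_eq_Lnorm (p : R) (f g : T -> \bar R) :
  f = g %[ae mu] -> Lnorm mu p%:E f = Lnorm mu p%:E g.
Proof.
move=> fg; rewrite unlock /=; congr (_ `^ _); apply: ae_eq_ge0_integral.
- by move=> x; exact: poweR_ge0.
- by move=> x; exact: poweR_ge0.
- by move: fg; apply: filterS => x /= fg _; rewrite fg.
Qed.

End ae_integral.

Section complex_measurable.
Context d (T : measurableType d) (R : realType).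
Implicit Types (f g : T -> R[i]).

Definition cmeasurable f : Prop :=
  measurable_fun setT (fun x => complex.Re (f x)) /\
  measurable_fun setT (fun x => complex.Im (f x)).

Lemma cmeasurable_cst (c : R[i]) : cmeasurable (fun=> c).
Proof. by split; exact: measurable_cst. Qed.

Lemma cmeasurableD f g :
  cmeasurable f -> cmeasurable g -> cmeasurable (fun x => f x + g x).
Proof.
move=> [rf jf] [rg jg]; split.
  by under eq_fun do rewrite ReD; exact: measurable_funD.
by under eq_fun do rewrite ImD; exact: measurable_funD.
Qed.

Lemma cmeasurableN f : cmeasurable f -> cmeasurable (fun x => - f x).
Proof.
move=> [rf jf]; split.
  by under eq_fun do rewrite ReN; exact: measurable_funN.
by under eq_fun do rewrite ImN; exact: measurable_funN.
Qed.

Lemma cmeasurableB f g :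
  cmeasurable f -> cmeasurable g -> cmeasurable (fun x => f x - g x).
Proof. by move=> mf mg; apply: cmeasurableD => //; exact: cmeasurableN. Qed.

Lemma cmeasurableM f g :
  cmeasurable f -> cmeasurable g -> cmeasurable (fun x => f x * g x).
Proof.
move=> [rf jf] [rg jg]; split.
  under eq_fun do rewrite ReM.
  by apply: measurable_funB; exact: measurable_funM.
under eq_fun do rewrite ImM.
by apply: measurable_funD; exact: measurable_funM.
Qed.

Lemma cmeasurable_conj f : cmeasurable f -> cmeasurable (fun x => conjc (f x)).
Proof.
move=> [rf jf]; split.
  by under eq_fun do rewrite Re_conjc.
by under eq_fun do rewrite Im_conjc; exact: measurable_funN.
Qed.

Lemma cmeasurable_real (g : T -> R) :
  measurable_fun setT g -> cmeasurable (fun x => (g x)%:C).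
Proof. by move=> mg; split => //=; exact: measurable_cst. Qed.

Lemma cmeasurable_cis (g : T -> R) :
  measurable_fun setT g -> cmeasurable (fun x => cis (g x)).
Proof.
move=> mg; split => /=.
  by apply: measurableT_comp mg; apply: continuous_measurable_fun;
    exact: continuous_cos.
by apply: measurableT_comp mg; apply: continuous_measurable_fun;
  exact: continuous_sin.
Qed.

Lemma measurable_absc f :
  cmeasurable f -> measurable_fun setT (fun x => absc (f x)).
Proof.
move=> [rf jf].
have -> : (fun x => absc (f x)) = (fun x =>
    Num.sqrt (complex.Re (f x) ^+ 2 + complex.Im (f x) ^+ 2)).
  by apply/funext => x; rewrite -absc_sqr sqrtr_sqr ger0_norm// absc_ge0.
apply: (measurableT_comp (f := @Num.sqrt R)).
  by apply: continuous_measurable_fun; exact: sqrt_continuous.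
by apply: measurable_funD; exact: measurable_funX.
Qed.

End complex_measurable.

Lemma cmeasurable_comp d1 d2 (T1 : measurableType d1) (T2 : measurableType d2)
    (R : realType) (f : T2 -> R[i]) (phi : T1 -> T2) :
  measurable_fun setT phi -> cmeasurable f -> cmeasurable (f \o phi).
Proof.
by move=> mphi [rf jf]; split; [exact: (measurableT_comp rf mphi)|
                                exact: (measurableT_comp jf mphi)].
Qed.

Section complex_integral.
Context d (T : measurableType d) (R : realType).
Variable mu : {measure set T -> \bar R}.
Implicit Types (f g : T -> R[i]).

Definition cintegrable f : Prop :=
  cmeasurable f /\ (\int[mu]_x (absc (f x))%:E < +oo)%E.

Definition cint f : R[i] :=
  (\int[mu]_x complex.Re (f x)) +i* (\int[mu]_x complex.Im (f x)).

Lemma Re_cint f : complex.Re (cint f) = \int[mu]_x complex.Re (f x).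
Proof. by []. Qed.

Lemma Im_cint f : complex.Im (cint f) = \int[mu]_x complex.Im (f x).
Proof. by []. Qed.

Lemma eq_cint f g : f =1 g -> cint f = cint g.
Proof. by move=> /funext ->. Qed.

Lemma ae_eq_cint f g : f = g %[ae mu] -> cint f = cint g.
Proof.
move=> fg; apply: eq_complexP => /=; rewrite /Rintegral; congr fine;
  apply: ae_eq_integralT; move: fg; apply: filterS => x /= fg _;
  by rewrite fg.
Qed.

Lemma cintegrable_le (g : T -> R) f : cmeasurable f ->
  measurable_fun setT g -> (forall x, absc (f x) <= g x) ->
  (\int[mu]_x (g x)%:E < +oo)%E -> cintegrable f.
Proof.
move=> mf mg fg goo; split => //; apply: le_lt_trans goo.
apply: ge0_le_integral => //.
- by move=> x _; rewrite lee_fin absc_ge0.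
- by apply/measurable_EFinP; exact: measurable_absc.
- exact/measurable_EFinP.
- by move=> x _; rewrite lee_fin.
Qed.

Lemma integrable_absc f : cintegrable f ->
  mu.-integrable setT (fun x => (absc (f x))%:E).
Proof.
move=> [mf foo]; apply/integrableP; split.
  by apply/measurable_EFinP; exact: measurable_absc.
by under eq_integral do rewrite /= ger0_norm ?absc_ge0//.
Qed.

Lemma integrable_Re f : cintegrable f ->
  mu.-integrable setT (fun x => (complex.Re (f x))%:E).
Proof.
move=> fi; apply: le_integrable (integrable_absc fi) => //.
  by apply/measurable_EFinP; exact: fi.1.1.
by move=> x _ /=; rewrite lee_fin [leRHS]ger0_norm ?absc_ge0// normr_Re_le.
Qed.

Lemma integrable_Im f : cintegrable f ->
  mu.-integrable setT (fun x => (complex.Im (f x))%:E).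
Proof.
move=> fi; apply: le_integrable (integrable_absc fi) => //.
  by apply/measurable_EFinP; exact: fi.1.2.
by move=> x _ /=; rewrite lee_fin [leRHS]ger0_norm ?absc_ge0// normr_Im_le.
Qed.

Lemma cintegrableD f g :
  cintegrable f -> cintegrable g -> cintegrable (fun x => f x + g x).
Proof.
move=> fi gi; have [mf _] := fi; have [mg _] := gi.
apply: (@cintegrable_le (fun x => absc (f x) + absc (g x))).
- exact: cmeasurableD.
- by apply: measurable_funD; exact: measurable_absc.
- by move=> x; exact: abscD.
under eq_integral do rewrite EFinD.
rewrite ge0_integralD//; last 4 first.
- by move=> x _; rewrite lee_fin absc_ge0.
- by apply/measurable_EFinP; exact: measurable_absc.
- by move=> x _; rewrite lee_fin absc_ge0.
- by apply/measurable_EFinP; exact: measurable_absc.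
by apply: lte_add_pinfty; [exact: fi.2|exact: gi.2].
Qed.

Lemma cintegrableMl (C : R) f g : cmeasurable g ->
  (forall x, absc (g x) <= C) -> cintegrable f ->
  cintegrable (fun x => g x * f x).
Proof.
move=> mg gC fi; have [mf foo] := fi.
apply: (@cintegrable_le (fun x => C * absc (f x))).
- exact: cmeasurableM.
- by apply: measurable_funM => //; exact: measurable_absc.
- by move=> x; rewrite abscM ler_wpM2r ?absc_ge0.
under eq_integral do rewrite EFinM.
rewrite integralZl//; last exact: integrable_absc.
rewrite -[X in (_ * X)%E]fineK -?EFinM ?ltry//.
by apply: integrable_fin_num => //; exact: integrable_absc.
Qed.

Lemma cintegrableZ (c : R[i]) f : cintegrable f ->
  cintegrable (fun x => c * f x).
Proof.
move=> fi; exact: (@cintegrableMl (absc c)).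
Qed.

Lemma cintegrable_conj f : cintegrable f -> cintegrable (fun x => conjc (f x)).
Proof.
move=> [mf foo]; split; first exact: cmeasurable_conj.
by under eq_integral do rewrite absc_conj.
Qed.

Lemma cintD f g : cintegrable f -> cintegrable g ->
  cint (fun x => f x + g x) = cint f + cint g.
Proof.
move=> fi gi; apply: eq_complexP; rewrite ?(ReD, ImD, ReM, ImM, Re_conjc, Im_conjc)
  ?(Re_cint, Im_cint).
  under eq_Rintegral do rewrite ReD.
  by rewrite RintegralD//; exact: integrable_Re.
under eq_Rintegral do rewrite ImD.
by rewrite RintegralD//; exact: integrable_Im.
Qed.

Lemma cintZ (c : R[i]) f : cintegrable f ->
  cint (fun x => c * f x) = c * cint f.
Proof.
move=> fi; have ri := integrable_Re fi; have ji := integrable_Im fi.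
have sZ (h : T -> R) a : mu.-integrable setT (EFin \o h) ->
    mu.-integrable setT (EFin \o (fun x => a * h x)).
  by move=> hi; exact: (integrableZl measurableT a hi).
apply: eq_complexP; rewrite ?(ReD, ImD, ReM, ImM, Re_conjc, Im_conjc) ?(Re_cint, Im_cint).
  under eq_Rintegral do rewrite ReM.
  by rewrite RintegralB ?RintegralZl//; exact: sZ.
under eq_Rintegral do rewrite ImM.
by rewrite RintegralD ?RintegralZl//; exact: sZ.
Qed.

Lemma cintB f g : cintegrable f -> cintegrable g ->
  cint (fun x => f x - g x) = cint f - cint g.
Proof.
move=> fi gi; have E h : (fun x => - h x) = (fun x => -1 * h x) :> (T -> R[i]).
  by apply/funext => x; rewrite mulN1r.
rewrite cintD//; last by rewrite E; exact: cintegrableZ.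
by rewrite E cintZ// mulN1r.
Qed.

Lemma cint_conj f : cintegrable f ->
  cint (fun x => conjc (f x)) = conjc (cint f).
Proof.
move=> fi; apply: eq_complexP; rewrite ?(ReD, ImD, ReM, ImM, Re_conjc, Im_conjc)
  ?(Re_cint, Im_cint).
  by under eq_Rintegral do rewrite Re_conjc.
under eq_Rintegral do rewrite Im_conjc -mulN1r.
by rewrite RintegralZl ?mulN1r//; exact: integrable_Im.
Qed.

(* The modulus is obtained by rotating the integral onto the real axis. *)
Lemma absc_cint_le f : cintegrable f ->
  ((absc (cint f))%:E <= \int[mu]_x (absc (f x))%:E)%E.
Proof.
move=> fi; set I := cint f; have [I0|I0] := eqVneq (absc I) 0.
  by rewrite I0 integral_ge0// => x _; rewrite lee_fin absc_ge0.
have Igt0 : 0 < absc I by rewrite lt_def I0 absc_ge0.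
rewrite -(@lee_pmul2l _ (absc I)%:E)// -EFinM -expr2.
have -> : absc I ^+ 2 = \int[mu]_x complex.Re (conjc I * f x).
  transitivity (complex.Re (cint (fun x => conjc I * f x))); last by [].
  by rewrite cintZ// -/I mulrC mul_conjc.
have ci := cintegrableZ (conjc I) fi.
rewrite fineK; last first.
  by apply: integrable_fin_num => //; exact: integrable_Re.
rewrite -integralZl//; last exact: integrable_absc.
apply: le_integral => //.
- exact: integrable_Re.
- by apply: integrableZl => //; exact: integrable_absc.
move=> x _; rewrite -EFinM lee_fin -[absc I]absc_conj -abscM.
exact: le_trans (ler_norm _) (normr_Re_le _).
Qed.

End complex_integral.

(** * Limits of non-negative quantities and of integrals *)

Section ereal_limits.
Context {R : realType} {T : Type} {F : set_system T} {FF : Filter F}.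

Lemma ge0_cvge0P (X : T -> \bar R) : (forall x, 0 <= X x)%E ->
  X @ F --> 0%E <-> forall e : R, 0 < e -> \forall x \near F, (X x <= e%:E)%E.
Proof.
move=> X0; split=> [X_0 e e0|X_0].
  have : nbhs 0%E [set y : \bar R | (y <= e%:E)%E].
    exists e => //= r /=; rewrite sub0r normrN => re.
    by rewrite lee_fin (le_trans (ler_norm _)) ?ltW.
  by move=> /X_0.
move=> A [e /= e0 eA].
(* Balls are open while the hypothesis bounds [X] non-strictly, hence the half. *)
have /X_0 : 0 < e / 2 by rewrite divr_gt0.
apply: filterS => x Xe.
have Xfin : X x \is a fin_num.
  by rewrite ge0_fin_numE ?X0// (le_lt_trans Xe) ?ltry.
suff : A (fine (X x))%:E by rewrite fineK.
apply: eA => /=; rewrite sub0r normrN ger0_norm ?fine_ge0//.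
by rewrite -lte_fin fineK// (le_lt_trans Xe)// lte_fin gtr_pMr// invf_lt1// ltr1n.
Qed.

Lemma ge0_cvge0_le (X Y : T -> \bar R) : (forall x, 0 <= X x)%E ->
  (\forall x \near F, X x <= Y x)%E -> Y @ F --> 0%E -> X @ F --> 0%E.
Proof.
move=> X0 XY Y_0; apply/ge0_cvge0P => // e e0.
have : nbhs 0%E [set y : \bar R | (y <= e%:E)%E].
  exists e => //= r /=; rewrite sub0r normrN => re.
  by rewrite lee_fin (le_trans (ler_norm _)) ?ltW.
move=> /Y_0; apply: filterS2 XY => x /=; exact: le_trans.
Qed.

End ereal_limits.

Section limit_of_integrals.
Context d (T : measurableType d) (R : realType).
Variable mu : {measure set T -> \bar R}.

Lemma dominated_integral_cvg0 (h : nat -> T -> R) (g : T -> R) :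
  (forall n, measurable_fun setT (h n)) -> (forall n x, 0 <= h n x) ->
  {ae mu, forall x, h n x @[n --> \oo] --> (0 : R)} ->
  mu.-integrable setT (EFin \o g) -> (forall n x, h n x <= g x) ->
  (\int[mu]_x (h n x)%:E)%E @[n --> \oo] --> 0%E.
Proof.
move=> mh h0 h_0 ig hg.
have [||||_ _] := @dominated_convergence _ T R mu setT measurableT
  (fun n x => (h n x)%:E) (cst 0%E) (EFin \o g) _ _ _ ig.
- by move=> n; exact/measurable_EFinP.
- exact: measurable_cst.
- move: h_0; apply: filterS => x hx _.
  exact: (cvg_comp _ _ hx).
- by apply: aeW => x n _ /=; rewrite lee_fin ger0_norm.
by rewrite integral0.
Qed.

(** Fatou's lemma under a bound that holds only eventually: the sequence is shifted by [K] so that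
    every term obeys it. *)
Lemma fatou_le (h : nat -> T -> R) (g : T -> R) (M : \bar R) :
  (forall n, measurable_fun setT (h n)) -> (forall n x, 0 <= h n x) ->
  (forall x, h n x @[n --> \oo] --> g x) ->
  (\forall n \near \oo, \int[mu]_x (h n x)%:E <= M)%E ->
  (\int[mu]_x (g x)%:E <= M)%E.
Proof.
move=> mh h0 hg [K _ KM].
pose h' n x := (h (n + K)%N x)%:E.
have h'g x : h' ^~ x @ \oo --> (g x)%:E.
  apply: (cvg_comp (fun n => h (n + K)%N x) EFin (G := nbhs (g x))) => //.
  by have := hg x; rewrite -(cvg_shiftn K).
have := @fatou _ T R mu setT measurableT h'.
rewrite (eq_integral (fun x => (g x)%:E)); last first.
  by move=> x _; rewrite (cvg_limn_einf_sup (h'g x)).1.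
move=> fat; apply: (le_trans (fat _ _)).
- by move=> n; exact/measurable_EFinP.
- by move=> n x _; rewrite lee_fin.
rewrite limn_einf_lim; apply: lime_le; first exact: is_cvg_einfs.
apply: nearW => n.
apply: (@le_trans _ _ (\int[mu]_x h' n x)%E).
  by apply: ereal_inf_lbound; exists n => //=.
by apply: KM => /=; exact: leq_addl.
Qed.

End limit_of_integrals.

(** * Square-integrable functions *)

Section square_integral.
Context d (T : measurableType d) (R : realType).
Variable mu : {measure set T -> \bar R}.
Implicit Types (f g h : T -> R[i]).

Definition nrm2 f : \bar R := (\int[mu]_x (absc (f x) ^+ 2)%:E)%E.

Lemma nrm2_ge0 f : (0 <= nrm2 f)%E.
Proof. by apply: integral_ge0 => x _; rewrite lee_fin sqr_ge0. Qed.

Lemma ae_eq_nrm2 f g : f = g %[ae mu] -> nrm2 f = nrm2 g.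
Proof.
move=> fg; apply: ae_eq_ge0_integral => [x|x|].
- by rewrite lee_fin sqr_ge0.
- by rewrite lee_fin sqr_ge0.
by move: fg; apply: filterS => x /= fg _; rewrite fg.
Qed.

Lemma nrm2_le f g : {ae mu, forall x, absc (f x) <= absc (g x)} ->
  (nrm2 f <= nrm2 g)%E.
Proof.
move=> fg; apply: ge0_ae_le_integral => [x|x|].
- by rewrite lee_fin sqr_ge0.
- by rewrite lee_fin sqr_ge0.
move: fg; apply: filterS => x fg.
by rewrite lee_fin lerXn2r ?nnegrE ?absc_ge0.
Qed.

Lemma measurable_absc2 f : cmeasurable f ->
  measurable_fun setT (fun x => absc (f x) ^+ 2).
Proof. by move=> mf; apply: measurable_funX; exact: measurable_absc. Qed.

Lemma nrm2Z (c : R[i]) f : cmeasurable f ->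
  nrm2 (fun x => (c * f x)%R) = ((absc c ^+ 2)%:E * nrm2 f)%E.
Proof.
move=> mf; rewrite /nrm2 -ge0_integralZl_EFin ?sqr_ge0//.
- by apply: eq_integral => x _; rewrite abscM exprMn EFinM.
- by move=> x _; rewrite lee_fin sqr_ge0.
- by apply/measurable_EFinP; exact: measurable_absc2.
Qed.

Lemma nrm2B f g : nrm2 (fun x => (f x - g x)%R) = nrm2 (fun x => (g x - f x)%R).
Proof. by apply: eq_integral => x _; rewrite abscB. Qed.

Lemma nrm2D_le f g : cmeasurable f -> cmeasurable g ->
  (nrm2 (fun x => (f x + g x)%R) <= 2%:E * nrm2 f + 2%:E * nrm2 g)%E.
Proof.
move=> mf mg; have m2f := measurable_absc2 mf; have m2g := measurable_absc2 mg.
have mZ (h : T -> R) : measurable_fun setT h ->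
    measurable_fun setT (fun x => (2 * h x)%:E).
  by move=> mh; apply/measurable_EFinP; exact: measurable_funM.
rewrite /nrm2 -!ge0_integralZl_EFin//; last 4 first.
- by move=> x _; rewrite lee_fin sqr_ge0.
- exact/measurable_EFinP.
- by move=> x _; rewrite lee_fin sqr_ge0.
- exact/measurable_EFinP.
rewrite -ge0_integralD//; last 4 first.
- by move=> x _; rewrite -EFinM lee_fin mulr_ge0 ?sqr_ge0.
- exact: mZ.
- by move=> x _; rewrite -EFinM lee_fin mulr_ge0 ?sqr_ge0.
- exact: mZ.
apply: ge0_ae_le_integral => [x|x|].
- by rewrite lee_fin sqr_ge0.
- by rewrite -!EFinM -EFinD lee_fin; apply: addr_ge0; apply: mulr_ge0 => //;
  exact: sqr_ge0.
by apply: aeW => x; rewrite -!EFinM -EFinD lee_fin sqr_abscD_le.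
Qed.

Lemma nrm2D_lty f g : cmeasurable f -> cmeasurable g ->
  (nrm2 f < +oo)%E -> (nrm2 g < +oo)%E ->
  (nrm2 (fun x => (f x + g x)%R) < +oo)%E.
Proof.
move=> mf mg foo goo; apply: le_lt_trans (nrm2D_le mf mg) _.
by apply: lte_add_pinfty; apply: lte_mul_pinfty; rewrite ?lee_fin.
Qed.

Lemma nrm2N f : nrm2 (fun x => (- f x)%R) = nrm2 f.
Proof. by apply: eq_integral => x _; rewrite abscN. Qed.

Lemma nrm2B_lty f g : cmeasurable f -> cmeasurable g ->
  (nrm2 f < +oo)%E -> (nrm2 g < +oo)%E ->
  (nrm2 (fun x => (f x - g x)%R) < +oo)%E.
Proof.
move=> mf mg foo goo; apply: nrm2D_lty => //; first exact: cmeasurableN.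
by rewrite nrm2N.
Qed.

(* nrm2 is the squared norm, so the triangle inequality costs a factor 2. *)
Lemma nrm2_triangle f g h : cmeasurable f -> cmeasurable g -> cmeasurable h ->
  (nrm2 (fun x => (f x - h x)%R) <=
   2%:E * nrm2 (fun x => (f x - g x)%R) + 2%:E * nrm2 (fun x => (g x - h x)%R))%E.
Proof.
move=> mf mg mh.
have := nrm2D_le (cmeasurableB mf mg) (cmeasurableB mg mh).
apply: le_trans; apply: nrm2_le; apply: aeW => x.
by rewrite addrA subrK.
Qed.

Lemma nrm2_eq0 f : cmeasurable f -> nrm2 f = 0%E -> f = (fun=> 0) %[ae mu].
Proof.
move=> mf f0.
have := @ae_eq_integral_abs _ T R mu setT measurableT
  (fun x => (absc (f x) ^+ 2)%:E).
move=> /(_ _)[|+ _].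
  by apply/measurable_EFinP; exact: measurable_absc2.
under eq_integral do rewrite abse_EFin ger0_norm ?sqr_ge0//.
move=> /(_ f0); apply: filterS => x /= /(_ I)[] fx _.
by apply: absc0_eq0; apply/eqP; rewrite -sqrf_eq0 fx.
Qed.

Lemma nrm2_lim_unique f g h (u : nat -> T -> R[i]) :
  (forall k, cmeasurable (u k)) -> cmeasurable g -> cmeasurable h ->
  nrm2 (fun x => (u k x - g x)%R) @[k --> \oo] --> 0%E ->
  nrm2 (fun x => (u k x - h x)%R) @[k --> \oo] --> 0%E -> g = h %[ae mu].
Proof.
move=> mu_ mg mh /(@ge0_cvge0P _ _ _ _ _ (fun=> nrm2_ge0 _)) ug
  /(@ge0_cvge0P _ _ _ _ _ (fun=> nrm2_ge0 _)) uh.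
suff gh0 : nrm2 (fun x => (g x - h x)%R) = 0%E.
  have := nrm2_eq0 (cmeasurableB mg mh) gh0.
  by apply: filterS => x /= /(_ I)/eqP + _; rewrite subr_eq0 => /eqP.
apply/eqP; rewrite eq_le nrm2_ge0 andbT; apply/lee_addgt0Pr => e e0.
(* A quarter each, because [nrm2_triangle] counts both distances twice. *)
rewrite add0e; have e4 : 0 < e / 4 by rewrite divr_gt0.
near \oo => k.
apply: (le_trans (nrm2_triangle mg (mu_ k) mh)).
have -> : e%:E = (2%:E * (e / 4)%:E + 2%:E * (e / 4)%:E)%E.
  by rewrite -!EFinM -EFinD; congr EFin; field.
apply: leeD; rewrite lee_pmul2l//.
- by rewrite nrm2B; near: k; exact: ug.
- by near: k; exact: uh.
Unshelve. all: end_near. Qed.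

(* AM-GM *)
Lemma absc_mul_le (eta : R) (z w : R[i]) : 0 < eta ->
  absc (z * w) <= eta * absc z ^+ 2 + eta^-1 * absc w ^+ 2.
Proof.
move=> eta0; rewrite abscM; move: (absc z) (absc w) => a b.
(* A sum of squares equal to twice the difference of the two sides. *)
have : 0 <= eta^-1 * ((eta * a - b) ^+ 2 + (eta * a) ^+ 2 + b ^+ 2).
  by rewrite mulr_ge0 ?invr_ge0 ?addr_ge0 ?sqr_ge0 ?ltW.
have -> : eta^-1 * ((eta * a - b) ^+ 2 + (eta * a) ^+ 2 + b ^+ 2) =
    2 * (eta * a ^+ 2 + eta^-1 * b ^+ 2 - a * b).
  by field; rewrite gt_eqF.
by rewrite pmulr_rge0// subr_ge0.
Qed.

(** Plays the part of Cauchy-Schwarz: the free parameter [eta] can be chosen to make the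
    contribution of [g] small, after which that of [f] is made small. *)
Lemma integral_absc_mul_le (eta : R) f g : 0 < eta ->
  cmeasurable f -> cmeasurable g ->
  (\int[mu]_x (absc (f x * g x)%R)%:E <=
   eta%:E * nrm2 f + eta^-1%:E * nrm2 g)%E.
Proof.
move=> eta0 mf mg.
have etaV0 : 0 < eta^-1 by rewrite invr_gt0.
have m2f := measurable_absc2 mf; have m2g := measurable_absc2 mg.
have mZ (c : R) (h : T -> R) : measurable_fun setT h ->
    measurable_fun setT (fun x => (c * h x)%:E).
  by move=> mh; apply/measurable_EFinP; exact: measurable_funM.
rewrite /nrm2 -!ge0_integralZl_EFin ?(ltW eta0) ?(ltW etaV0)//; last 4 first.
- by move=> x _; rewrite lee_fin sqr_ge0.
- exact/measurable_EFinP.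
- by move=> x _; rewrite lee_fin sqr_ge0.
- exact/measurable_EFinP.
rewrite -ge0_integralD//; last 4 first.
- by move=> x _; rewrite -EFinM lee_fin; apply: mulr_ge0; rewrite ?sqr_ge0// ltW.
- exact: mZ.
- by move=> x _; rewrite -EFinM lee_fin; apply: mulr_ge0; rewrite ?sqr_ge0// ltW.
- exact: mZ.
apply: ge0_ae_le_integral => [x|x|].
- by rewrite lee_fin absc_ge0.
- rewrite -!EFinM -EFinD lee_fin; apply: addr_ge0; apply: mulr_ge0;
  by rewrite ?sqr_ge0// ltW.
by apply: aeW => x; rewrite -!EFinM -EFinD lee_fin absc_mul_le.
Qed.

Lemma cintegrable_mul f g : cmeasurable f -> cmeasurable g ->
  (nrm2 f < +oo)%E -> (nrm2 g < +oo)%E ->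
  cintegrable mu (fun x => f x * g x).
Proof.
move=> mf mg foo goo; split; first exact: cmeasurableM.
apply: le_lt_trans (integral_absc_mul_le ltr01 mf mg) _.
by rewrite invr1 !mul1e; exact: lte_add_pinfty.
Qed.

Lemma integral_absc_mul_cvg0 {I : Type} {F : set_system I} {FF : Filter F}
    (u : I -> T -> R[i]) g :
  (forall k, cmeasurable (u k)) -> cmeasurable g -> (nrm2 g < +oo)%E ->
  nrm2 (u k) @[k --> F] --> 0%E ->
  (\int[mu]_x (absc (u k x * g x)%R)%:E)%E @[k --> F] --> 0%E.
Proof.
move=> mu_ mg goo /(@ge0_cvge0P _ _ _ _ _ (fun=> nrm2_ge0 _)) u0.
apply/ge0_cvge0P => [k|e e0].
  by apply: integral_ge0 => x _; rewrite lee_fin absc_ge0.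
have gfin : nrm2 g \is a fin_num by rewrite ge0_fin_numE ?nrm2_ge0.
set G := fine (nrm2 g); have G0 : 0 <= G by rewrite fine_ge0 ?nrm2_ge0.
(* Chosen so that [eta^-1 * G] is at most [e / 2]; the [+ 1] keeps [eta] positive when [G = 0]. *)
pose eta := 2 * (G + 1) / e.
have eta0 : 0 < eta by rewrite divr_gt0// mulr_gt0// ltr_pwDr.
near=> k.
apply: (le_trans (integral_absc_mul_le eta0 (mu_ k) mg)).
rewrite -[X in (_ + _ * X)%E]fineK// -/G.
apply: (@le_trans _ _ (eta%:E * (e / (2 * eta))%:E + (eta^-1 * G)%:E)%E).
  apply: leeD => //; rewrite lee_pmul2l//.
  by near: k; apply: u0; rewrite divr_gt0// mulr_gt0.
rewrite -EFinM -EFinD lee_fin.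
have -> : eta * (e / (2 * eta)) = e / 2 by field; rewrite gt_eqF.
have -> : eta^-1 * G = e / 2 * (G / (G + 1)).
  by rewrite /eta; field; rewrite !gt_eqF// ltr_pwDr.
have : G / (G + 1) <= 1 by rewrite ler_pdivrMr ?ltr_pwDr// mul1r lerDl.
by move=> ?; nra.
Unshelve. all: end_near. Qed.

(** Continuity of the L_2 pairing in one argument, by which identities for truncated functions pass
    to all of L_2. *)
Lemma cint_mul_cvg (u : nat -> T -> R[i]) f g :
  (forall k, cmeasurable (u k)) -> cmeasurable f -> cmeasurable g ->
  (forall k, nrm2 (u k) < +oo)%E -> (nrm2 f < +oo)%E -> (nrm2 g < +oo)%E ->
  nrm2 (fun x => (u k x - f x)%R) @[k --> \oo] --> 0%E ->
  (absc (cint mu (fun x => u k x * g x) - cint mu (fun x => f x * g x)))%:E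
    @[k --> \oo] --> 0%E.
Proof.
move=> mu_ mf mg uoo foo goo uf.
have I0 := integral_absc_mul_cvg0 (FF := eventually_filter)
  (fun k => cmeasurableB (mu_ k) mf) mg goo uf.
apply: (ge0_cvge0_le _ _ I0) => [k|]; first by rewrite lee_fin absc_ge0.
apply: nearW => k.
have iu := cintegrable_mul (mu_ k) mg (uoo k) goo.
have i_f := cintegrable_mul mf mg foo goo.
rewrite -cintB//.
have -> : (fun x => u k x * g x - f x * g x) = (fun x => (u k x - f x) * g x).
  by apply/funext => x; rewrite mulrBl.
apply: absc_cint_le; apply: cintegrable_mul => //.
- exact: cmeasurableB.
- exact: nrm2B_lty.
Qed.

End square_integral.

(** The telescoping series of [w] converges absolutely, and its partial sums are [w] up to the
    constant [w 0]. *)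
Lemma cvgn_bounded_variation {R : realType} (w : nat -> R) (C : R) :
  (forall m, \sum_(0 <= j < m) `|w j.+1 - w j| <= C) -> cvgn w.
Proof.
move=> wC.
have /normed_cvg ctel : cvgn [normed series (telescope w)].
  apply: nondecreasing_is_cvgn.
    by apply: nondecreasing_series => j _ _ /=; exact: normr_ge0.
  by exists C => _ [m _ <-]; exact: wC.
have -> : w = (fun n => w 0%N + series (telescope w) n).
  by apply/funext => n; rewrite -eq_sum_telescope.
by apply: is_cvgD ctel; exact: is_cvg_cst.
Qed.

(** * Completeness of L_2 *)

Section l2_complete.
Context d (T : measurableType d) (R : realType).
Variable mu : {measure set T -> \bar R}.
Variable u : nat -> T -> R[i].
Hypothesis mu_ : forall k, cmeasurable (u k).

(* Along a subsequence with nrm2 (u_(j+1) - u_j) <= 4^-j, the series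
   sum_j 2^j |u_(j+1) - u_j|^2 has finite integral, and
   |z| <= 2^-j + 2^j |z|^2 then gives pointwise a.e. convergence. *)
Let fast_cauchy_cvg (n : nat -> nat) :
  (forall j, nrm2 mu (fun x => (u (n j.+1) x - u (n j) x)%R) <=
             ((4^-1) ^+ j)%:E)%E ->
  exists g (G : set T), [/\ cmeasurable g, measurable G, mu (~` G) = 0%E &
    forall x, complex.Re (u (n j) x * (\1_G x)%:C) @[j --> \oo]
                --> complex.Re (g x) /\
              complex.Im (u (n j) x * (\1_G x)%:C) @[j --> \oo]
                --> complex.Im (g x)].
Proof.
move=> un; pose dd j x := u (n j.+1) x - u (n j) x.
have md j : cmeasurable (dd j) by exact: cmeasurableB.
pose s j x : R := 2 ^+ j * absc (dd j x) ^+ 2.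
have s0 j x : 0 <= s j x by apply: mulr_ge0; rewrite ?sqr_ge0 ?exprn_ge0.
have ms j : measurable_fun setT (s j).
  by apply: measurable_funM => //; exact: measurable_absc2.
pose S x := (\sum_(0 <= j <oo) (s j x)%:E)%E.
have mes j : measurable_fun setT (fun x => (s j x)%:E).
  exact/measurable_EFinP.
have es0 j x : (0 <= (s j x)%:E)%E by rewrite lee_fin.
have mS : measurable_fun setT S.
  exact: (ge0_emeasurable_sum (P := xpredT) (fun j x _ _ => es0 j x)).
have S0 x : (0 <= S x)%E by exact: nneseries_ge0.
have Soo : (\int[mu]_x S x < +oo)%E.
  rewrite integral_nneseries//.
  apply: (@le_lt_trans _ _ 2%:E); last exact: ltry.
  apply: lime_le.
    by apply: is_cvg_nneseries => j _ _; apply: integral_ge0 => x _; exact: es0.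
  apply: nearW => m.
  apply: (@le_trans _ _ (\sum_(0 <= j < m) (2^-1 ^+ j)%:E)%E).
    apply: lee_sum => j _.
    under eq_integral do rewrite EFinM.
    rewrite ge0_integralZl_EFin ?exprn_ge0//; last 2 first.
    - by move=> x _; rewrite lee_fin sqr_ge0.
    - by apply/measurable_EFinP; exact: measurable_absc2.
    apply: (@le_trans _ _ ((2 ^+ j)%:E * (4^-1 ^+ j)%:E)%E).
      by rewrite lee_pmul2l ?lte_fin ?exprn_gt0//; exact: un.
    rewrite -EFinM lee_fin -exprMn.
    by have -> : 2 * 4^-1 = 2^-1 :> R by field.
  rewrite sumEFin lee_fin.
  have := @geometric_le_lim R m 1 2^-1 ler01 _ _.
  have -> : 1 * (1 - 2^-1)^-1 = 2 :> R by field.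
  rewrite /series /=; under eq_bigr do rewrite mul1r.
  by apply; rewrite ?invr_gt0// ger0_norm ?invf_lt1 ?ltr1n.
pose G := [set x | (S x < +oo)%E].
have mG : measurable G.
  by rewrite -[G]setTI; exact: emeasurable_fun_infty_o.
have G0 : mu (~` G) = 0%E.
  have iS : mu.-integrable setT S.
    by apply/integrableP; split => //; under eq_integral do rewrite gee0_abs//.
  have /negligibleP := integrable_ae measurableT iS.
  rewrite (_ : ~` _ = ~` G); first by apply; exact: measurableC.
  apply/seteqP; split=> x /=; apply: contra_not.
    by rewrite /G /= ge0_fin_numE.
  by move=> /(_ I); rewrite /G /= ge0_fin_numE.
(* Cutting off outside [G] makes the sequence converge at every point, so that its pointwise limit
   is measurable. *)
pose v j x := u (n j) x * (\1_G x)%:C.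
have mv j : cmeasurable (v j).
  by apply: cmeasurableM => //; apply: cmeasurable_real; exact: measurable_indic.
have vC x : exists C : R,
    forall m, \sum_(0 <= j < m) absc (v j.+1 x - v j x) <= C.
  have [xG|xG] := boolP (x \in G); last first.
    exists 0 => m; rewrite big1// => j _.
    by rewrite /v indicE (negbTE xG) !mulr0 subrr absc0.
  exists (2 + fine (S x)) => m.
  apply: (@le_trans _ _ (\sum_(0 <= j < m) (2^-1 ^+ j + s j x))).
    apply: ler_sum => j _; rewrite /v indicE xG !mulr1 -/(dd j x).
    have eta0 : 0 < (2 ^+ j)^-1 :> R by rewrite invr_gt0 exprn_gt0.
    have := absc_mul_le 1 (dd j x) eta0.
    by rewrite mul1r -[X in absc X ^+ 2](_ : 1%:C = _)// absc_real normr1 expr1n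
      mulr1 invrK -exprVn.
  rewrite big_split /= lerD//.
    have := @geometric_le_lim R m 1 2^-1 ler01 _ _.
    have -> : 1 * (1 - 2^-1)^-1 = 2 :> R by field.
    rewrite /series /=; under eq_bigr do rewrite mul1r.
    by apply; rewrite ?invr_gt0// ger0_norm ?invf_lt1 ?ltr1n.
  rewrite -lee_fin fineK; last by rewrite ge0_fin_numE//; move: xG; rewrite inE.
  by rewrite -sumEFin; exact: nneseries_lim_ge.
have cRe x : cvgn (fun j => complex.Re (v j x)).
  have [C xC] := vC x; apply: (@cvgn_bounded_variation _ _ C) => m.
  apply: le_trans (xC m); apply: ler_sum => j _.
  by rewrite -ReN -ReD normr_Re_le.
have cIm x : cvgn (fun j => complex.Im (v j x)).
  have [C xC] := vC x; apply: (@cvgn_bounded_variation _ _ C) => m.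
  apply: le_trans (xC m); apply: ler_sum => j _.
  by rewrite -ImN -ImD normr_Im_le.
pose g x := limn (fun j => complex.Re (v j x)) +i*
            limn (fun j => complex.Im (v j x)).
exists g, G; split => //.
  split.
    apply: (@measurable_fun_cvg _ _ _ _ (fun j x => complex.Re (v j x))).
      by move=> j; exact: (mv j).1.
    by move=> x _; exact: cRe.
  apply: (@measurable_fun_cvg _ _ _ _ (fun j x => complex.Im (v j x))).
    by move=> j; exact: (mv j).2.
  by move=> x _; exact: cIm.
by move=> x; split; [exact: cRe|exact: cIm].
Qed.

(** Riesz-Fischer: a rapidly converging subsequence supplies the limit, and Fatou's lemma bounds its
    distance to every late term of the full sequence. *)
Lemma nrm2_complete :
  (forall e : R, 0 < e -> exists K, forall k l, (K <= k)%N -> (K <= l)%N ->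
    (nrm2 mu (fun x => (u k x - u l x)%R) <= e%:E)%E) ->
  exists2 g, cmeasurable g &
    nrm2 mu (fun x => u k x - g x) @[k --> \oo] --> 0%E.
Proof.
move=> uC.
have /choice[K KP] : forall j, exists K, forall k l, (K <= k)%N -> (K <= l)%N ->
    (nrm2 mu (fun x => (u k x - u l x)%R) <= ((4^-1) ^+ j)%:E)%E.
  by move=> j; apply: uC; rewrite exprn_gt0// invr_gt0.
(* The sum makes [n] nondecreasing and at least [K j]; the summand [j] makes it tend to infinity. *)
pose n j := (j + \sum_(i < j.+1) K i)%N.
have Kn j : (K j <= n j)%N.
  by rewrite /n big_ord_recr /= addnA leq_addl.
have nS j : (n j <= n j.+1)%N.
  by rewrite /n [in leqRHS]big_ord_recr /= leq_add// leq_addr.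
have [|g [G [mg mG G0 ung]]] := @fast_cauchy_cvg n.
  by move=> j; apply: KP => //; exact: leq_trans (nS j).
exists g => //; apply/ge0_cvge0P => [k|e e0]; first exact: nrm2_ge0.
have [M MP] := uC e e0; exists M => // k /= Mk.
pose v j x := u (n j) x * (\1_G x)%:C.
have mv j : cmeasurable (v j).
  by apply: cmeasurableM => //; apply: cmeasurable_real; exact: measurable_indic.
(* Here [k] is fixed and the limit is taken along the subsequence. *)
apply: (@fatou_le _ _ _ mu (fun j x => absc (u k x - v j x) ^+ 2)).
- by move=> j; apply: measurable_absc2; exact: cmeasurableB.
- by move=> j x; exact: sqr_ge0.
- move=> x; have [vr vi] := ung x.
  have rB : complex.Re (u k x) - complex.Re (v j x) @[j --> \oo] -->
      complex.Re (u k x) - complex.Re (g x).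
    by apply: cvgB => //; exact: cvg_cst.
  have iB : complex.Im (u k x) - complex.Im (v j x) @[j --> \oo] -->
      complex.Im (u k x) - complex.Im (g x).
    by apply: cvgB => //; exact: cvg_cst.
  have E z : absc (u k x - z) ^+ 2 =
      (complex.Re (u k x) - complex.Re z) * (complex.Re (u k x) - complex.Re z) +
      (complex.Im (u k x) - complex.Im z) * (complex.Im (u k x) - complex.Im z).
    by rewrite absc_sqr !(ReD, ImD, ReN, ImN) !expr2.
  rewrite (eq_cvg _ _ (fun j => E (v j x))) E.
  by have := cvgD (cvgM rB rB) (cvgM iB iB); exact.
- exists M => // j /= Mj.
  rewrite -/(nrm2 mu (fun x => u k x - v j x)).
  rewrite (@ae_eq_nrm2 _ _ _ mu _ (fun x => u k x - u (n j) x)).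
    apply: MP => //; apply: leq_trans Mj _; exact: leq_addr.
  exists (~` G); split=> //; first exact: measurableC.
  move=> x /=; apply: contra_not => Gx _.
  by rewrite /v indicE mem_set// mulr1.
Qed.

End l2_complete.

(** * Integration on R^N *)

Section fubini.
Context d1 d2 (T1 : measurableType d1) (T2 : measurableType d2) (R : realType).
Variable m1 : {sigma_finite_measure set T1 -> \bar R}.
Variable m2 : {sigma_finite_measure set T2 -> \bar R}.

Lemma measurable_Rintegral2 (f : T1 * T2 -> R) : measurable_fun setT f ->
  measurable_fun setT (fun x => \int[m2]_y f (x, y)).
Proof.
move=> mf; apply: (measurableT_comp (fine_measurable measurableT)).
have mef : measurable_fun setT (EFin \o f) by exact/measurable_EFinP.
under eq_fun do rewrite integralE.
apply: emeasurable_funB.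
  have := @measurable_fun_fubini_tonelli_F _ _ _ _ _ m2 _
    (measurable_funepos mef) (fun=> funepos_ge0 _ _).
  congr measurable_fun; apply/funext => x; apply: eq_integral => y _.
  by rewrite !funeposE.
have := @measurable_fun_fubini_tonelli_F _ _ _ _ _ m2 _
  (measurable_funeneg mef) (fun=> funeneg_ge0 _ _).
congr measurable_fun; apply/funext => x; apply: eq_integral => y _.
  by rewrite !funenegE.
Qed.

Lemma cmeasurable_cint (f : T1 -> T2 -> R[i]) :
  cmeasurable (fun z : T1 * T2 => f z.1 z.2) ->
  cmeasurable (fun x => cint m2 (f x)).
Proof.
move=> [rf jf]; split.
  exact: (measurable_Rintegral2 rf).
exact: (measurable_Rintegral2 jf).
Qed.

Let Rfubini (f : T1 -> T2 -> R) :
  (m1 \x m2)%E.-integrable setT (fun z : T1 * T2 => (f z.1 z.2)%:E) ->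
  (forall x, m2.-integrable setT (fun y => (f x y)%:E)) ->
  (forall y, m1.-integrable setT (fun x => (f x y)%:E)) ->
  \int[m1]_x \int[m2]_y f x y = \int[m2]_y \int[m1]_x f x y.
Proof.
move=> f12 f2 f1; rewrite /Rintegral; congr fine.
under eq_integral do rewrite fineK ?integrable_fin_num//.
under [RHS]eq_integral do rewrite fineK ?integrable_fin_num//.
exact: (Fubini f12).
Qed.

(** Domination by a product of integrable functions gives integrability on the product space and on
    every single section, so that no exceptional null set of sections has to be tracked. *)
Lemma cint_fubini (f : T1 -> T2 -> R[i]) (g : T1 -> R) (h : T2 -> R) :
  cmeasurable (fun z : T1 * T2 => f z.1 z.2) ->
  measurable_fun setT g -> measurable_fun setT h ->
  (forall x, 0 <= g x) -> (forall y, 0 <= h y) ->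
  (\int[m1]_x (g x)%:E < +oo)%E -> (\int[m2]_y (h y)%:E < +oo)%E ->
  (forall x y, absc (f x y) <= g x * h y) ->
  cint m1 (fun x => cint m2 (f x)) = cint m2 (fun y => cint m1 (f^~ y)).
Proof.
move=> mf mg mh g0 h0 goo hoo fgh.
have f2 x : cintegrable m2 (f x).
  apply: (@cintegrable_le _ _ _ _ (fun y => g x * h y)).
  - exact: (cmeasurable_comp (measurable_pair1 x) mf).
  - exact: measurable_funM.
  - exact: fgh.
  under eq_integral do rewrite EFinM.
  rewrite ge0_integralZl_EFin ?lte_mul_pinfty ?lee_fin//.
    by move=> y _; rewrite lee_fin.
  exact/measurable_EFinP.
have f1 y : cintegrable m1 (f^~ y).
  apply: (@cintegrable_le _ _ _ _ (fun x => g x * h y)).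
  - exact: (cmeasurable_comp (measurable_pair2 y) mf).
  - exact: measurable_funM.
  - by move=> x; exact: fgh.
  under eq_integral do rewrite mulrC EFinM.
  rewrite ge0_integralZl_EFin ?lte_mul_pinfty ?lee_fin//.
    by move=> x _; rewrite lee_fin.
  exact/measurable_EFinP.
have f12 : cintegrable (m1 \x m2)%E (fun z : T1 * T2 => f z.1 z.2).
  apply: (@cintegrable_le _ _ _ _ (fun z : T1 * T2 => g z.1 * h z.2)) => //.
  - apply: measurable_funM.
      exact: (measurableT_comp mg measurable_fst).
    exact: (measurableT_comp mh measurable_snd).
  rewrite fubini_tonelli1; last 2 first.
  - apply/measurable_EFinP; apply: measurable_funM.
      exact: (measurableT_comp mg measurable_fst).
    exact: (measurableT_comp mh measurable_snd).
  - by move=> z; rewrite lee_fin mulr_ge0.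
  rewrite /fubini_F /=.
  under eq_integral => x _.
    under eq_integral do rewrite EFinM.
    rewrite ge0_integralZl_EFin//; last 2 first.
    - by move=> y _; rewrite lee_fin.
    - exact/measurable_EFinP.
    over.
  rewrite ge0_integralZr//; last 3 first.
  - exact/measurable_EFinP.
  - by move=> x _; rewrite lee_fin.
  - by apply: integral_ge0 => y _; rewrite lee_fin.
  rewrite lte_mul_pinfty ?integral_ge0//.
  - by move=> x _; rewrite lee_fin.
  - by rewrite ge0_fin_numE ?integral_ge0// => x _; rewrite lee_fin.
apply: eq_complexP.
  apply: Rfubini => [|x|y]; exact: integrable_Re.
apply: Rfubini => [|x|y]; exact: integrable_Im.
Qed.

End fubini.

Section product_integral.
Context d1 d2 (T1 : measurableType d1) (T2 : measurableType d2) (R : realType).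
Variable m1 : {sigma_finite_measure set T1 -> \bar R}.
Variable m2 : {sigma_finite_measure set T2 -> \bar R}.
Variables (f : T1 -> R[i]) (g : T2 -> R[i]).
Hypotheses (fi : cintegrable m1 f) (gi : cintegrable m2 g).

Let mfg : cmeasurable (fun z : T1 * T2 => f z.1 * g z.2).
Proof.
apply: cmeasurableM.
  exact: (cmeasurable_comp measurable_fst fi.1).
exact: (cmeasurable_comp measurable_snd gi.1).
Qed.

Lemma cintegrable_prod2 :
  cintegrable (m1 \x m2)%E (fun z : T1 * T2 => f z.1 * g z.2).
Proof.
have [mf foo] := fi; have [mg goo] := gi; split => //.
rewrite fubini_tonelli1; last 2 first.
- by apply/measurable_EFinP; exact: measurable_absc.
- by move=> z; rewrite lee_fin absc_ge0.
rewrite /fubini_F /=.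
under eq_integral => x _.
  under eq_integral do rewrite abscM EFinM.
  rewrite ge0_integralZl_EFin ?absc_ge0//; last 2 first.
  - by move=> y _; rewrite lee_fin absc_ge0.
  - by apply/measurable_EFinP; exact: measurable_absc.
  over.
rewrite ge0_integralZr//; last 3 first.
- by apply/measurable_EFinP; exact: measurable_absc.
- by move=> x _; rewrite lee_fin absc_ge0.
- by apply: integral_ge0 => y _; rewrite lee_fin absc_ge0.
rewrite lte_mul_pinfty ?integral_ge0//.
- by move=> x _; rewrite lee_fin absc_ge0.
- by rewrite ge0_fin_numE ?integral_ge0// => x _; rewrite lee_fin absc_ge0.
Qed.

Lemma cint_prod2 : cint (m1 \x m2)%E (fun z : T1 * T2 => f z.1 * g z.2) =
  cint m1 f * cint m2 g.
Proof.
have fgi := cintegrable_prod2.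
have sec x : cintegrable m2 (fun y => f x * g y) by exact: cintegrableZ.
transitivity (cint m1 (fun x => cint m2 (fun y => f x * g y))); last first.
  under eq_cint do rewrite cintZ// mulrC.
  by rewrite cintZ// mulrC.
apply: eq_complexP.
  rewrite !Re_cint /Rintegral -integral12_prod_meas1; last exact: integrable_Re.
  congr fine; apply: eq_integral => x _; rewrite fineK//.
  by apply: integrable_fin_num => //; exact: (integrable_Re (sec x)).
rewrite !Im_cint /Rintegral -integral12_prod_meas1; last exact: integrable_Im.
congr fine; apply: eq_integral => x _; rewrite fineK//.
by apply: integrable_fin_num => //; exact: (integrable_Im (sec x)).
Qed.

End product_integral.

Section lebesgue_vec.
Context {R : realType}.
Local Notation leb := (@lebesgue_measure R).

Lemma measurable_tnthR N (i : 'I_N) :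
  measurable_fun setT (fun v : N.-tuple R => tnth v i).
Proof. exact: (@measurable_tnth _ (measurableTypeR R)). Qed.

Lemma lebesgue_vecE N (A : set (N.-tuple R)) : measurable A ->
  lebesgue_vec R N A = (\int[lebesgue_vec R N]_v (\1_A v)%:E)%E.
Proof. by move=> mA; rewrite integral_indic// setIT. Qed.

Lemma ge0_integral_lebesgue_cons N (f : N.+1.-tuple R -> \bar R) :
  measurable_fun setT f -> (forall v, 0 <= f v)%E ->
  (\int[lebesgue_vec R N.+1]_v f v =
   \int[leb]_x \int[lebesgue_vec R N]_v f (cons_vec (x, v)))%E.
Proof.
move=> mf f0.
transitivity (\int[pushforward (leb \x lebesgue_vec R N) (@cons_vec R N)]_v f v)%E.
  by [].
rewrite ge0_integral_pushforward//; last exact: measurable_cons_vec.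
rewrite fubini_tonelli1//; last by move=> z; exact: f0.
exact: (measurableT_comp mf (@measurable_cons_vec R N)).
Qed.

Lemma cint_lebesgue_cons N (f : N.+1.-tuple R -> R[i]) : cmeasurable f ->
  cintegrable (leb \x lebesgue_vec R N)%E (f \o @cons_vec R N) ->
  cintegrable (lebesgue_vec R N.+1) f /\
  cint (lebesgue_vec R N.+1) f =
    cint (leb \x lebesgue_vec R N)%E (f \o @cons_vec R N).
Proof.
move=> mf fi.
have mcons := @measurable_cons_vec R N.
split.
  split=> //; apply: le_lt_trans fi.2.
  rewrite -[leLHS]/(\int[pushforward (leb \x lebesgue_vec R N) (@cons_vec R N)]_v
    (absc (f v))%:E)%E ge0_integral_pushforward//.
    by apply/measurable_EFinP; exact: measurable_absc.
  by move=> v _; rewrite lee_fin absc_ge0.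
apply: eq_complexP.
  rewrite !Re_cint /Rintegral; congr fine.
  rewrite -[LHS]/(\int[pushforward (leb \x lebesgue_vec R N) (@cons_vec R N)]_v
    (complex.Re (f v))%:E)%E integral_pushforward//.
    by apply/measurable_EFinP; exact: mf.1.
  exact: integrable_Re.
rewrite !Im_cint /Rintegral; congr fine.
rewrite -[LHS]/(\int[pushforward (leb \x lebesgue_vec R N) (@cons_vec R N)]_v
  (complex.Im (f v))%:E)%E integral_pushforward//.
  by apply/measurable_EFinP; exact: mf.2.
exact: integrable_Im.
Qed.

Lemma cmeasurable_prod N (f : 'I_N -> R -> R[i]) :
  (forall i, @cmeasurable _ (measurableTypeR R) R (f i)) ->
  cmeasurable (fun v : N.-tuple R => \prod_(i < N) f i (tnth v i)).
Proof.
move=> mf; elim: (index_enum _) => [|i s IHs].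
  by under eq_fun do rewrite big_nil; exact: cmeasurable_cst.
under eq_fun do rewrite big_cons; apply: cmeasurableM => //.
exact: (cmeasurable_comp (measurable_tnthR i) (mf i)).
Qed.

(** The passage from dimension one to R^N, used for the transform of the weight, for the Poisson
    integrals and for the measure of boxes. *)
Lemma cint_prod N (f : 'I_N -> R -> R[i]) :
  (forall i, cintegrable leb (f i)) ->
  cintegrable (lebesgue_vec R N) (fun v => \prod_(i < N) f i (tnth v i)) /\
  cint (lebesgue_vec R N) (fun v => \prod_(i < N) f i (tnth v i)) =
    \prod_(i < N) cint leb (f i).
Proof.
elim: N f => [|N IHN] f fi.
  (* On R^0 the measure is a point mass, so the empty product integrates to 1. *)
  under eq_fun do rewrite big_ord0; rewrite big_ord0; split.
    split; first exact: cmeasurable_cst.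
    by rewrite integral_dirac// diracT mul1e ltry.
  by apply: eq_complexP; rewrite ?Re_cint ?Im_cint /Rintegral integral_dirac//
    diracT mul1e.
have [gi gE] := IHN (fun i => f (lift ord0 i)) (fun i => fi _).
have E : (fun v : N.+1.-tuple R => \prod_(i < N.+1) f i (tnth v i)) \o
    @cons_vec R N = (fun z => f ord0 z.1 *
      \prod_(i < N) f (lift ord0 i) (tnth z.2 i)).
  apply/funext => -[x v] /=; rewrite big_ord_recl; congr (_ * _).
  by apply: eq_bigr => i _; rewrite tnthS.
have mp : cmeasurable (fun v : N.+1.-tuple R => \prod_(i < N.+1) f i (tnth v i)).
  by apply: cmeasurable_prod => i; exact: (fi i).1.
have [|pi_ ->] := cint_lebesgue_cons mp.
  by rewrite E; exact: (cintegrable_prod2 (fi ord0) gi).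
split; first exact: pi_.
by rewrite E (cint_prod2 (fi ord0) gi) big_ord_recl gE.
Qed.

Lemma measurable_opp_vec N :
  measurable_fun setT (opp_vec : N.-tuple R -> N.-tuple R).
Proof.
apply/(@measurable_fun_tnthP _ _ _ (measurableTypeR R)) => i.
rewrite (_ : _ \o _ = (fun v : N.-tuple R => - tnth v i)); last first.
  by apply/funext => v /=; rewrite tnth_mktuple.
by apply: measurable_funN; exact: measurable_tnthR.
Qed.

Lemma ge0_integral_opp (f : R -> \bar R) :
  measurable_fun setT f -> (forall x, 0 <= f x)%E ->
  (\int[leb]_x f (- x)%R = \int[leb]_x f x)%E.
Proof.
move=> mf f0.
transitivity (\int[pushforward leb (-%R : R -> measurableTypeR R)]_x f x)%E.
  by rewrite ge0_integral_pushforward.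
by apply: eq_measure_integral => A mA _; exact: lebesgue_measureN.
Qed.

Lemma opp_cons_vec N (x : R) (v : N.-tuple R) :
  opp_vec (cons_vec (x, v)) = cons_vec (- x, opp_vec v).
Proof.
apply: eq_from_tnth => i; rewrite tnth_mktuple.
case: (unliftP ord0 i) => [j|] ->; last by rewrite !tnth0.
by rewrite !tnthS tnth_mktuple.
Qed.

(** Tonelli and induction on the dimension: one coordinate is reflected at a time. *)
Lemma ge0_integral_opp_vec N (f : N.-tuple R -> \bar R) :
  measurable_fun setT f -> (forall v, 0 <= f v)%E ->
  (\int[lebesgue_vec R N]_v f (opp_vec v) = \int[lebesgue_vec R N]_v f v)%E.
Proof.
elim: N f => [|N IHN] f mf f0.
  by apply: eq_integral => v _; congr f; rewrite (tuple0 v) (tuple0 (opp_vec _)).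
have mc : measurable_fun setT (f \o @cons_vec R N).
  exact: (measurableT_comp mf (@measurable_cons_vec R N)).
rewrite ge0_integral_lebesgue_cons//; last first.
  exact: (measurableT_comp mf (@measurable_opp_vec N.+1)).
under eq_integral => x _.
  under eq_integral do rewrite opp_cons_vec.
  rewrite (IHN (fun v => f (cons_vec (- x, v))))//; last first.
    exact: (measurableT_comp mc (measurable_pair1 _)).
  over.
rewrite (ge0_integral_opp (f := fun x =>
  (\int[lebesgue_vec R N]_v f (cons_vec (x, v)))%E)).
- by rewrite -ge0_integral_lebesgue_cons.
- exact: (@measurable_fun_fubini_tonelli_F _ _ _ _ _ (lebesgue_vec R N) _
    mc (fun z => f0 _)).
- by move=> x; exact: integral_ge0.
Qed.

Lemma nrm2_opp_vec N (f : N.-tuple R -> R[i]) : cmeasurable f ->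
  nrm2 (lebesgue_vec R N) (fun v => f (opp_vec v)) = nrm2 (lebesgue_vec R N) f.
Proof.
move=> mf; rewrite /nrm2.
rewrite (ge0_integral_opp_vec (f := fun v => (absc (f v) ^+ 2)%:E))//.
  by apply/measurable_EFinP; exact: measurable_absc2.
by move=> v; rewrite lee_fin sqr_ge0.
Qed.

Lemma ae_opp_vec N (P : N.-tuple R -> Prop) :
  {ae lebesgue_vec R N, forall v, P v} ->
  {ae lebesgue_vec R N, forall v, P (opp_vec v)}.
Proof.
move=> [M [mM M0 PM]].
have mB : measurable ((opp_vec : N.-tuple R -> N.-tuple R) @^-1` M).
  by rewrite -[_ @^-1` _]setTI; exact: measurable_opp_vec.
exists (opp_vec @^-1` M); split => //; last by move=> v /= Pv; exact: PM.
rewrite [LHS]lebesgue_vecE//.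
rewrite -[LHS]/(\int[lebesgue_vec R N]_v (\1_M (opp_vec v))%:E)%E.
rewrite (ge0_integral_opp_vec (f := fun v => (\1_M v)%:E)) -?lebesgue_vecE//.
by apply/measurable_EFinP; exact: measurable_indic.
Qed.

(** Makes the faces of a box negligible: Poisson integrals of the box are shown to tend to its
    indicator only off the faces. In the induction, a constraint on the first coordinate leaves a
    single nonempty slice, any other one makes every slice null. *)
Lemma hyperplane_null N (i : 'I_N) (c : R) :
  {ae lebesgue_vec R N, forall v, tnth v i <> c}.
Proof.
have mH n (j : 'I_n) : measurable [set v : n.-tuple R | tnth v j = c].
  rewrite -[X in measurable X]setTI.
  exact: (measurable_tnthR j measurableT (measurable_set1 c)).
exists [set v | tnth v i = c].
split; [exact: mH| |by move=> v /= /contrapT].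
rewrite [LHS](lebesgue_vecE (mH _ i)); elim: N i => [[]//|N IHN] i.
rewrite ge0_integral_lebesgue_cons//; last first.
  by apply/measurable_EFinP; apply: measurable_indic; exact: mH.
case: (unliftP ord0 i) => [j|] ->.
  rewrite -[RHS](@integral0 _ _ _ leb setT); apply: eq_integral => x _.
  rewrite -[RHS](IHN j); apply: eq_integral => v _; congr EFin.
  rewrite !indicE; congr (_%:R); congr nat_of_bool.
  by apply: asbool_equiv_eq; rewrite /= tnthS.
rewrite -[RHS](@integral0 _ _ _ leb setT).
apply: ae_eq_ge0_integral => // [x|].
  by apply: integral_ge0 => v _; rewrite lee_fin.
exists [set c]; split; [exact: measurable_set1|exact: lebesgue_measure_set1|].
move=> x /=; apply: contra_notP => xc _.
rewrite -[RHS](@integral0 _ _ _ (lebesgue_vec R N) setT).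
apply: eq_integral => v _; congr EFin; by rewrite indicE memNset.
Qed.

End lebesgue_vec.

(** * Boxes and cubes as a generating pi-system *)

Section boxes.
Context {R : realType}.
Local Notation leb := (@lebesgue_measure R).

Definition box N (a b : 'I_N -> R) : set (N.-tuple R) :=
  [set v | forall i, a i <= tnth v i <= b i].

Definition boxes N : set (set (N.-tuple R)) :=
  [set A | exists a b : 'I_N -> R, A = box a b].

Lemma measurable_box N (a b : 'I_N -> R) : measurable (box a b).
Proof.
rewrite (_ : box a b = \bigcap_(i in [set: 'I_N])
    ((fun v : N.-tuple R => tnth v i) @^-1` `[a i, b i])).
  apply: fin_bigcap_measurable => [|i _]; first exact: finite_finset.
  rewrite -[X in measurable X]setTI.
  exact: (measurable_tnthR i measurableT (measurable_itv `[a i, b i])).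
apply/seteqP; split=> v /= vab i; last by have := vab i I; rewrite /= in_itv.
by move=> _; rewrite /= in_itv /=; exact: vab.
Qed.

Lemma indic_box N (a b : 'I_N -> R) (v : N.-tuple R) :
  \1_(box a b) v = \prod_(i < N) (\1_(`[a i, b i]) (tnth v i)) :> R.
Proof.
rewrite indicE; have [|] := boolP (v \in box a b); rewrite ?inE ?notin_setE.
  move=> vab; rewrite big1// => i _; rewrite indicE mem_set//= in_itv /=.
  exact: vab.
move=> /existsNP[i /negP vi].
rewrite (bigD1 i)//= indicE memNset ?mul0r//= in_itv /=; exact/negP.
Qed.

Lemma cintegrable_indic_itv (a b : R) :
  cintegrable leb (fun x => (\1_(`[a, b]) x : R)%:C).
Proof.
split; first by apply: cmeasurable_real; exact: measurable_indic.
under eq_integral do rewrite absc_real ger0_norm//.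
rewrite integral_indic// setIT [ltLHS](lebesgue_measure_itv `[a, b]).
by case: ifP => _; rewrite ?ltry// -EFinB ltry.
Qed.

Lemma box_fin N (a b : 'I_N -> R) : (lebesgue_vec R N (box a b) < +oo)%E.
Proof.
rewrite (lebesgue_vecE (measurable_box a b)).
have [[_ +] _] := cint_prod (fun i => cintegrable_indic_itv (a i) (b i)).
apply: le_lt_trans; rewrite le_eqVlt; apply/orP; left; apply/eqP.
apply: eq_integral => v _; congr EFin.
by rewrite -rmorph_prod absc_real indic_box ger0_norm// prodr_ge0.
Qed.

Lemma cubeE N k : cube k = box (fun=> - k%:R) (fun=> k%:R) :> set (N.-tuple R).
Proof.
by apply/seteqP; split=> v /= vk i; have := vk i; rewrite ler_norml.
Qed.

Lemma measurable_cube N k : measurable (cube k : set (N.-tuple R)).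
Proof. by rewrite cubeE; exact: measurable_box. Qed.

Lemma cube_nondecreasing N (j k : nat) : (j <= k)%N ->
  (cube j : set (N.-tuple R)) `<=` cube k.
Proof.
by move=> jk v /= vj i; apply: le_trans (vj i) _; rewrite ler_nat.
Qed.

Lemma cube_cover N (v : N.-tuple R) : \forall k \near \oo, cube k v.
Proof.
(* The sum of the bounds for the coordinates stands in for their maximum. *)
exists (\sum_(i < N) (Num.truncn `|tnth v i|%R).+1)%N => // k /= Kk i.
apply: (@le_trans _ _ (Num.truncn `|tnth v i|).+1%:R).
  exact/ltW/truncnS_gt.
rewrite ler_nat; apply: leq_trans Kk.
by rewrite (bigD1 i)//= leq_addr.
Qed.

Lemma box_cube N (a b : 'I_N -> R) : exists k, box a b `<=` cube k.
Proof.
exists (\sum_(i < N) (Num.truncn (`|a i| + `|b i|)%R).+1)%N => v /= vab i.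
apply: (@le_trans _ _ (Num.truncn (`|a i| + `|b i|)).+1%:R).
  apply: ltW; apply: le_lt_trans (truncnS_gt _).
  have /andP[av vb] := vab i; rewrite ler_norml; apply/andP; split.
    apply: le_trans av; have := ler_norm (- a i); rewrite normrN.
    by have := normr_ge0 (b i); lra.
  by apply: (le_trans vb); have := ler_norm (b i); have := normr_ge0 (a i); lra.
by rewrite ler_nat (bigD1 i)//= leq_addr.
Qed.

Lemma boxI N (a b c e : 'I_N -> R) : box a b `&` box c e =
  box (fun i => Num.max (a i) (c i)) (fun i => Num.min (b i) (e i)).
Proof.
apply/seteqP; split=> v /=.
  move=> [vab vce] i; have /andP[av vb] := vab i; have /andP[cv ve] := vce i.
  by rewrite ge_max le_min av vb cv ve.
move=> vm; split=> i; have := vm i; rewrite ge_max le_min.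
  by move=> /andP[/andP[-> _] /andP[-> _]].
by move=> /andP[/andP[_ ->] /andP[_ ->]].
Qed.

(** A slab restricting one coordinate is the union of boxes whose other sides grow, so the
    coordinates are measurable for the sigma-algebra generated by boxes. *)
Lemma measurable_tuple_box N : @measurable _ (N.-tuple R) =
  <<s @boxes N >>.
Proof.
apply/seteqP; split; last first.
  apply: smallest_sub; first exact: sigma_algebra_measurable.
  by move=> _ [a [b ->]]; exact: measurable_box.
have slab (i : 'I_N) (p q : R) : <<s @boxes N >> [set v | p <= tnth v i <= q].
  pose a k j : R := if j == i then p else - k%:R.
  pose b k j : R := if j == i then q else k%:R.
  rewrite (_ : [set v | _] = \bigcup_k box (a k) (b k)).
    apply: sigma_algebra_bigcup => k; apply: sub_sigma_algebra.
    by exists (a k), (b k).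
  apply/seteqP; split=> v /=.
    move=> vpq; have [k _ vk] := cube_cover v; exists k => //= j.
    rewrite /a /b; case: eqP => [->//|_].
    by rewrite -ler_norml; exact: (vk k (leqnn k)).
  by move=> [k _ /(_ i)]; rewrite /a /b eqxx.
have mtnth (i : 'I_N) :
    @measurable_fun _ _ (g_sigma_algebraType (@boxes N)) (measurableTypeR R) setT
      (fun v : N.-tuple R => tnth v i).
  apply: (measurability _ (RGenCInfty.measurableE R)) => _ [_ [p ->] <-].
  rewrite setTI (_ : _ @^-1` _ = \bigcup_k [set v | p <= tnth v i <= k%:R]).
    by apply: bigcup_measurable => k _; exact: slab.
  apply/seteqP; split=> v /=.
    rewrite in_itv/= andbT => pv; have [k _ vk] := cube_cover v.
    exists k => //=; rewrite pv /= (le_trans (ler_norm _))//.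
    exact: (vk k (leqnn k)).
  by move=> [k _ /= /andP[pv _]]; rewrite in_itv/= pv.
apply: smallest_sub; first exact: smallest_sigma_algebra.
move=> A; case: N slab mtnth A => [|n] slab mtnth A.
  by rewrite big_ord0.
rewrite -bigcup_mkord_ord => -[i _ [B mB <-]].
exact: (mtnth (inord i) measurableT B mB).
Qed.

(** Dynkin's argument: the sets on which [h] integrates to 0 contain the boxes, which are stable
    under intersection, and hence all measurable sets. *)
Lemma ae_eq0_box N (h : N.-tuple R -> R) :
  (lebesgue_vec R N).-integrable setT (EFin \o h) ->
  (forall a b : 'I_N -> R, (\int[lebesgue_vec R N]_(v in box a b) (h v)%:E)%E = 0%E) ->
  h = (fun=> 0) %[ae lebesgue_vec R N].
Proof.
move=> ih h0.
pose P (A : set (N.-tuple R)) := (\int[lebesgue_vec R N]_(v in A) (h v)%:E = 0)%E.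
have mh := measurable_int _ ih.
(* The whole space comes first, by exhaustion with cubes, since stability under complements rests on
   it. *)
have PT : P setT.
  have [||||_ _] := @dominated_convergence _ _ _ (lebesgue_vec R N) setT
    measurableT (fun k => (EFin \o h) \_ (cube k)) (EFin \o h)
    (fun v => `|(h v)%:E|%E) _ _ _ (integrable_abse ih).
  - move=> k; apply/(measurable_restrictT _ (@measurable_cube N k)).
    exact: measurable_funTS.
  - exact: mh.
  - apply: aeW => v _; apply: cvg_near_cst.
    by have := cube_cover v; apply: filterS => k kv; rewrite patchE mem_set.
  - apply: aeW => v k _; rewrite patchE; case: ifP => //.
    by rewrite abse0.
  move=> /cvg_lim; rewrite /P => <-//.
  apply/cvg_lim => //; apply: cvg_near_cst; apply: nearW => k /=.
  by rewrite -integral_mkcond cubeE; exact: h0.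
have PA A : measurable A -> P A.
  move=> mA; have := mA; rewrite measurable_tuple_box.
  apply: (dynkin_induction (@measurable_tuple_box N)) => //.
  - by move=> _ _ [a [b ->]] [c [e ->]]; rewrite boxI; do 2 eexists.
  - by move=> _ [a [b ->]]; exact: h0.
  - move=> S mS PS; rewrite /P.
    have := @integral_setU _ _ _ (lebesgue_vec R N) S (~` S) (EFin \o h) mS
      (measurableC mS).
    rewrite setUv => /(_ mh); rewrite [X in X = _]PT [X in X + _](_ : _ = 0%E) ?add0e.
      by move=> <- //; apply/disj_setPCl.
    exact: PS.
  - move=> F mF tF PF; rewrite /P integral_bigcup//.
      by rewrite eseries0// => k _ _; exact: PF.
    apply: integrableS ih => //; exact: bigcup_measurable.
have := @integral_ae_eq _ _ _ (lebesgue_vec R N) setT measurableT (cst 0%E)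
  (EFin \o h) ih _ _.
have mc : measurable_fun setT (cst 0%E : N.-tuple R -> \bar R) by exact: measurable_cst.
move=> /(_ mc); rewrite /ae_eq => H.
have {}H : \forall x \ae lebesgue_vec R N, setT x -> (EFin \o h) x = cst 0%E x.
  by apply: H => A _ mA; rewrite integral0; exact: PA.
by move: H; apply: filterS => v /(_ I)/= [].
Qed.

End boxes.

(** * Poisson kernels *)

Section poisson_kernel.
Context {R : realType}.
Local Notation leb := (@lebesgue_measure R).

Lemma is_derive_ext (f g : R -> R) (x df dg : R) :
  is_derive x (1 : R) f df -> f =1 g -> df = dg -> is_derive x (1 : R) g dg.
Proof. by move=> fdf /funext <- <-. Qed.

Lemma is_derive_affine (c b x : R) : is_derive x 1 (fun t => c * t + b) c.
Proof.
apply: (is_derive_ext (is_deriveD (is_deriveZ c (is_derive_id x (1 : R)))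
  (is_derive_cst b x 1))) => //.
by rewrite addr0 scaler1.
Qed.

Lemma is_derive_comp_affine (f : R -> R) (c b x df : R) :
  is_derive (c * x + b) (1 : R) f df ->
  is_derive x 1 (fun t => f (c * t + b)) (c * df).
Proof.
move=> fdf.
apply: (is_derive_ext (@is_derive1_comp _ f (fun t => c * t + b) x _ _ fdf
  (is_derive_affine c b x))) => //.
by rewrite mulrC.
Qed.

Section exponential.
Variables (e a : R).
Hypothesis e_gt0 : 0 < e.

(** The added 1 makes the integrand non-negative, as the fundamental theorem of calculus on a
    half-line demands; [cint_laplace_cis] subtracts its contribution again. *)
Let f (t : R) := expR (- (e * `|t|)) * (1 + cos (a * t)).
(** Primitive of [f] on the half-line where [t] is positive. The terms [+ 0] keep the arguments in
    the affine shape of [is_derive_comp_affine]. *)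
Let F (t : R) := expR (- e * t + 0) *
  ((e ^+ 2 + a ^+ 2)^-1 * (a * sin (a * t + 0) - e * cos (a * t + 0)) - e^-1).

Let dF (x : R) : is_derive x 1 F (expR (- e * x) * (1 + cos (a * x))).
Proof.
have ea0 : e ^+ 2 + a ^+ 2 != 0.
  by rewrite gt_eqF// ltr_pwDl ?sqr_ge0// exprn_gt0.
apply: (is_derive_ext (is_deriveM
  (is_derive_comp_affine (is_derive_expR (- e * x + 0)))
  (is_deriveD
    (is_deriveZ (e ^+ 2 + a ^+ 2)^-1
      (is_deriveB (is_deriveZ a (is_derive_comp_affine (is_derive_sin (a * x + 0))))
        (is_deriveZ e (is_derive_comp_affine (is_derive_cos (a * x + 0))))))
    (is_derive_cst (- e^-1) x 1)))) => //.
transitivity (expR (- e * x + 0) * ((e ^+ 2 + a ^+ 2)^-1 *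
    (a * (a * cos (a * x + 0)) - e * (a * - sin (a * x + 0))) + 0) +
  ((e ^+ 2 + a ^+ 2)^-1 * (a * sin (a * x + 0) - e * cos (a * x + 0)) - e^-1) *
  (- e * expR (- e * x + 0))); first by [].
by rewrite !addr0; field; rewrite ea0 gt_eqF.
Qed.

Lemma continuous_laplace_cos : continuous f.
Proof.
move=> x; apply: cvgM.
  apply: (@continuous_comp _ _ _ (fun t : R => - (e * `|t|)) expR); last first.
    exact: continuous_expR.
  by apply: cvgN; apply: cvgM; [exact: cvg_cst|exact: norm_continuous].
apply: cvgD; first exact: cvg_cst.
apply: (@continuous_comp _ _ _ (fun t : R => a * t) cos); last first.
  exact: continuous_cos.
by apply: cvgM; [exact: cvg_cst|exact: cvg_id].
Qed.

Lemma laplace_cos_ge0 t : 0 <= f t.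
Proof. by rewrite mulr_ge0 ?expR_ge0// -lerBlDl sub0r cos_geN1. Qed.

Lemma integral_laplace_cos :
  (\int[leb]_t (f t)%:E = (2 / e + 2 * e / (e ^+ 2 + a ^+ 2))%:E)%E.
Proof.
rewrite ge0_symfun_integralT//; first last.
- by move=> t; rewrite /f /= normrN mulrN cosN.
- exact: continuous_laplace_cos.
- exact: laplace_cos_ge0.
rewrite -set_itvcy (@ge0_continuous_FTC2y _ f F 0 0).
- rewrite -!EFinM sub0r; congr EFin; rewrite /F !mulr0 !addr0 expR0 sin0 cos0.
  by field; rewrite !gt_eqF// ltr_pwDl ?sqr_ge0// exprn_gt0.
- by move=> x _; exact: laplace_cos_ge0.
- by apply: continuous_subspaceT; exact: continuous_laplace_cos.
- have e0 : expR (- e * t + 0) @[t --> +oo] --> (0 : R).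
    under eq_cvg do rewrite addr0 mulNr.
    have ey : e * t @[t --> +oo] --> +oo by apply: gt0_cvgMry => //; exact: cvg_id.
    exact: (@cvg_comp _ _ _ (fun t => e * t) (fun t => expR (- t)) _ _ _
      ey (@cvgr_expR R)).
  (* Bound for the oscillating factor of [F], which therefore decays like the exponential. *)
  pose C := (e ^+ 2 + a ^+ 2)^-1 * (`|a| + e) + e^-1.
  apply/norm_cvg0P.
  apply: (@squeeze_cvgr _ _ _ _ (cst 0) (fun t => expR (- e * t + 0) * C)).
  + apply: nearW => t; rewrite normr_ge0 /= /F normrM ger0_norm ?expR_ge0//.
    rewrite ler_wpM2l ?expR_ge0// (le_trans (ler_normB _ _))// /C.
    rewrite [X in _ + X <= _]ger0_norm ?invr_ge0 ?(ltW e_gt0)// lerD2r normrM.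
    rewrite ger0_norm ?invr_ge0 ?addr_ge0 ?sqr_ge0// ler_wpM2l//.
      by rewrite invr_ge0 addr_ge0 ?sqr_ge0.
    rewrite (le_trans (ler_normB _ _))// !normrM lerD//.
      by rewrite ler_piMr// ler_norml sin_geN1 sin_le1.
    by rewrite gtr0_norm// ler_piMr ?(ltW e_gt0)// ler_norml cos_geN1 cos_le1.
  + exact: cvg_cst.
  + by rewrite -[X in _ --> X](mul0r C); apply: cvgM => //; exact: cvg_cst.
- by move=> x _; have [] := dF x.
- apply: cvg_at_right_filter; apply: differentiable_continuous.
  by apply/derivable1_diffP; have [] := dF 0.
- move=> x; rewrite in_itv/= andbT => x0; rewrite derive1E.
  by have [_ ->] := dF x; rewrite /f gtr0_norm// mulNr.
Qed.
End exponential.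

Definition laplace (e t : R) : R := expR (- (e * `|t|)).

Lemma laplace_ge0 e t : 0 <= laplace e t. Proof. exact: expR_ge0. Qed.

Lemma laplace_le1 e t : 0 < e -> laplace e t <= 1.
Proof. by move=> e0; rewrite -expR0 ler_expR oppr_le0 mulr_ge0// ltW. Qed.

Lemma measurable_laplace e : measurable_fun setT (laplace e).
Proof.
apply: continuous_measurable_fun => x.
apply: (@continuous_comp _ _ _ (fun t : R => - (e * `|t|)) expR); last first.
  exact: continuous_expR.
by apply: cvgN; apply: cvgM; [exact: cvg_cst|exact: norm_continuous].
Qed.

Lemma integral_laplace e : 0 < e -> (\int[leb]_t (laplace e t)%:E = (2 / e)%:E)%E.
Proof.
(* At [a = 0] the integrand is twice [laplace e]. *)
move=> e0; have := integral_laplace_cos 0 e0.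
under eq_integral do rewrite mul0r cos0 mulrC EFinM.
rewrite ge0_integralZl_EFin//; last first.
  by apply/measurable_EFinP; exact: measurable_laplace.
rewrite -/(laplace e _) => H.
have -> : (2 / e)%:E = (2^-1%:E * (2 / e + 2 * e / (e ^+ 2 + 0 ^+ 2))%:E)%E.
  by rewrite -EFinM; congr EFin; field; rewrite gt_eqF// ltr_pwDl ?exprn_gt0.
by rewrite -H muleA -EFinM (_ : 2^-1 * (1 + 1) = 1 :> R) ?mul1e//; field.
Qed.

Lemma cintegrable_laplace e : 0 < e ->
  cintegrable leb (fun t => (laplace e t)%:C).
Proof.
move=> e0; split; first by apply: cmeasurable_real; exact: measurable_laplace.
under eq_integral do rewrite absc_real ger0_norm ?laplace_ge0//.
by rewrite integral_laplace// ltry.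
Qed.

Lemma cintegrable_laplace_cis e a : 0 < e ->
  cintegrable leb (fun t => (laplace e t)%:C * cis (a * t)).
Proof.
move=> e0; under eq_fun do rewrite mulrC.
apply: (@cintegrableMl _ _ _ _ 1); last exact: cintegrable_laplace.
  apply: (@cmeasurable_cis _ (measurableTypeR R)).
  exact: mulrl_measurable.
by move=> t; rewrite absc_cis.
Qed.

Lemma cint_laplace_cis e a : 0 < e ->
  cint leb (fun t => (laplace e t)%:C * cis (a * t)) =
  (2 * e / (e ^+ 2 + a ^+ 2))%:C.
Proof.
move=> e0; have li := integrable_Re (cintegrable_laplace e0).
have lci := integrable_Re (cintegrable_laplace_cis a e0).
have lsi := integrable_Im (cintegrable_laplace_cis a e0).
have lE : \int[leb]_t laplace e t = 2 / e by rewrite /Rintegral integral_laplace.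
have ReE t : complex.Re ((laplace e t)%:C * cis (a * t)) = laplace e t * cos (a * t).
  by rewrite ReM ReC ImC Re_cis mul0r subr0.
have ImE t : complex.Im ((laplace e t)%:C * cis (a * t)) = laplace e t * sin (a * t).
  by rewrite ImM ReC ImC Im_cis mul0r addr0.
apply: eq_complexP; rewrite ?Re_cint ?Im_cint ?ReC ?ImC.
  have : \int[leb]_t (laplace e t + complex.Re ((laplace e t)%:C * cis (a * t))) =
      2 / e + 2 * e / (e ^+ 2 + a ^+ 2).
    rewrite /Rintegral; under eq_integral do rewrite ReE -[X in X + _]mulr1 -mulrDr.
    by rewrite (integral_laplace_cos a e0).
  by rewrite RintegralD// lE => /addrI.
(* Reflection is available for non-negative integrands, hence the [1 +]. It shows that the sine
   integral equals its own opposite. *)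
have := @ge0_integral_opp R (fun t => (laplace e t * (1 + sin (a * t)))%:E).
have ms : measurable_fun setT (fun t => (laplace e t * (1 + sin (a * t)))%:E).
  under eq_fun do rewrite mulrDr mulr1 -ImE.
  apply/measurable_EFinP; apply: measurable_funD; first exact: measurable_laplace.
  exact: (cintegrable_laplace_cis a e0).1.2.
move=> /(_ ms).
have s0 t : (0 <= (laplace e t * (1 + sin (a * t)))%:E)%E.
  by rewrite lee_fin mulr_ge0 ?laplace_ge0// -lerBlDl sub0r sin_geN1.
move=> /(_ s0) sE.
have : \int[leb]_t (laplace e t - complex.Im ((laplace e t)%:C * cis (a * t))) =
    \int[leb]_t (laplace e t + complex.Im ((laplace e t)%:C * cis (a * t))).
  rewrite /Rintegral; congr fine.
  under eq_integral do rewrite ImE.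
  under [RHS]eq_integral do rewrite ImE -[X in X + _]mulr1 -mulrDr.
  rewrite -sE; apply: eq_integral => t _; congr EFin.
  by rewrite /laplace normrN mulrN sinN; ring.
by rewrite RintegralB// RintegralD// => /addrI h; lra.
Qed.

(** Transform of [laplace e] at frequency [z]. This is the Poisson kernel of the half-plane at
    height [e / (2 * pi)], of total mass one. *)
Definition poisson (e z : R) : R := 2 * e / (e ^+ 2 + (2 * pi * z) ^+ 2).

Lemma poisson_ge0 e z : 0 < e -> 0 <= poisson e z.
Proof.
move=> e0; apply: mulr_ge0; first by apply: mulr_ge0 => //; exact: ltW.
by rewrite invr_ge0 addr_ge0 ?sqr_ge0.
Qed.

Lemma poissonN e z : poisson e (- z) = poisson e z.
Proof. by rewrite /poisson mulrN sqrrN. Qed.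

Lemma continuous_poisson e : 0 < e -> continuous (poisson e).
Proof.
move=> e0 z; apply: cvgM; first exact: cvg_cst.
apply: cvgV; first by rewrite gt_eqF// ltr_pwDl ?sqr_ge0// exprn_gt0.
apply: cvgD; first exact: cvg_cst.
under eq_cvg do rewrite expr2; rewrite expr2.
by apply: cvgM; apply: cvgM; try exact: cvg_cst; exact: cvg_id.
Qed.

Lemma integral_poisson (e x p q : R) : 0 < e -> p < q ->
  \int[leb]_(y in `[p, q]) poisson e (x - y) =
  (atan (2 * pi / e * (q - x)) - atan (2 * pi / e * (p - x))) / pi.
Proof.
move=> e0 pq.
have pi0 : (pi : R) != 0 by rewrite gt_eqF// pi_gt0.
pose c := 2 * pi / e.
pose F y := pi^-1 * atan (c * y + - (c * x)).
have dF (y : R) : is_derive y (1 : R) F (poisson e (x - y)).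
  apply: (is_derive_ext (is_deriveZ pi^-1
    (is_derive_comp_affine (is_derive1_atan (c * y + - (c * x)))))) => //.
  rewrite /GRing.scale /= /poisson /c; move: (pi : R) pi0 => w w0.
  have d0 : e ^+ 2 + (2 * w * (x - y)) ^+ 2 != 0.
    by rewrite gt_eqF// ltr_pwDl ?sqr_ge0// exprn_gt0.
  by field; rewrite d0 w0 gt_eqF.
rewrite /Rintegral (@continuous_FTC2 _ _ F)//.
- rewrite -EFinB /= /F -mulrBr mulrC; congr (_ / _).
  by rewrite !mulrBr.
- apply: continuous_subspaceT => y.
  apply: (@continuous_comp _ _ _ (fun y => x - y) (poisson e)); last first.
    exact: continuous_poisson.
  by apply: cvgB; [exact: cvg_cst|exact: cvg_id].
- have cF y : {for y, continuous F}.
    apply: differentiable_continuous.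
    by apply/derivable1_diffP; have [] := dF y.
  split.
  + by move=> y _; have [] := dF y.
  + by apply: cvg_at_right_filter; exact: cF.
  + by apply: cvg_at_left_filter; exact: cF.
- by move=> y _; rewrite derive1E; have [_ ->] := dF y.
Qed.

Lemma integral_poisson_ge0 e x p q : 0 < e ->
  0 <= \int[leb]_(y in `[p, q]) poisson e (x - y).
Proof. by move=> e0; apply: Rintegral_ge0 => y _; exact: poisson_ge0. Qed.

Lemma integral_poisson_le1 e x p q : 0 < e ->
  \int[leb]_(y in `[p, q]) poisson e (x - y) <= 1.
Proof.
move=> e0; have [pq|qp|->] := ltgtP p q.
- rewrite integral_poisson// ler_pdivrMr ?pi_gt0// mul1r.
  have := atan_ltpi2 (2 * pi / e * (q - x)).
  by have := atan_gtNpi2 (2 * pi / e * (p - x)); lra.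
- by rewrite set_itv_ge ?Rintegral_set0// bnd_simp -ltNge.
- by rewrite set_itv1 Rintegral_set1.
Qed.

(** Each arctangent tends to plus or minus [pi / 2] according to the sign of [q - x] or [p - x]. For
    [p < q] the limit at an endpoint would be 1/2, whence the two exclusions. *)
Lemma cvg_integral_poisson x p q : x != p -> x != q ->
  \int[leb]_(y in `[p, q]) poisson m.+1%:R^-1 (x - y) @[m --> \oo]
    --> (\1_(`[p, q]) x : R).
Proof.
move=> xp xq; have [pq|qp|pq] := ltgtP p q; last 2 first.
- rewrite set_itv_ge ?indicE ?in_set0; last by rewrite bnd_simp -ltNge.
  by under eq_cvg do rewrite Rintegral_set0; exact: cvg_cst.
- rewrite -pq set_itv1 indicE memNset; last by move/eqP; rewrite (negbTE xp).
  by under eq_cvg do rewrite Rintegral_set1; exact: cvg_cst.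
have pi0 : (0 : R) < pi := pi_gt0 R.
have A z : 0 < z ->
    atan (2 * pi / m.+1%:R^-1 * z) @[m --> \oo] --> (pi / 2 : R).
  move=> z0.
  have c0 : 0 < 2 * pi * z by rewrite !mulr_gt0.
  apply: (@cvg_comp _ _ _ (fun m : nat => 2 * pi / m.+1%:R^-1 * z) atan _ _ _ _
    (@cvgy_atan R)).
  have -> : (fun m : nat => 2 * pi / m.+1%:R^-1 * z) =
      (fun m => (2 * pi * z) * m.+1%:R).
    by apply/funext => m; rewrite invrK mulrAC.
  have my : m.+1%:R @[m --> \oo] --> (+oo : set_system R).
    by rewrite (cvg_shiftS (fun m => m%:R : R)); exact: cvgr_idn.
  apply: (@cvg_comp _ _ _ _ (fun r => 2 * pi * z * r) _ _ _ my).
  by apply: gt0_cvgMry => //; exact: cvg_id.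
have B z : z < 0 ->
    atan (2 * pi / m.+1%:R^-1 * z) @[m --> \oo] --> (- (pi / 2) : R).
  move=> z0; rewrite -(opprK z).
  under eq_cvg do rewrite mulrN atanN.
  by apply: cvgN; apply: A; rewrite oppr_gt0.
under eq_cvg do rewrite integral_poisson ?invr_gt0//.
rewrite indicE; have [/[!(inE, in_itv)]/= /andP[px xq']|] := boolP (x \in _).
  have -> : 1%:R = (pi / 2 - - (pi / 2)) / pi :> R.
    by move: (pi : R) pi0 => w w0; field; rewrite gt_eqF.
  apply: cvgM; last exact: cvg_cst.
  apply: cvgB; [apply: A|apply: B].
    by rewrite subr_gt0 lt_neqAle xq.
  by rewrite subr_lt0 lt_neqAle eq_sym xp.
rewrite notin_setE /= in_itv /= => /negP; rewrite negb_and -!ltNge.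
move=> /orP[xp'|qx].
  have -> : 0%:R = (pi / 2 - pi / 2) / pi :> R by rewrite subrr mul0r.
  apply: cvgM; last exact: cvg_cst.
  by apply: cvgB; apply: A; rewrite subr_gt0// (lt_trans xp').
have -> : 0%:R = (- (pi / 2) - - (pi / 2)) / pi :> R by rewrite subrr mul0r.
apply: cvgM; last exact: cvg_cst.
by apply: cvgB; apply: B; rewrite subr_lt0// (lt_trans pq).
Qed.

End poisson_kernel.

(** * The Fourier transform on L_2 *)

Section fourier_integral.
Context {R : realType} (N : nat).
Local Notation mu := (lebesgue_vec R N).
Local Notation V := (N.-tuple R).
Implicit Types (f g : V -> R[i]) (s e : R).

Definition ft s f (xi : V) : R[i] :=
  cint mu (fun x => cis (s * (2 * pi * dotp x xi)) * f x).

Lemma measurable_dotp d (T : measurableType d) (a b : T -> V) :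
  measurable_fun setT a -> measurable_fun setT b ->
  measurable_fun setT (fun z => dotp (a z) (b z)).
Proof.
move=> ma mb; apply: measurable_sum => i.
by apply: measurable_funM; exact: (measurableT_comp (measurable_tnthR i)).
Qed.

Lemma cmeasurable_wave d (T : measurableType d) (a b : T -> V) s :
  measurable_fun setT a -> measurable_fun setT b ->
  cmeasurable (fun z => cis (s * (2 * pi * dotp (a z) (b z)))).
Proof.
move=> ma mb; apply: cmeasurable_cis.
by do 2 apply: measurable_funM => //; exact: measurable_dotp.
Qed.

Lemma cmeasurable_wave1 (xi : V) s :
  cmeasurable (fun x : V => cis (s * (2 * pi * dotp x xi))).
Proof. by apply: cmeasurable_wave => //; exact: measurable_cst. Qed.

Lemma cmeasurable_wave2 (x : V) s :
  cmeasurable (fun xi : V => cis (s * (2 * pi * dotp x xi))).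
Proof. by apply: cmeasurable_wave => //; exact: measurable_cst. Qed.

Lemma cmeasurable_ft s f : cmeasurable f -> cmeasurable (ft s f).
Proof.
move=> mf.
apply: (@cmeasurable_cint _ _ V V R mu
  (fun xi x => cis (s * (2 * pi * dotp x xi)) * f x)).
apply: cmeasurableM.
  by apply: cmeasurable_wave; [exact: measurable_snd|exact: measurable_fst].
exact: (cmeasurable_comp measurable_snd mf).
Qed.

Lemma cintegrable_wave s f xi : cintegrable mu f ->
  cintegrable mu (fun x => cis (s * (2 * pi * dotp x xi)) * f x).
Proof.
move=> fi; apply: (@cintegrableMl _ _ _ _ 1) => //.
  exact: cmeasurable_wave1.
by move=> x; rewrite absc_cis.
Qed.

Lemma absc_ft_le s f xi : cintegrable mu f ->
  absc (ft s f xi) <= fine (\int[mu]_x (absc (f x))%:E).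
Proof.
move=> fi; rewrite -lee_fin fineK; last first.
  by apply: integrable_fin_num => //; exact: integrable_absc.
apply: le_trans (absc_cint_le (cintegrable_wave s xi fi)) _.
by under eq_integral do rewrite abscM absc_cis mul1r.
Qed.

Lemma ftB s f g xi : cintegrable mu f -> cintegrable mu g ->
  ft s (fun x => f x - g x) xi = ft s f xi - ft s g xi.
Proof.
move=> fi gi; rewrite /ft -cintB; try exact: cintegrable_wave.
by under eq_cint do rewrite mulrBr.
Qed.

Lemma conj_ft s f xi : cintegrable mu f ->
  conjc (ft s f xi) = ft (- s) (fun x => conjc (f x)) xi.
Proof.
move=> fi; rewrite /ft -cint_conj; last exact: cintegrable_wave.
by apply: eq_cint => x; rewrite conjcM conj_cis mulNr.
Qed.

(** The damping factor, written as a product so that [cint_prod] applies. *)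
Definition weight e (xi : V) : R := \prod_(i < N) laplace e (tnth xi i).

(** Transform of [weight e] at [x - y], an approximate identity as [e] tends to 0. *)
Definition kernel e (x y : V) : R :=
  \prod_(i < N) poisson e (tnth x i - tnth y i).

Lemma weight_ge0 e xi : 0 <= weight e xi.
Proof. by apply: prodr_ge0 => i _; exact: laplace_ge0. Qed.

Lemma weight_le1 e xi : 0 < e -> weight e xi <= 1.
Proof.
move=> e0; apply: prodr_ile1 => i _.
by rewrite laplace_ge0 laplace_le1.
Qed.

Lemma weightC e xi : (weight e xi)%:C = \prod_(i < N) (laplace e (tnth xi i))%:C.
Proof. exact: rmorph_prod. Qed.

Lemma cintegrable_weight e : 0 < e -> cintegrable mu (fun xi => (weight e xi)%:C).
Proof.
move=> e0; under eq_fun do rewrite weightC.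
exact: (cint_prod (fun=> cintegrable_laplace e0)).1.
Qed.

Lemma measurable_weight e : 0 < e -> measurable_fun setT (weight e).
Proof. by move=> e0; have [[]] := cintegrable_weight e0. Qed.

Lemma integral_weight_lty e : 0 < e -> (\int[mu]_xi (weight e xi)%:E < +oo)%E.
Proof.
move=> e0; have [_] := cintegrable_weight e0.
by under eq_integral do rewrite absc_real ger0_norm ?weight_ge0//.
Qed.

Lemma cvg_weight xi : weight m.+1%:R^-1 xi @[m --> \oo] --> (1 : R).
Proof.
have E m : weight m.+1%:R^-1 xi =
    expR (- (\sum_(i < N) `|tnth xi i|) * harmonic m).
  rewrite /weight /harmonic /= mulNr mulr_suml -sumrN expR_sum.
  by apply: eq_bigr => i _; rewrite /laplace mulrC.
under eq_cvg do rewrite E.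
have h0 : - (\sum_(i < N) `|tnth xi i|) * harmonic m @[m --> \oo] --> (0 : R).
  rewrite -[X in _ --> X](mulr0 (- (\sum_(i < N) `|tnth xi i|))).
  by apply: cvgM; [exact: cvg_cst|exact: cvg_harmonic].
by rewrite -expR0; exact: (cvg_comp _ _ h0 (@continuous_expR R 0)).
Qed.

Lemma cis_sum (I : Type) (r : seq I) (a : I -> R) :
  cis (\sum_(i <- r) a i) = \prod_(i <- r) cis (a i).
Proof.
elim: r => [|i r IHr]; first by rewrite !big_nil cis0.
by rewrite !big_cons cisD IHr.
Qed.

(** The two waves combine into one wave in [x - y], which splits over the coordinates as the weight
    does. Only the square of the frequency enters the Poisson kernel, so both signs [s] give the
    same value. *)
Lemma cint_weight_wave e s (x y : V) : 0 < e -> s ^+ 2 = 1 ->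
  cint mu (fun xi => (weight e xi)%:C *
    (cis (s * (2 * pi * dotp x xi)) * conjc (cis (s * (2 * pi * dotp y xi))))) =
  (kernel e x y)%:C.
Proof.
move=> e0 s1; pose c i : R := s * (2 * pi * (tnth x i - tnth y i)).
have -> : (kernel e x y)%:C = \prod_(i < N)
    cint (@lebesgue_measure R) (fun t => (laplace e t)%:C * cis (c i * t)).
  rewrite [LHS]rmorph_prod; apply: eq_bigr => i _ /=.
  by rewrite cint_laplace_cis// /poisson /c [(s * _) ^+ 2]exprMn s1 mul1r.
rewrite -(cint_prod (fun i => cintegrable_laplace_cis (c i) e0)).2.
apply: eq_cint => xi; rewrite weightC conj_cis -cisD big_split /= -cis_sum.
congr (_ * cis _); rewrite -mulrBr -mulrBr /dotp -sumrB 2!mulr_sumr.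
by apply: eq_bigr => i _; rewrite /c; ring.
Qed.

Lemma kernel_ge0 e x y : 0 < e -> 0 <= kernel e x y.
Proof. by move=> e0; apply: prodr_ge0 => i _; exact: poisson_ge0. Qed.

Lemma kernelC e x y : kernel e x y = kernel e y x.
Proof. by apply: eq_bigr => i _; rewrite -opprB poissonN. Qed.

Lemma measurable_kernel d (T : measurableType d) (a b : T -> V) e : 0 < e ->
  measurable_fun setT a -> measurable_fun setT b ->
  measurable_fun setT (fun z => kernel e (a z) (b z)).
Proof.
move=> e0 ma mb; apply: measurable_prod => i _.
apply: (measurableT_comp (f := poisson e)).
  by apply: continuous_measurable_fun; exact: continuous_poisson.
by apply: measurable_funB; exact: (measurableT_comp (measurable_tnthR i)).
Qed.

(* Fubini against the integrable weight; at e = 0 the weight is 1 and the kernel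
   a delta function, which is Parseval's identity. *)
Lemma weighted_parseval e s f g : 0 < e -> s ^+ 2 = 1 ->
  cintegrable mu f -> cintegrable mu g ->
  cint mu (fun xi => (weight e xi)%:C * conjc (ft s g xi) * ft s f xi) =
  cint mu (fun x => f x * cint mu (fun y => conjc (g y) * (kernel e x y)%:C)).
Proof.
move=> e0 s1 fi gi.
pose C := fine (\int[mu]_x (absc (g x))%:E).
have C0 : 0 <= C.
  by apply: fine_ge0; apply: integral_ge0 => x _; rewrite lee_fin absc_ge0.
have mw := measurable_weight e0; have woo := integral_weight_lty e0.
have mcw : cmeasurable (fun z : V * V => (weight e z.1)%:C).
  by apply: cmeasurable_real; exact: (measurableT_comp mw measurable_fst).
have mcw2 : cmeasurable (fun z : V * V => (weight e z.2)%:C).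
  by apply: cmeasurable_real; exact: (measurableT_comp mw measurable_snd).
have mgft := cmeasurable_conj (cmeasurable_ft s gi.1).
have bddw : (\int[mu]_xi (weight e xi * C)%:E < +oo)%E.
  under eq_integral do rewrite mulrC EFinM.
  rewrite ge0_integralZl_EFin//.
  - by rewrite lte_mul_pinfty.
  - by move=> xi _; rewrite lee_fin weight_ge0.
  - exact/measurable_EFinP.
have wf1 : cintegrable mu (fun xi => (weight e xi)%:C * conjc (ft s g xi)).
  apply: (@cintegrable_le _ _ _ _ (fun xi => weight e xi * C)) => //.
  - by apply: cmeasurableM => //; exact: cmeasurable_real.
  - by apply: measurable_funM.
  - move=> xi; rewrite abscM absc_real ger0_norm ?weight_ge0// absc_conj.
    by rewrite ler_wpM2l ?weight_ge0// absc_ft_le.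
(* The transform of [f] is opened first, while that of [g] is controlled by the uniform bound [C].
   The latter is opened for fixed [x], by a second exchange of integrals. *)
transitivity (cint mu (fun xi => cint mu (fun x => (weight e xi)%:C *
    conjc (ft s g xi) * (cis (s * (2 * pi * dotp x xi)) * f x)))).
  by apply: eq_cint => xi; rewrite cintZ//; exact: cintegrable_wave.
rewrite (@cint_fubini _ _ _ _ _ mu mu _ (fun xi => weight e xi * C)
  (fun x => absc (f x))); last 8 first.
- apply: cmeasurableM.
    by apply: cmeasurableM => //; exact: (cmeasurable_comp measurable_fst mgft).
  apply: cmeasurableM; last exact: (cmeasurable_comp measurable_snd fi.1).
  by apply: cmeasurable_wave; [exact: measurable_snd|exact: measurable_fst].
- exact: measurable_funM.
- exact: measurable_absc fi.1.
- by move=> xi; rewrite mulr_ge0 ?weight_ge0.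
- by move=> x; exact: absc_ge0.
- exact: bddw.
- exact: fi.2.
- move=> xi x; rewrite !abscM absc_real ger0_norm ?weight_ge0// absc_conj.
  rewrite absc_cis mul1r ler_wpM2r ?absc_ge0// ler_wpM2l ?weight_ge0//.
  exact: absc_ft_le.
apply: eq_cint => x /=.
transitivity (cint mu (fun xi => f x * ((weight e xi)%:C *
    cis (s * (2 * pi * dotp x xi)) * conjc (ft s g xi)))).
  apply: eq_cint => xi; rewrite [RHS]mulrC -!mulrA; congr (_ * _).
  by rewrite mulrCA.
rewrite cintZ; last first.
  have := cintegrableMl (C := 1) (cmeasurable_wave2 x s) _ wf1.
  under eq_fun do rewrite mulrCA mulrA.
  by apply => xi; rewrite absc_cis.
congr (_ * _).
transitivity (cint mu (fun xi => cint mu (fun y => (weight e xi)%:C *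
    cis (s * (2 * pi * dotp x xi)) * conjc (cis (s * (2 * pi * dotp y xi)) * g y)))).
  apply: eq_cint => xi; rewrite cintZ.
    by rewrite cint_conj//; exact: cintegrable_wave.
  by apply: cintegrable_conj; exact: cintegrable_wave.
rewrite (@cint_fubini _ _ _ _ _ mu mu _ (weight e)
  (fun x => absc (g x))); last 8 first.
- apply: cmeasurableM.
    apply: cmeasurableM => //.
    exact: (cmeasurable_wave s (measurable_cst x) measurable_fst).
  apply: cmeasurable_conj; apply: cmeasurableM.
    by apply: cmeasurable_wave; [exact: measurable_snd|exact: measurable_fst].
  exact: (cmeasurable_comp measurable_snd gi.1).
- exact: mw.
- exact: measurable_absc gi.1.
- by move=> xi; rewrite weight_ge0.
- by move=> y; exact: absc_ge0.
- exact: woo.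
- exact: gi.2.
- move=> xi y; rewrite !abscM absc_real ger0_norm ?weight_ge0// absc_conj.
  by rewrite abscM !absc_cis mul1r mulr1.
apply: eq_cint => y /=; rewrite -(cint_weight_wave x y e0 s1) -cintZ; last first.
  have := cintegrableMl (C := 1) (cmeasurableM (cmeasurable_wave2 x s)
    (cmeasurable_conj (cmeasurable_wave2 y s))) _ (cintegrable_weight e0).
  under eq_fun do rewrite mulrC.
  by apply => xi; rewrite abscM absc_conj !absc_cis mulr1.
by apply: eq_cint => xi; rewrite conjcM [RHS]mulrC -!mulrA.
Qed.

End fourier_integral.

(** * The L_2 bound for compactly supported functions *)

Section contraction.
Context {R : realType} (N : nat).
Local Notation leb := (@lebesgue_measure R).
Local Notation mu := (lebesgue_vec R N).
Local Notation V := (N.-tuple R).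
Implicit Types (f g : V -> R[i]) (s e : R) (a b : 'I_N -> R).

Lemma poisson_le e (z : R) : 0 < e -> poisson e z <= 2 / e.
Proof.
move=> e0; rewrite /poisson -mulrA ler_pM2l// ler_pdivrMr; last first.
  by rewrite ltr_pwDl ?sqr_ge0// exprn_gt0.
rewrite mulrDr expr2 mulrA mulVf ?gt_eqF// mul1r lerDl.
by rewrite mulr_ge0 ?sqr_ge0// invr_ge0 ltW.
Qed.

Lemma kernel_le e (x y : V) : 0 < e -> kernel e x y <= (2 / e) ^+ N.
Proof.
move=> e0; rewrite -[X in _ ^+ X](card_ord N) -prodr_const.
by apply: ler_prod => i _; rewrite poisson_ge0// poisson_le.
Qed.

(** Poisson integral of the indicator of the box, that is, the mass that [kernel e x] gives to
    it. *)
Definition boxker e a b (x : V) : R :=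
  \prod_(i < N) \int[leb]_(t in `[a i, b i]) poisson e (tnth x i - t).

Lemma boxker_ge0 e a b x : 0 < e -> 0 <= boxker e a b x.
Proof. by move=> e0; apply: prodr_ge0 => i _; exact: integral_poisson_ge0. Qed.

Lemma boxker_le1 e a b x : 0 < e -> boxker e a b x <= 1.
Proof.
move=> e0; apply: prodr_ile1 => i _.
by rewrite integral_poisson_ge0// integral_poisson_le1.
Qed.

Lemma cint_box_kernel e a b (x : V) : 0 < e ->
  cintegrable mu (fun y => (\1_(box a b) y)%:C * (kernel e x y)%:C) /\
  cint mu (fun y => (\1_(box a b) y)%:C * (kernel e x y)%:C) =
    (boxker e a b x)%:C.
Proof.
move=> e0.
have mp i : measurable_fun setT (fun t : R => poisson e (tnth x i - t)).
  apply: continuous_measurable_fun => t.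
  apply: (@continuous_comp _ _ _ (fun t => tnth x i - t) (poisson e)).
    by apply: cvgB; [exact: cvg_cst|exact: cvg_id].
  exact: continuous_poisson.
have fi i : cintegrable leb (fun t => (poisson e (tnth x i - t))%:C *
    (\1_(`[a i, b i]) t : R)%:C).
  apply: (@cintegrableMl _ _ _ _ (2 / e)).
  - by apply: (@cmeasurable_real _ (measurableTypeR R)); exact: mp.
  - by move=> t; rewrite absc_real ger0_norm ?poisson_ge0// poisson_le.
  - exact: cintegrable_indic_itv.
have [pi_ pE] := cint_prod fi.
have E : (fun y : V => (\1_(box a b) y)%:C * (kernel e x y)%:C) =
    (fun y => \prod_(i < N) ((poisson e (tnth x i - tnth y i))%:C *
      (\1_(`[a i, b i]) (tnth y i) : R)%:C)).
  by apply/funext => y; rewrite indic_box mulrC /kernel !rmorph_prod -big_split.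
rewrite E; split=> //; rewrite pE /boxker rmorph_prod; apply: eq_bigr => i _.
apply: eq_complexP; rewrite ?Re_cint ?Im_cint ?ReC ?ImC.
  rewrite [RHS]Rintegral_mkcond; apply: eq_Rintegral => t _.
  rewrite ReM !ReC !ImC mulr0 subr0 patchE indicE.
  by case: ifPn => _; rewrite ?mulr1 ?mulr0.
under eq_Rintegral do rewrite ImM !ImC mulr0 mul0r addr0.
by rewrite /Rintegral integral0.
Qed.

Lemma integral_box_kernel e a b (x : V) : 0 < e ->
  (\int[mu]_y (\1_(box a b) y * kernel e x y)%:E = (boxker e a b x)%:E)%E.
Proof.
move=> e0; have [bi bE] := cint_box_kernel a b x e0.
have rE y : complex.Re ((\1_(box a b) y)%:C * (kernel e x y)%:C) =
    \1_(box a b) y * kernel e x y.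
  by rewrite ReM !ReC !ImC mulr0 subr0.
rewrite -[in RHS](ReC (boxker e a b x)) -bE Re_cint.
rewrite fineK; first by under [RHS]eq_integral do rewrite rE.
by apply: integrable_fin_num => //; exact: (integrable_Re bi).
Qed.

(* Schur's test: the kernel has mass at most one in each variable. *)
Lemma kernel_form_le e f k : 0 < e -> cmeasurable f ->
  (forall x, ~ cube k x -> f x = 0) ->
  (\int[mu]_x \int[mu]_y (absc (f x) * absc (f y) * kernel e x y)%:E <=
   nrm2 mu f)%E.
Proof.
move=> e0 mf f0.
have mA := @measurable_cube R N k.
have m1A : measurable_fun setT (\1_(cube k) : V -> R) by exact: measurable_indic.
(* One half of the bound of [absc (f x) * absc (f y)] by half the sum of the squares; the other half
   is [P y x]. The indicator, free because [f] lives on the cube, turns the integral in [y] into a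
   [boxker], which is at most 1. *)
pose P (x y : V) : R :=
  2^-1 * absc (f x) ^+ 2 * (\1_(cube k) y * kernel e x y).
have c0 x : 0 <= 2^-1 * absc (f x) ^+ 2.
  by apply: mulr_ge0; rewrite ?sqr_ge0 ?invr_ge0.
have P0 x y : 0 <= P x y.
  by apply: mulr_ge0 => //; apply: mulr_ge0; rewrite ?kernel_ge0.
have mk : measurable_fun setT (fun z : V * V => kernel e z.1 z.2).
  by apply: measurable_kernel.
have mP : measurable_fun setT (fun z : V * V => (P z.1 z.2)%:E).
  apply/measurable_EFinP; apply: measurable_funM.
    apply: measurable_funM => //.
    exact: (measurableT_comp (measurable_absc2 mf) measurable_fst).
  apply: measurable_funM => //.
  exact: (measurableT_comp m1A measurable_snd).
have P0e (z : V * V) : (0 <= (P z.1 z.2)%:E)%E by rewrite lee_fin.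
have PE x : (\int[mu]_y (P x y)%:E)%E =
    (2^-1 * absc (f x) ^+ 2 * boxker e (fun=> - k%:R) (fun=> k%:R) x)%:E.
  rewrite /P; under eq_integral do rewrite EFinM.
  rewrite ge0_integralZl_EFin//; last 2 first.
  - by move=> y _; rewrite lee_fin; apply: mulr_ge0; rewrite ?kernel_ge0.
  - apply/measurable_EFinP; apply: measurable_funM => //.
    exact: (measurable_kernel e0 (measurable_cst x) (@measurable_id _ _ setT)).
  by rewrite cubeE integral_box_kernel// EFinM.
have PPE : (\int[mu]_x \int[mu]_y (P x y)%:E <= 2^-1%:E * nrm2 mu f)%E.
  rewrite /nrm2 -ge0_integralZl_EFin//; last 2 first.
  - by move=> x _; rewrite lee_fin sqr_ge0.
  - by apply/measurable_EFinP; exact: measurable_absc2.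
  apply: ge0_ae_le_integral => [x|x|].
  - by apply: integral_ge0 => y _; rewrite lee_fin.
  - by rewrite -EFinM lee_fin.
  by apply: aeW => x; rewrite PE -EFinM lee_fin ler_piMr ?boxker_le1.
apply: (@le_trans _ _ (\int[mu]_x \int[mu]_y ((P x y)%:E + (P y x)%:E))%E).
  apply: ge0_ae_le_integral => [x|x|].
  - apply: integral_ge0 => y _.
    by rewrite lee_fin !mulr_ge0 ?absc_ge0 ?kernel_ge0.
  - by apply: integral_ge0 => y _; rewrite -EFinD lee_fin addr_ge0.
  apply: aeW => x; apply: ge0_ae_le_integral => [y|y|].
  - by rewrite lee_fin !mulr_ge0 ?absc_ge0 ?kernel_ge0.
  - by rewrite -EFinD lee_fin addr_ge0.
  apply: aeW => y; rewrite -EFinD lee_fin.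
  have [kx|kx] := pselect (cube k x); last first.
    by rewrite f0// absc0 !mul0r addr_ge0.
  have [ky|ky] := pselect (cube k y); last first.
    by rewrite (f0 y)// absc0 mulr0 mul0r addr_ge0.
  rewrite /P !indicE !mem_set// !mul1r (kernelC _ y x) -mulrDl.
  rewrite ler_wpM2r ?kernel_ge0//.
  by have := sqr_ge0 (absc (f x) - absc (f y)); lra.
have mPx x : measurable_fun setT (fun y => (P x y)%:E).
  exact: (measurableT_comp mP (measurable_pair1 x)).
have mPy y : measurable_fun setT (fun x => (P x y)%:E).
  exact: (measurableT_comp mP (measurable_pair2 y)).
under eq_integral => x _.
  rewrite ge0_integralD//; last 2 first.
  - by move=> y _; rewrite lee_fin.
  - by move=> y _; rewrite lee_fin.
  over.
have mswap : measurable_fun setT (fun z : V * V => (P z.2 z.1)%:E).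
  apply: (measurableT_comp mP (f := fun z : V * V => (P z.1 z.2)%:E)
    (g := fun z : V * V => (z.2, z.1))).
  by apply: measurable_fun_pair.
rewrite ge0_integralD//; last 4 first.
- by move=> x _; apply: integral_ge0 => y _; rewrite lee_fin.
- exact: (@measurable_fun_fubini_tonelli_F _ _ _ _ _ mu _ mP P0e).
- by move=> x _; apply: integral_ge0 => y _; rewrite lee_fin.
- exact: (@measurable_fun_fubini_tonelli_F _ _ _ _ _ mu _ mswap
    (fun z => P0e (z.2, z.1))).
have -> : (\int[mu]_x \int[mu]_y (P y x)%:E = \int[mu]_x \int[mu]_y (P x y)%:E)%E.
  by rewrite -[RHS](@fubini_tonelli _ _ _ _ _ mu mu _ mswap
    (fun z => P0e (z.2, z.1))).
apply: (le_trans (leeD PPE PPE)).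
rewrite -ge0_muleDl ?lee_fin// -EFinD.
by rewrite (_ : 2^-1 + 2^-1 = 1 :> R) ?mul1e//; field.
Qed.

(** [weighted_parseval] with [g = f] turns the damped norm of the transform into the quadratic form
    of the kernel, bounded uniformly in the damping by [kernel_form_le]. Fatou's lemma then removes
    the damping. *)
Lemma nrm2_ft_le s f k : s ^+ 2 = 1 -> cintegrable mu f ->
  (nrm2 mu f < +oo)%E -> (forall x, ~ cube k x -> f x = 0) ->
  (nrm2 mu (ft s f) <= nrm2 mu f)%E.
Proof.
move=> s1 fi foo f0; have mf := fi.1.
have mft := cmeasurable_ft s mf.
apply: (@fatou_le _ _ _ mu (fun m xi => weight m.+1%:R^-1 xi * absc (ft s f xi) ^+ 2)).
- move=> m; apply: measurable_funM; first exact: measurable_weight.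
  exact: measurable_absc2.
- by move=> m xi; rewrite mulr_ge0 ?weight_ge0 ?sqr_ge0.
- move=> xi; rewrite -[X in _ --> X]mul1r.
  by apply: cvgM; [exact: cvg_weight|exact: cvg_cst].
apply: nearW => m; set e := m.+1%:R^-1.
have e0 : 0 < e by rewrite invr_gt0.
have mw := @measurable_weight R N e e0.
pose C := fine (\int[mu]_x (absc (f x))%:E).
have ftC xi : absc (ft s f xi) <= C by exact: absc_ft_le.
pose F xi := (weight e xi)%:C * conjc (ft s f xi) * ft s f xi.
have FE xi : F xi = (weight e xi * absc (ft s f xi) ^+ 2)%:C.
  by rewrite /F -mulrA [X in _ * X]mulrC mul_conjc -rmorphM.
have iF : cintegrable mu F.
  have := cintegrableMl (C := C * C) (g := fun xi => conjc (ft s f xi) * ft s f xi)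
    _ _ (@cintegrable_weight R N e e0).
  rewrite (_ : (fun x => _ * _ * _) = F); last first.
    by apply/funext => xi; rewrite /F mulrC mulrA.
  apply.
    by apply: cmeasurableM => //; exact: cmeasurable_conj.
  move=> xi; rewrite abscM absc_conj.
  by apply: ler_pM; rewrite ?absc_ge0.
have -> : (\int[mu]_xi (weight e xi * absc (ft s f xi) ^+ 2)%:E)%E =
    (complex.Re (cint mu F))%:E.
  rewrite Re_cint fineK.
    by apply: eq_integral => xi _; rewrite FE.
  by apply: integrable_fin_num => //; exact: (integrable_Re iF).
rewrite /F (weighted_parseval e0 s1 fi fi).
set H := fun x => f x * _.
have iK x : cintegrable mu (fun y => conjc (f y) * (kernel e x y)%:C).
  rewrite (_ : (fun y => _) = (fun y => (kernel e x y)%:C * conjc (f y))).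
    apply: (cintegrableMl (C := (2 / e) ^+ N)); last exact: cintegrable_conj.
      apply: cmeasurable_real.
      exact: (measurable_kernel e0 (measurable_cst x) (@measurable_id _ _ setT)).
    by move=> y; rewrite absc_real ger0_norm ?kernel_ge0// kernel_le.
  by apply/funext => y; rewrite mulrC.
have mH : cmeasurable H.
  apply: cmeasurableM => //.
  apply: (@cmeasurable_cint _ _ V V R mu (fun x y => conjc (f y) * (kernel e x y)%:C)).
  apply: cmeasurableM.
    exact: (cmeasurable_comp measurable_snd (cmeasurable_conj mf)).
  by apply: cmeasurable_real; exact: measurable_kernel.
(* Used twice: it makes [H] integrable and it bounds the integral of [H]. *)
have HS : (\int[mu]_x (absc (H x))%:E <= nrm2 mu f)%E.
  apply: le_trans (kernel_form_le e0 mf f0).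
  apply: ge0_ae_le_integral => [x|x|].
  - by rewrite lee_fin absc_ge0.
  - apply: integral_ge0 => y _.
    by rewrite lee_fin !mulr_ge0 ?absc_ge0 ?kernel_ge0.
  apply: aeW => x; rewrite /H abscM EFinM.
  under eq_integral do rewrite -mulrA EFinM.
  rewrite ge0_integralZl_EFin ?absc_ge0//; last 2 first.
  - by move=> y _; rewrite lee_fin mulr_ge0 ?absc_ge0 ?kernel_ge0.
  - apply/measurable_EFinP; apply: measurable_funM; first exact: measurable_absc.
    exact: (measurable_kernel e0 (measurable_cst x) (@measurable_id _ _ setT)).
  apply: lee_wpmul2l; first by rewrite lee_fin absc_ge0.
  apply: le_trans (absc_cint_le (iK x)) _.
  apply: ge0_ae_le_integral => [y|y|].
  - by rewrite lee_fin absc_ge0.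
  - by rewrite lee_fin mulr_ge0 ?absc_ge0 ?kernel_ge0.
  apply: aeW => y; rewrite abscM absc_conj absc_real ger0_norm ?kernel_ge0//.
have iH : cintegrable mu H by split => //; exact: le_lt_trans HS foo.
apply: le_trans HS; apply: le_trans (absc_cint_le iH).
by rewrite lee_fin (le_trans (ler_norm _))// normr_Re_le.
Qed.

End contraction.

Section cint_limits.
Context d (T : measurableType d) (R : realType).
Variable mu : {measure set T -> \bar R}.

Lemma cint_dominated_cvg (u : nat -> T -> R[i]) (f : T -> R[i]) (g : T -> R) :
  (forall n, cintegrable mu (u n)) -> cintegrable mu f ->
  mu.-integrable setT (EFin \o g) ->
  (forall n x, absc (u n x - f x) <= g x) ->
  {ae mu, forall x, absc (u n x - f x) @[n --> \oo] --> (0 : R)} ->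
  (absc (cint mu (u n) - cint mu f))%:E @[n --> \oo] --> 0%E.
Proof.
move=> ui fi ig ug uf.
have mB n : cmeasurable (fun x => u n x - f x).
  by apply: cmeasurableB; [exact: (ui n).1|exact: fi.1].
have I0 := dominated_integral_cvg0 (fun n => measurable_absc (mB n))
  (fun n x => absc_ge0 _) uf ig ug.
apply: (ge0_cvge0_le _ _ I0) => [n|]; first by rewrite lee_fin absc_ge0.
apply: nearW => n; rewrite -cintB//; apply: absc_cint_le.
apply: cintegrableD => //.
rewrite (_ : (fun x => _) = (fun x => -1 * f x)); first exact: cintegrableZ.
by apply/funext => x; rewrite mulN1r.
Qed.

Lemma absc_lim_unique (c : nat -> R[i]) (z w : R[i]) :
  (absc (c n - z))%:E @[n --> \oo] --> 0%E ->
  (absc (c n - w))%:E @[n --> \oo] --> 0%E -> z = w.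
Proof.
have p0 y k : (0 <= (absc (c k - y))%:E)%E by rewrite lee_fin absc_ge0.
move=> /(ge0_cvge0P (p0 z)) cz /(ge0_cvge0P (p0 w)) cw.
apply/eqP; rewrite -subr_eq0; apply/eqP; apply: absc0_eq0; apply/eqP.
rewrite eq_le absc_ge0 andbT; apply/ler_addgt0Pr => e e0; rewrite add0r.
near \oo => n.
have -> : z - w = (z - c n) + (c n - w) by rewrite addrA subrK.
apply: le_trans (abscD _ _) _; rewrite (splitr e) lerD//.
  rewrite abscB -lee_fin; near: n; apply: cz; exact: divr_gt0.
by rewrite -lee_fin; near: n; apply: cw; exact: divr_gt0.
Unshelve. all: end_near. Qed.

End cint_limits.

(** * Parseval's identity against boxes and extension of the transform to L_2 *)

Section l2_fourier.
Context {R : realType} (N : nat).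
Local Notation leb := (@lebesgue_measure R).
Local Notation mu := (lebesgue_vec R N).
Local Notation V := (N.-tuple R).
Implicit Types (f g h : V -> R[i]) (s e : R) (a b : 'I_N -> R).

Definition cindic (A : set V) (x : V) : R[i] := (\1_A x)%:C.

Lemma cindicE (A : set V) x : cindic A x = if x \in A then 1 else 0.
Proof. by rewrite /cindic indicE; case: (_ \in _). Qed.

Lemma cmeasurable_cindic (A : set V) : measurable A -> cmeasurable (cindic A).
Proof. by move=> mA; apply: cmeasurable_real; exact: measurable_indic. Qed.

Lemma absc_cindic (A : set V) x : absc (cindic A x) = \1_A x.
Proof. by rewrite absc_real ger0_norm. Qed.

Lemma absc_cindic_le1 (A : set V) x : absc (cindic A x) <= 1.
Proof. by rewrite absc_cindic indicE; case: (_ \in _). Qed.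

Lemma conjc_cindic (A : set V) x : conjc (cindic A x) = cindic A x.
Proof. exact: conjc_real. Qed.

Lemma cintegrable_cindic (A : set V) : measurable A -> (mu A < +oo)%E ->
  cintegrable mu (cindic A).
Proof.
move=> mA Aoo; split; first exact: cmeasurable_cindic.
by under eq_integral do rewrite absc_cindic; rewrite -lebesgue_vecE.
Qed.

Lemma nrm2_cindic (A : set V) : measurable A -> nrm2 mu (cindic A) = mu A.
Proof.
move=> mA; rewrite lebesgue_vecE//; apply: eq_integral => x _; congr EFin.
by rewrite absc_cindic indicE; case: (_ \in _); rewrite ?expr1n ?expr0n.
Qed.

Lemma cindic_out (A : set V) k x : A `<=` cube k -> ~ cube k x -> cindic A x = 0.
Proof. by move=> Ak kx; rewrite /cindic indicE memNset// => /Ak. Qed.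

Lemma cvg_boxker a b (x : V) : (forall i, tnth x i <> a i) ->
  (forall i, tnth x i <> b i) ->
  boxker m.+1%:R^-1 a b x @[m --> \oo] --> (\1_(box a b) x : R).
Proof.
move=> xa xb; rewrite indic_box /boxker.
elim: (index_enum _) => [|i r IHr].
  by rewrite big_nil; under eq_cvg do rewrite big_nil; exact: cvg_cst.
rewrite big_cons; under eq_cvg do rewrite big_cons.
by apply: cvgM => //; apply: cvg_integral_poisson; apply/eqP.
Qed.

Lemma absc_mulBl (p q : R) (z : R[i]) :
  absc (p%:C * z - q%:C * z) = `|p - q| * absc z.
Proof. by rewrite -mulrBl abscM -rmorphB absc_real. Qed.

Lemma cvg_absc_real (u : nat -> R) (v : R) (z : R[i]) : u n @[n --> \oo] --> v ->
  absc ((u n)%:C * z - v%:C * z) @[n --> \oo] --> (0 : R).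
Proof.
move=> uv.
have -> : (fun n => absc ((u n)%:C * z - v%:C * z)) =
    (fun n => `|u n - v| * absc z).
  by apply/funext => n; rewrite absc_mulBl.
have h : `|u n - v| @[n --> \oo] --> (0 : R).
  have uB : u n - v @[n --> \oo] --> (0 : R).
    by rewrite -(subrr v); apply: cvgB => //; exact: cvg_cst.
  by rewrite -[X in _ --> X](@normr0 _ R); exact: cvg_norm.
have H : `|u n - v| * absc z @[n --> \oo] --> 0 * absc z.
  by apply: cvgM => //; exact: cvg_cst.
by rewrite mul0r in H.
Qed.

(** One sequence has two limits. On the frequency side the weights are at most 1 and tend to 1; on
    the space side the Poisson integrals [boxker] are at most 1 and tend to the indicator off the
    faces. Dominated convergence applies to both. *)
Lemma parseval_box s f k a b : s ^+ 2 = 1 -> cintegrable mu f ->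
  (nrm2 mu f < +oo)%E -> (forall x, ~ cube k x -> f x = 0) ->
  cint mu (fun xi => conjc (ft s (cindic (box a b)) xi) * ft s f xi) =
  cint mu (fun x => f x * cindic (box a b) x).
Proof.
move=> s1 fi foo f0; set B := box a b.
have mB : measurable B := measurable_box a b.
have [l Bl] := box_cube a b.
have Bi : cintegrable mu (cindic B) := cintegrable_cindic mB (box_fin a b).
have Boo : (nrm2 mu (cindic B) < +oo)%E by rewrite nrm2_cindic// box_fin.
have mF := cmeasurable_ft s fi.1; have mG := cmeasurable_ft s Bi.1.
have Foo := le_lt_trans (nrm2_ft_le s1 fi foo f0) foo.
have Goo := le_lt_trans (nrm2_ft_le s1 Bi Boo (fun x => @cindic_out B l x Bl)) Boo.
have iGF : cintegrable mu (fun xi => conjc (ft s (cindic B) xi) * ft s f xi).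
  apply: cintegrable_mul => //; first exact: cmeasurable_conj.
  by rewrite /nrm2; under eq_integral do rewrite absc_conj.
pose e m : R := m.+1%:R^-1.
have e0 m : 0 < e m by rewrite invr_gt0.
have iw m : cintegrable mu (fun xi => (weight (e m) xi)%:C *
    (conjc (ft s (cindic B) xi) * ft s f xi)).
  apply: (@cintegrableMl _ _ _ _ 1) => //.
    by apply: cmeasurable_real; exact: measurable_weight.
  by move=> xi; rewrite absc_real ger0_norm ?weight_ge0// weight_le1.
have ifB m : cintegrable mu (fun x => (boxker (e m) a b x)%:C * f x).
  apply: (@cintegrableMl _ _ _ _ 1) => //.
    apply: cmeasurable_real.
    have := @cmeasurable_cint _ _ V V R mu
      (fun x y => (\1_B y)%:C * (kernel (e m) x y)%:C).
    case.
      apply: cmeasurableM.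
        exact: (cmeasurable_comp measurable_snd (cmeasurable_cindic mB)).
      by apply: cmeasurable_real; exact: measurable_kernel.
    by move=> + _; under eq_fun do rewrite (cint_box_kernel _ _ _ (e0 m)).2 ReC.
  by move=> x; rewrite absc_real ger0_norm ?boxker_ge0// boxker_le1.
apply: (@absc_lim_unique _ (fun m => cint mu (fun xi => (weight (e m) xi)%:C *
    (conjc (ft s (cindic B) xi) * ft s f xi)))).
  apply: (@cint_dominated_cvg _ _ _ _ _ _
    (fun xi => absc (conjc (ft s (cindic B) xi) * ft s f xi))) => //.
  - exact: integrable_absc.
  - move=> m xi; set z := conjc _ * _.
    rewrite -[X in absc (_ - X)](mul1r z) -[1]/(1%:C) absc_mulBl.
    rewrite ler_piMl ?absc_ge0//.
    have := weight_ge0 (e m) xi; have := weight_le1 xi (e0 m).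
    by rewrite ler_norml => *; lra.
  - apply: aeW => xi; set z := conjc _ * _.
    by have := cvg_absc_real z (cvg_weight xi); rewrite (_ : 1%:C = 1)// mul1r.
have cE m : cint mu (fun xi => (weight (e m) xi)%:C *
    (conjc (ft s (cindic B) xi) * ft s f xi)) =
    cint mu (fun x => (boxker (e m) a b x)%:C * f x).
  transitivity (cint mu (fun xi => (weight (e m) xi)%:C *
    conjc (ft s (cindic B) xi) * ft s f xi)).
    by apply: eq_cint => xi; rewrite mulrA.
  rewrite weighted_parseval//; apply: eq_cint => x; rewrite mulrC; congr (_ * _).
  rewrite -(cint_box_kernel _ _ _ (e0 m)).2.
  by apply: eq_cint => y; rewrite conjc_cindic.
under eq_cvg do rewrite cE.
have ifc : cintegrable mu (fun x => cindic B x * f x).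
  apply: (@cintegrableMl _ _ _ _ 1) => //; first exact: cmeasurable_cindic.
  exact: absc_cindic_le1.
have -> : cint mu (fun x => f x * cindic B x) =
    cint mu (fun x => cindic B x * f x) by apply: eq_cint => x; rewrite mulrC.
apply: (@cint_dominated_cvg _ _ _ _ _ _ (fun x => absc (f x))) => //.
- exact: integrable_absc.
- move=> m x; rewrite /cindic absc_mulBl ler_piMl ?absc_ge0//.
  have := boxker_ge0 a b x (e0 m).
  have := boxker_le1 a b x (e0 m).
  by rewrite ler_norml indicE; case: (_ \in _) => /= *; lra.
have ha : {ae mu, forall x, forall i, tnth x i <> a i}.
  by apply: filter_forall => i; exact: hyperplane_null.
have hb : {ae mu, forall x, forall i, tnth x i <> b i}.
  by apply: filter_forall => i; exact: hyperplane_null.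
move: ha hb; apply: filterS2 => x xa xb.
exact: (cvg_absc_real (f x) (cvg_boxker xa xb)).
Qed.

Lemma dotpC (x y : V) : dotp x y = dotp y x.
Proof. by apply: eq_bigr => i _; rewrite mulrC. Qed.

(** Multiplication formula, from Fubini and the symmetry of the wave in its two variables. It moves
    the inverse transform onto the test function in [fourier_inversion]. *)
Lemma ft_mul s f g : cintegrable mu f -> cintegrable mu g ->
  cint mu (fun xi => ft s f xi * g xi) = cint mu (fun x => f x * ft s g x).
Proof.
move=> fi gi.
transitivity (cint mu (fun xi => cint mu (fun x =>
    g xi * (cis (s * (2 * pi * dotp x xi)) * f x)))).
  by apply: eq_cint => xi; rewrite cintZ; [rewrite mulrC|exact: cintegrable_wave].
rewrite (@cint_fubini _ _ _ _ _ mu mu _ (fun xi => absc (g xi))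
  (fun x => absc (f x))); last 8 first.
- apply: cmeasurableM.
    exact: (cmeasurable_comp measurable_fst gi.1).
  apply: cmeasurableM.
    by apply: cmeasurable_wave; [exact: measurable_snd|exact: measurable_fst].
  exact: (cmeasurable_comp measurable_snd fi.1).
- exact: measurable_absc gi.1.
- exact: measurable_absc fi.1.
- by move=> xi; exact: absc_ge0.
- by move=> x; exact: absc_ge0.
- exact: gi.2.
- exact: fi.2.
- by move=> xi x; rewrite !abscM absc_cis mul1r.
apply: eq_cint => x /=; rewrite -cintZ; last exact: cintegrable_wave.
by apply: eq_cint => xi; rewrite (dotpC x xi) mulrCA [RHS]mulrCA [g xi * _]mulrC.
Qed.

(** Makes an L_2 function integrable and compactly supported, as [nrm2_ft_le] asks. *)
Definition cut k f (x : V) : R[i] := cindic (cube k) x * f x.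

Lemma cmeasurable_cut k f : cmeasurable f -> cmeasurable (cut k f).
Proof.
move=> mf; apply: cmeasurableM => //.
by apply: cmeasurable_cindic; exact: measurable_cube.
Qed.

Lemma cut_out k f x : ~ cube k x -> cut k f x = 0.
Proof. by move=> kx; rewrite /cut (@cindic_out _ k)// mul0r. Qed.

Lemma nrm2_cut_le k f : (nrm2 mu (cut k f) <= nrm2 mu f)%E.
Proof.
apply: nrm2_le; apply: aeW => x.
by rewrite abscM ler_piMl ?absc_ge0// absc_cindic_le1.
Qed.

Lemma cube_fin k : (mu (cube k) < +oo)%E.
Proof. by rewrite cubeE box_fin. Qed.

Lemma cintegrable_cut k f : cmeasurable f -> (nrm2 mu f < +oo)%E ->
  cintegrable mu (cut k f).
Proof.
move=> mf foo; have mk := @measurable_cube R N k.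
apply: cintegrable_mul => //; first exact: cmeasurable_cindic.
by rewrite nrm2_cindic// cube_fin.
Qed.

Lemma cvg_nrm2_cut f : cmeasurable f -> (nrm2 mu f < +oo)%E ->
  nrm2 mu (fun x => cut k f x - f x) @[k --> \oo] --> 0%E.
Proof.
move=> mf foo; apply: (@dominated_integral_cvg0 _ _ _ mu
  (fun k x => absc (cut k f x - f x) ^+ 2) (fun x => absc (f x) ^+ 2)).
- move=> k; apply: measurable_absc2; apply: cmeasurableB => //.
  exact: cmeasurable_cut.
- by move=> k x; exact: sqr_ge0.
- apply: aeW => x; apply: cvg_near_cst.
  have := cube_cover x; apply: filterS => k kx.
  by rewrite /cut /cindic indicE mem_set// mul1r subrr absc0 expr0n.
- apply/integrableP; split.
    by apply/measurable_EFinP; exact: measurable_absc2.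
  by under eq_integral do rewrite /= ger0_norm ?sqr_ge0//.
- move=> k x; rewrite lerXn2r ?nnegrE ?absc_ge0//.
  rewrite /cut /cindic indicE; case: (_ \in _); rewrite ?mul1r ?mul0r.
    by rewrite subrr absc0 absc_ge0.
  by rewrite sub0r abscN.
Qed.

Lemma truncated_fourierE s k f : truncated_fourier s k f = ft s (cut k f).
Proof.
apply/funext => xi; rewrite /truncated_fourier /cintegral /ft /cint.
congr (_ +i* _); rewrite Rintegral_mkcond; apply: eq_Rintegral => x _;
  by rewrite patchE /cut cindicE dotpC; case: (x \in _); rewrite ?mul1r// mul0r mulr0.
Qed.

Definition l2_limit (u : nat -> V -> R[i]) f : Prop :=
  nrm2 mu (fun x => u k x - f x) @[k --> \oo] --> 0%E.

(** The truncations of [f] converge to it in L_2, so by [nrm2_ft_le] their transforms form a Cauchy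
    sequence. *)
Lemma ft_l2_exists s f : s ^+ 2 = 1 -> cmeasurable f -> (nrm2 mu f < +oo)%E ->
  exists g, [/\ cmeasurable g, (nrm2 mu g <= 4%:E * nrm2 mu f)%E &
    l2_limit (fun k => ft s (cut k f)) g].
Proof.
move=> s1 mf foo.
have ic k := cintegrable_cut k mf foo.
have mc k := cmeasurable_cut k mf.
have mF k := cmeasurable_ft s (mc k).
have cutD k l : (nrm2 mu (fun xi => (ft s (cut k f) xi - ft s (cut l f) xi)%R) <=
    nrm2 mu (fun x => (cut k f x - cut l f x)%R))%E.
  under [X in (nrm2 _ X <= _)%E]eq_fun do rewrite -ftB//.
  (* Both truncations vanish off the larger cube, so their difference is again compactly
     supported. *)
  apply: (@nrm2_ft_le _ _ _ _ (maxn k l)) => //.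
  - apply: cintegrableD => //.
    rewrite (_ : (fun x => _) = (fun x => -1 * cut l f x)).
      exact: cintegrableZ.
    by apply/funext => x; rewrite mulN1r.
  - apply: nrm2B_lty => //; exact: le_lt_trans (nrm2_cut_le _ _) foo.
  - move=> x nx; rewrite !cut_out ?subrr// => kx; apply: nx.
      by apply: cube_nondecreasing kx; exact: leq_maxr.
    by apply: cube_nondecreasing kx; exact: leq_maxl.
have [|g mg Fg] := @nrm2_complete _ _ _ mu (fun k => ft s (cut k f)) mF.
  move=> e e0.
  have /(ge0_cvge0P (fun k => nrm2_ge0 mu _)) cf := cvg_nrm2_cut mf foo.
  have [K _ KP] := cf (e / 4) (divr_gt0 e0 (ltr0n _ 4)).
  exists K => k l Kk Kl; apply: le_trans (cutD k l) _.
  apply: (le_trans (nrm2_triangle mu (mc k) mf (mc l))).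
  have -> : e%:E = (2%:E * (e / 4)%:E + 2%:E * (e / 4)%:E)%E.
    by rewrite -!EFinM -EFinD; congr EFin; field.
  apply: leeD; rewrite lee_pmul2l//; first exact: KP.
  by rewrite nrm2B; exact: KP.
exists g; split => //.
have Fle k : (nrm2 mu (ft s (cut k f)) <= nrm2 mu f)%E.
  apply: le_trans (nrm2_cut_le k f).
  apply: (@nrm2_ft_le _ _ _ _ k) => //.
  - exact: le_lt_trans (nrm2_cut_le _ _) foo.
  - by move=> x; exact: cut_out.
apply/lee_addgt0Pr => e e0.
have /(ge0_cvge0P (fun k => nrm2_ge0 mu _)) Fg' := Fg.
have [K _ KP] := Fg' (e / 2) (divr_gt0 e0 (ltr0n _ 2)).
have := nrm2D_le mu (cmeasurableB mg (mF K)) (mF K).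
under [X in (nrm2 _ X <= _)%E -> _]eq_fun do rewrite subrK.
move=> /le_trans; apply; rewrite nrm2B addeC.
apply: leeD.
  (* The triangle inequality yields the factor 2, rounded up to 4; any finite constant would
     serve. *)
  apply: (@le_trans _ _ (2%:E * nrm2 mu f)%E); first by rewrite lee_pmul2l//.
  by apply: lee_wpmul2r; [exact: nrm2_ge0|rewrite lee_fin ler_nat].
have -> : e%:E = (2%:E * (e / 2)%:E)%E by rewrite -EFinM; congr EFin; field.
by rewrite lee_pmul2l//; apply: KP => /=.
Qed.

End l2_fourier.

(** * The inversion formula *)

Section inversion.
Context {R : realType} (N : nat).
Local Notation mu := (lebesgue_vec R N).
Local Notation V := (N.-tuple R).
Implicit Types (f g h : V -> R[i]) (s : R) (a b : 'I_N -> R).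

Lemma nrm2_conj f : nrm2 mu (fun x => conjc (f x)) = nrm2 mu f.
Proof. by apply: eq_integral => x _; rewrite absc_conj. Qed.

Lemma nrm2_ft_cindic_lty s a b : s ^+ 2 = 1 ->
  (nrm2 mu (ft s (cindic (box a b))) < +oo)%E.
Proof.
move=> s1; have mB := measurable_box a b; have [l Bl] := box_cube a b.
have Boo : (nrm2 mu (cindic (box a b)) < +oo)%E by rewrite nrm2_cindic// box_fin.
have Bi := cintegrable_cindic mB (box_fin a b).
apply: (le_lt_trans _ Boo).
exact: (nrm2_ft_le s1 Bi Boo (fun x => @cindic_out _ _ _ l x Bl)).
Qed.

(** Both sides are L_2-continuous, so the identity for [cut k f] passes to the limit. *)
Lemma parseval_box_l2 s f g a b : s ^+ 2 = 1 ->
  cmeasurable f -> (nrm2 mu f < +oo)%E -> cmeasurable g -> (nrm2 mu g < +oo)%E ->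
  l2_limit (fun k => ft s (cut k f)) g ->
  cint mu (fun xi => g xi * conjc (ft s (cindic (box a b)) xi)) =
  cint mu (fun x => f x * cindic (box a b) x).
Proof.
move=> s1 mf foo mg goo fg; have mB := measurable_box a b.
have mk k := cmeasurable_cut k mf.
have koo k : (nrm2 mu (cut k f) < +oo)%E := le_lt_trans (nrm2_cut_le k f) foo.
have ik k := cintegrable_cut k mf foo.
have Foo k := le_lt_trans (nrm2_ft_le s1 (ik k) (koo k) (@cut_out _ _ k f)) (koo k).
apply: (@absc_lim_unique _
  (fun k => cint mu (fun xi => ft s (cut k f) xi *
    conjc (ft s (cindic (box a b)) xi)))).
  apply: cint_mul_cvg => //.
  - by move=> k; exact: cmeasurable_ft.
  - by apply: cmeasurable_conj; apply: cmeasurable_ft; exact: cmeasurable_cindic.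
  - by rewrite nrm2_conj; exact: nrm2_ft_cindic_lty.
have E k : cint mu (fun xi => ft s (cut k f) xi *
    conjc (ft s (cindic (box a b)) xi)) =
    cint mu (fun x => cut k f x * cindic (box a b) x).
  rewrite -(parseval_box a b s1 (ik k) (koo k) (@cut_out _ _ k f)).
  by apply: eq_cint => xi; rewrite mulrC.
under eq_cvg do rewrite E.
apply: cint_mul_cvg => //.
- exact: cmeasurable_cindic.
- by rewrite nrm2_cindic// box_fin.
- exact: cvg_nrm2_cut.
Qed.

Lemma ae_eq_box f h : cmeasurable f -> (nrm2 mu f < +oo)%E ->
  cmeasurable h -> (nrm2 mu h < +oo)%E ->
  (forall a b, cint mu (fun x => f x * cindic (box a b) x) =
               cint mu (fun x => h x * cindic (box a b) x)) ->
  f = h %[ae mu].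
Proof.
move=> mf foo mh hoo fh.
pose D x := f x - h x.
have mD : cmeasurable D by exact: cmeasurableB.
have Doo : (nrm2 mu D < +oo)%E by exact: nrm2B_lty.
have iB a b u : cmeasurable u -> (nrm2 mu u < +oo)%E ->
    cintegrable mu (fun x => u x * cindic (box a b) x).
  move=> mu_ uoo; have mB := measurable_box a b.
  apply: cintegrable_mul => //; first exact: cmeasurable_cindic.
  by rewrite nrm2_cindic// box_fin.
have D0 a b : cint mu (fun x => D x * cindic (box a b) x) = 0.
  under eq_cint do rewrite mulrBl.
  by rewrite cintB ?fh ?subrr//; exact: iB.
pose cb k : 'I_N -> R := fun=> k%:R.
have cubeE' k : cube k = box (fun i => - cb k i) (cb k) by exact: cubeE.
have RD a b x : complex.Re (D x * cindic (box a b) x) =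
    complex.Re (D x) * \1_(box a b) x.
  by rewrite ReM ReC ImC mulr0 subr0.
have ID a b x : complex.Im (D x * cindic (box a b) x) =
    complex.Im (D x) * \1_(box a b) x.
  by rewrite ImM ReC ImC mulr0 add0r.
(* An L_2 function is only locally integrable. So [ae_eq0_box] is applied to [r] cut off at each
   cube, where testing on a box amounts to testing [r] on an intersection of boxes, and the
   countably many null sets are united. *)
have loc (r : V -> R) :
    (forall a b, mu.-integrable setT (fun x => (r x * \1_(box a b) x)%:E)) ->
    (forall a b, \int[mu]_x (r x * \1_(box a b) x) = 0) ->
    r = (fun=> 0) %[ae mu].
  move=> ir r0.
  have : {ae mu, forall x, forall k, r x * \1_(cube k) x = 0}.
    apply: ae_foralln => k; rewrite cubeE'.
    have := @ae_eq0_box R N (fun x => r x * \1_(box (fun i => - cb k i) (cb k)) x)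
      (ir _ _).
    have H a b : (\int[mu]_(x in box a b)
        (r x * \1_(box (fun i => - cb k i) (cb k)) x)%:E = 0)%E.
      rewrite integral_mkcond.
      rewrite -[RHS]/((0 : R)%:E) -(r0 (fun i => Num.max (a i) (- cb k i))
        (fun i => Num.min (b i) (cb k i))) fineK; last first.
        exact: (integrable_fin_num measurableT (ir _ _)).
      apply: eq_integral => x _; rewrite -boxI patchE !indicE in_setI.
      by case: (x \in box a b) => //=; rewrite mulr0.
    by move=> /(_ H); apply: filterS => x /(_ I).
  apply: filterS => x rx _; have [k _ kx] := cube_cover x.
  by have := rx k; rewrite indicE mem_set ?mulr1//; exact: (kx k (leqnn k)).
have /= r0 := loc (fun x => complex.Re (D x)) _ _.
have /= i0 := loc (fun x => complex.Im (D x)) _ _.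
have {}r0 : (fun x => complex.Re (D x)) = (fun=> 0) %[ae mu].
  apply: r0 => a b.
    have := integrable_Re (iB a b D mD Doo).
    by under eq_fun do rewrite RD.
  have := D0 a b => /(congr1 (fun z => complex.Re z)); rewrite Re_cint.
  by under eq_Rintegral do rewrite RD.
have {}i0 : (fun x => complex.Im (D x)) = (fun=> 0) %[ae mu].
  apply: i0 => a b.
    have := integrable_Im (iB a b D mD Doo).
    by under eq_fun do rewrite ID.
  have := D0 a b => /(congr1 (fun z => complex.Im z)); rewrite Im_cint.
  by under eq_Rintegral do rewrite ID.
move: r0 i0; apply: filterS2 => x /(_ I) rx /(_ I) ix _.
by apply/eqP; rewrite -subr_eq0; apply/eqP; exact: eq_complexP.
Qed.

(** Against the indicator of a box, the multiplication formula moves the transform of sign [- s]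
    from [g] onto the indicator. There it is the conjugate of the transform of sign [s], and
    Parseval's identity gives back the pairing with [f]. *)
Lemma fourier_inversion s f g h : s ^+ 2 = 1 ->
  cmeasurable f -> (nrm2 mu f < +oo)%E -> cmeasurable g -> (nrm2 mu g < +oo)%E ->
  cmeasurable h -> (nrm2 mu h < +oo)%E ->
  l2_limit (fun k => ft s (cut k f)) g ->
  l2_limit (fun k => ft (- s) (cut k g)) h -> h = f %[ae mu].
Proof.
move=> s1 mf foo mg goo mh hoo fg gh; apply: ae_eq_box => // a b.
have mB := measurable_box a b.
have sN1 : (- s) ^+ 2 = 1 by rewrite sqrrN.
have Bi := cintegrable_cindic mB (box_fin a b).
rewrite -(parseval_box_l2 a b s1 mf foo mg goo fg).
have ik k := cintegrable_cut k mg goo.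
have koo k : (nrm2 mu (cut k g) < +oo)%E := le_lt_trans (nrm2_cut_le k g) goo.
have mc := cmeasurable_conj (cmeasurable_ft s Bi.1).
apply: (@absc_lim_unique _
  (fun k => cint mu (fun xi => ft (- s) (cut k g) xi * cindic (box a b) xi))).
  apply: cint_mul_cvg => //.
  - by move=> k; apply: cmeasurable_ft; exact: (ik k).1.
  - exact: cmeasurable_cindic.
  - move=> k; apply: le_lt_trans (koo k).
    exact: (nrm2_ft_le sN1 (ik k) (koo k) (@cut_out _ _ k g)).
  - by rewrite nrm2_cindic// box_fin.
have E k : cint mu (fun xi => ft (- s) (cut k g) xi * cindic (box a b) xi) =
    cint mu (fun x => cut k g x * conjc (ft s (cindic (box a b)) x)).
  rewrite (ft_mul _ (ik k) Bi); apply: eq_cint => x.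
  rewrite (conj_ft _ _ Bi); congr (_ * _).
  by apply: eq_cint => y; rewrite conjc_cindic.
under eq_cvg do rewrite E.
apply: cint_mul_cvg => //.
- by move=> k; exact: (ik k).1.
- by rewrite nrm2_conj; exact: nrm2_ft_cindic_lty.
- exact: cvg_nrm2_cut.
Qed.

End inversion.

(** * Calculus of the relation [is_fourier] *)

Section is_fourier_theory.
Context {R : realType} (N : nat).
Local Notation mu := (lebesgue_vec R N).
Local Notation V := (N.-tuple R).
Implicit Types (f g h : V -> R[i]) (s : R).

Lemma nrm2_normLp f : nrm2 mu f = (normLp 2%:E f * normLp 2%:E f)%E.
Proof.
have n0 : (2 : R) != 0 by rewrite pnatr_eq0.
have := poweR_Lnorm mu (fun x => (absc (f x))%:E) n0; rewrite -/(normLp _ _).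
have -> : (\int[mu]_x (`|(absc (f x))%:E| `^ 2) = nrm2 mu f)%E.
  apply: eq_integral => x _.
  by rewrite abse_EFin ger0_norm ?absc_ge0// poweR_EFin powR_mulrn ?absc_ge0.
move=> <-; have : (0 <= normLp 2%:E f)%E by exact: Lnorm_ge0.
case: (normLp 2%:E f) => [r|_|//].
  by rewrite lee_fin => r0; rewrite poweR_EFin powR_mulrn// expr2 EFinM.
by rewrite poweRyr// mulyy.
Qed.

Lemma normLp2_lty f : (normLp 2%:E f < +oo)%E <-> (nrm2 mu f < +oo)%E.
Proof.
rewrite nrm2_normLp; have : (0 <= normLp 2%:E f)%E by exact: Lnorm_ge0.
by case: (normLp 2%:E f) => [r|_|//]; rewrite ?mulyy// -EFinM !ltry.
Qed.

Lemma normLp2_cvg0 (u : nat -> V -> R[i]) :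
  normLp 2%:E (u k) @[k --> \oo] --> 0%E <-> nrm2 mu (u k) @[k --> \oo] --> 0%E.
Proof.
have n0 k : (0 <= normLp 2%:E (u k))%E by exact: Lnorm_ge0.
split=> [/(ge0_cvge0P n0) un|/(ge0_cvge0P (fun k => nrm2_ge0 mu _)) un].
  apply/ge0_cvge0P => [k|e e0]; first exact: nrm2_ge0.
  have se0 : 0 < Num.sqrt e by rewrite sqrtr_gt0.
  have := un _ se0; apply: filterS => k uk; rewrite nrm2_normLp.
  by apply: (le_trans (lee_pmul _ _ uk uk)) => //; rewrite -EFinM lee_fin
    -expr2 sqr_sqrtr// ltW.
apply/ge0_cvge0P => // e e0.
have ee0 : 0 < e * e by rewrite mulr_gt0.
have := un _ ee0; apply: filterS => k; rewrite nrm2_normLp; have := n0 k.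
case: (normLp 2%:E (u k)) => [r|_|//]; last by rewrite mulyy.
by rewrite -EFinM !lee_fin => r0; rewrite -!expr2 ler_pXn2r// ?nnegrE// ltW.
Qed.

Lemma eq_l2_limit (u u' : nat -> V -> R[i]) f f' :
  (forall k, nrm2 mu (fun x => u k x - f x) = nrm2 mu (fun x => u' k x - f' x)) ->
  l2_limit u f -> l2_limit u' f'.
Proof. by move=> uu'; rewrite /l2_limit (eq_cvg _ _ uu'). Qed.

Lemma lebesgue_measurableP f : lebesgue_measurable f <->
  exists2 g, cmeasurable g & f = g %[ae mu].
Proof.
split; first by move=> [g [rg jg fg]]; exists g.
by move=> [g [rg jg] fg]; exists g.
Qed.

Lemma ae_eq_normLp (p : R) f g : f = g %[ae mu] -> normLp p%:E f = normLp p%:E g.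
Proof.
move=> fg; apply: ae_eq_Lnorm; move: fg; apply: filterS => x /= fg _.
by rewrite fg.
Qed.

Lemma ae_eq_Lp (p : R) f g : f = g %[ae mu] -> Lp p%:E f -> Lp p%:E g.
Proof.
move=> fg [/lebesgue_measurableP[h mh fh] foo]; split.
  apply/lebesgue_measurableP; exists h => //.
  by apply: ae_eq_trans fh; exact: ae_eq_sym.
by rewrite -(ae_eq_normLp p fg).
Qed.

Lemma Lp2P f : Lp 2%:E f <->
  exists g, [/\ cmeasurable g, f = g %[ae mu] & (nrm2 mu g < +oo)%E].
Proof.
split=> [[/lebesgue_measurableP[g mg fg] /normLp2_lty]|[g [mg fg goo]]].
  by rewrite (ae_eq_nrm2 fg) => goo; exists g.
apply: (ae_eq_Lp (ae_eq_sym fg)); split; last exact/normLp2_lty.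
by apply/lebesgue_measurableP; exists g => //; exact: ae_eq_refl.
Qed.

Lemma ae_eq_truncated s k f f' : f = f' %[ae mu] ->
  truncated_fourier s k f = truncated_fourier s k f'.
Proof.
move=> ff'; rewrite !truncated_fourierE; apply/funext => xi.
apply: ae_eq_cint; move: ff'; apply: filterS => x /(_ I) fx _.
by rewrite /cut fx.
Qed.

Lemma is_fourier_ae s f f' g g' : f = f' %[ae mu] -> g = g' %[ae mu] ->
  is_fourier s f g -> is_fourier s f' g'.
Proof.
move=> ff' gg' [fL gL fg]; split.
- exact: ae_eq_Lp fL.
- exact: ae_eq_Lp gL.
rewrite (_ : (fun k => _) = (fun k => normLp 2%:E (fun xi =>
  truncated_fourier s k f xi - g xi))) => //.
apply/funext => k; apply: ae_eq_normLp; rewrite (ae_eq_truncated s k ff').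
by move: gg'; apply: filterS => x /(_ I) -> _.
Qed.

Lemma is_fourier_borel s f g : cmeasurable f -> cmeasurable g ->
  is_fourier s f g <-> [/\ (nrm2 mu f < +oo)%E, (nrm2 mu g < +oo)%E &
    l2_limit (fun k => ft s (cut k f)) g].
Proof.
move=> mf mg; split=> [[[_ /normLp2_lty foo] [_ /normLp2_lty goo]]|[foo goo]].
  by under eq_fun do rewrite truncated_fourierE; move=> /normLp2_cvg0.
move=> fg; split.
- by apply/Lp2P; exists f; split => //; exact: ae_eq_refl.
- by apply/Lp2P; exists g; split => //; exact: ae_eq_refl.
by under eq_fun do rewrite truncated_fourierE; exact/normLp2_cvg0.
Qed.

(** Functions in [Lp] are only a.e. equal to Borel ones, whereas the estimates above concern Borel
    functions; this is the bridge between the two. *)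
Lemma is_fourierP s f g : is_fourier s f g <->
  exists f' g', [/\ f = f' %[ae mu], g = g' %[ae mu], cmeasurable f',
    cmeasurable g' & [/\ (nrm2 mu f' < +oo)%E, (nrm2 mu g' < +oo)%E &
    l2_limit (fun k => ft s (cut k f')) g']].
Proof.
split=> [fg|[f' [g' [ff' gg' mf mg]]]].
  have [/Lp2P[f' [mf ff' _]] /Lp2P[g' [mg gg' _]] _] := fg.
  exists f', g'; split=> //; apply/is_fourier_borel => //.
  exact: is_fourier_ae fg.
move=> /(is_fourier_borel s mf mg).
by apply: is_fourier_ae; exact: ae_eq_sym.
Qed.

Lemma is_fourier_exists s f : s ^+ 2 = 1 -> Lp 2%:E f ->
  exists g, is_fourier s f g.
Proof.
move=> s1 /Lp2P[f' [mf ff' foo]].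
have [g [mg gf fg]] := ft_l2_exists s1 mf foo.
exists g; apply/is_fourierP; exists f', g; split => //; first exact: ae_eq_refl.
split=> //; apply: le_lt_trans gf _.
by apply: lte_mul_pinfty => //; rewrite lee_fin.
Qed.

Lemma is_fourier_unique s f g h :
  is_fourier s f g -> is_fourier s f h -> g = h %[ae mu].
Proof.
move=> /is_fourierP[f' [g' [ff' gg' mf mg [foo goo fg]]]].
move=> /(is_fourier_ae ff' (ae_eq_refl _ _ _)).
move=> /is_fourierP[f2 [h' [ff2 hh' mf2 mh [f2oo hoo fh]]]].
have fh' : l2_limit (fun k => ft s (cut k f')) h'.
  apply: eq_l2_limit fh => k.
  by rewrite -!truncated_fourierE (ae_eq_truncated s k ff2).
apply: ae_eq_trans gg' _; apply: ae_eq_trans (ae_eq_sym hh').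
apply: nrm2_lim_unique fg fh' => // k.
by apply: cmeasurable_ft; exact: cmeasurable_cut.
Qed.

Lemma is_fourier_nrm2_le s f g : s ^+ 2 = 1 -> is_fourier s f g ->
  (nrm2 mu g <= 4%:E * nrm2 mu f)%E.
Proof.
move=> s1 fg.
have [f' [g' [ff' gg' mf mg [foo goo _]]]] := (is_fourierP s f g).1 fg.
have [h [mh hf fh]] := ft_l2_exists s1 mf foo.
have fh' : is_fourier s f h.
  apply/is_fourierP; exists f', h; split => //; first exact: ae_eq_refl.
  split=> //; apply: le_lt_trans hf _.
  by apply: lte_mul_pinfty => //; rewrite lee_fin.
by rewrite (ae_eq_nrm2 (is_fourier_unique fg fh')) (ae_eq_nrm2 ff').
Qed.

Lemma is_fourier_linear s (c : R[i]) f g f' g' :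
  is_fourier s f g -> is_fourier s f' g' ->
  is_fourier s (fun x => c * f x + f' x) (fun x => c * g x + g' x).
Proof.
move=> /is_fourierP[f1 [g1 [ff1 gg1 mf1 mg1 [f1oo g1oo fg1]]]].
move=> /is_fourierP[f2 [g2 [ff2 gg2 mf2 mg2 [f2oo g2oo fg2]]]].
have mZ (u : V -> R[i]) : cmeasurable u -> cmeasurable (fun x => c * u x).
  by move=> mu_; apply: cmeasurableM => //; exact: cmeasurable_cst.
have Zoo u : cmeasurable u -> (nrm2 mu u < +oo)%E ->
    (nrm2 mu (fun x => (c * u x)%R) < +oo)%E.
  move=> mu_ uoo; rewrite nrm2Z//.
  by apply: lte_mul_pinfty => //; rewrite lee_fin sqr_ge0.
apply/is_fourierP; exists (fun x => c * f1 x + f2 x), (fun x => c * g1 x + g2 x).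
split.
- by move: ff1 ff2; apply: filterS2 => x /(_ I) -> /(_ I) -> _.
- by move: gg1 gg2; apply: filterS2 => x /(_ I) -> /(_ I) -> _.
- by apply: cmeasurableD => //; exact: mZ.
- by apply: cmeasurableD => //; exact: mZ.
split; [by apply: nrm2D_lty => //; [exact: mZ|exact: Zoo]|
        by apply: nrm2D_lty => //; [exact: mZ|exact: Zoo]|].
have m1 k : cmeasurable (fun x => ft s (cut k f1) x - g1 x).
  by apply: cmeasurableB => //; apply: cmeasurable_ft; exact: cmeasurable_cut.
have m2 k : cmeasurable (fun x => ft s (cut k f2) x - g2 x).
  by apply: cmeasurableB => //; apply: cmeasurable_ft; exact: cmeasurable_cut.
have E k x : ft s (cut k (fun x => c * f1 x + f2 x)) x - (c * g1 x + g2 x) =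
    c * (ft s (cut k f1) x - g1 x) + (ft s (cut k f2) x - g2 x).
  have i1 := cintegrable_wave s x (cintegrable_cut k mf1 f1oo).
  have i2 := cintegrable_wave s x (cintegrable_cut k mf2 f2oo).
  rewrite mulrBr addrACA -opprD; congr (_ - _).
  rewrite /ft -cintZ// -cintD//; last exact: cintegrableZ.
  by apply: eq_cint => y; rewrite /cut !mulrDr; congr (_ + _);
    rewrite [c * (_ * _)]mulrCA [c * (_ * _)]mulrCA.
apply/ge0_cvge0P => [k|e e0]; first exact: nrm2_ge0.
move: fg1 fg2 => /(ge0_cvge0P (fun k => nrm2_ge0 mu _)) fg1
  /(ge0_cvge0P (fun k => nrm2_ge0 mu _)) fg2.
(* The [+ 1] allows division by [C] even when [c = 0]. *)
pose C := absc c ^+ 2 + 1.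
have C0 : 0 < C by rewrite ltr_wpDl ?sqr_ge0.
have e1 : 0 < e / (4 * C) by rewrite divr_gt0// mulr_gt0.
have e2 : 0 < e / 4 by rewrite divr_gt0.
have := fg2 _ e2; have := fg1 _ e1; apply: filterS2 => k h1 h2.
have -> : nrm2 mu (fun x => ft s (cut k (fun x => c * f1 x + f2 x)) x -
    (c * g1 x + g2 x)) = nrm2 mu (fun x => c * (ft s (cut k f1) x - g1 x) +
    (ft s (cut k f2) x - g2 x)).
  by congr nrm2; apply/funext => x; exact: E.
apply: (le_trans (nrm2D_le mu (mZ _ (m1 k)) (m2 k))).
have -> : e%:E = (2%:E * (e / 4)%:E + 2%:E * (e / 4)%:E)%E.
  by rewrite -!EFinM -EFinD; congr EFin; field.
apply: leeD; rewrite lee_pmul2l// nrm2Z//.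
apply: (@le_trans _ _ (C%:E * (e / (4 * C))%:E)%E).
  by apply: lee_pmul => //; rewrite ?nrm2_ge0// lee_fin ?sqr_ge0// lerDl.
by rewrite -EFinM lee_fin le_eqVlt; apply/orP; left; apply/eqP; field; rewrite gt_eqF.
Qed.

(** The transform of [g] with the opposite sign exists by [ft_l2_exists], and [fourier_inversion]
    identifies it with [f]. *)
Lemma is_fourier_inv s f g : s ^+ 2 = 1 -> is_fourier s f g ->
  is_fourier (- s) g f.
Proof.
move=> s1 /is_fourierP[f' [g' [ff' gg' mf mg [foo goo fg]]]].
have sN1 : (- s) ^+ 2 = 1 by rewrite sqrrN.
have [h [mh hg gh]] := ft_l2_exists sN1 mg goo.
have hoo : (nrm2 mu h < +oo)%E.
  by apply: le_lt_trans hg _; apply: lte_mul_pinfty => //; rewrite lee_fin.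
have hf := fourier_inversion s1 mf foo mg goo mh hoo fg gh.
apply/is_fourierP; exists g', h; split => //.
by apply: ae_eq_trans ff' (ae_eq_sym hf).
Qed.

Lemma is_fourier_conj s f g : is_fourier s f g ->
  is_fourier (- s) (fun x => conjc (f x)) (fun x => conjc (g x)).
Proof.
move=> /is_fourierP[f' [g' [ff' gg' mf mg [foo goo fg]]]].
apply/is_fourierP; exists (fun x => conjc (f' x)), (fun x => conjc (g' x)); split.
- by move: ff'; apply: filterS => x /(_ I) -> _.
- by move: gg'; apply: filterS => x /(_ I) -> _.
- exact: cmeasurable_conj.
- exact: cmeasurable_conj.
split; rewrite ?nrm2_conj//.
apply: eq_l2_limit fg => k; rewrite -[LHS]nrm2_conj; congr nrm2; apply/funext => x.
apply/esym.
have -> : conjc (ft s (cut k f') x - g' x) =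
    conjc (ft s (cut k f') x) - conjc (g' x) by exact: raddfB.
congr (_ - _); rewrite conj_ft; last exact: cintegrable_cut.
by apply: eq_cint => y; rewrite /cut conjcM conjc_cindic.
Qed.

Lemma dotp_opp (x y : V) : dotp x (opp_vec y) = - dotp x y.
Proof.
by rewrite /dotp -sumrN; apply: eq_bigr => i _; rewrite tnth_mktuple mulrN.
Qed.

(** Reflecting the frequency changes the sign of the exponent and preserves the measure. *)
Lemma is_fourier_opp s f g : is_fourier s f g ->
  is_fourier (- s) f (fun xi => g (opp_vec xi)).
Proof.
move=> /is_fourierP[f' [g' [ff' gg' mf mg [foo goo fg]]]].
have mo := @measurable_opp_vec R N.
apply/is_fourierP; exists f', (fun xi => g' (opp_vec xi)).
split; [exact: ff'|exact: (ae_opp_vec gg')|exact: mf|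
        exact: (cmeasurable_comp mo mg)|].
split; [exact: foo|by rewrite (nrm2_opp_vec mg)|].
apply: eq_l2_limit fg => k.
have mB : cmeasurable (fun xi => ft s (cut k f') xi - g' xi).
  by apply: cmeasurableB => //; apply: cmeasurable_ft; exact: cmeasurable_cut.
rewrite -(nrm2_opp_vec mB); congr nrm2; apply/funext => x; congr (_ - _).
by apply: eq_cint => y; rewrite dotp_opp mulrN mulrN mulNr.
Qed.

Lemma fourierP f : Lp 2%:E f -> is_fourier (-1) f (fourier f).
Proof.
move=> fL; apply: (xgetPex _ (P := [set g | is_fourier (-1) f g])).
by apply: is_fourier_exists => //; rewrite sqrrN expr1n.
Qed.

Lemma fourier_invP f : Lp 2%:E f -> is_fourier 1 f (fourier_inv f).
Proof.
move=> fL; apply: (xgetPex _ (P := [set g | is_fourier 1 f g])).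
by apply: is_fourier_exists => //; rewrite expr1n.
Qed.

End is_fourier_theory.

(** * Propagation and the intensity *)

Section phase.
Context {R : realType}.
Implicit Types (t p : R).

Lemma normr_sin_le t : `|sin t| <= `|t|.
Proof.
wlog t0 : t / 0 <= t => [H|].
  have [/H//|/ltW t0] := leP 0 t.
  by have := H (- t); rewrite oppr_ge0 sinN !normrN => /(_ t0).
have [|c _] := @MVT_segment R sin cos 0 t t0 (fun x _ => is_derive_sin x).
  by apply: continuous_subspaceT => x; exact: continuous_sin.
rewrite sin0 !subr0 => ->; rewrite normrM ler_piMl//.
by rewrite ler_norml cos_geN1 cos_le1.
Qed.

(** The left side is twice the modulus of [sin (t / 2)], by the double-angle formulas. The bound
    provides the dominating function in [propagate_diff]. *)
Lemma absc_cis_sub1 t : absc (cis t - 1) <= `|t|.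
Proof.
rewrite -(@ler_pXn2r _ 2) ?nnegrE ?absc_ge0// absc_sqr !(ReD, ImD, ReN, ImN) /=.
have := normr_sin_le (t / 2); rewrite normrM (@ger0_norm _ 2^-1)// => h.
have {}h : sin (t / 2) ^+ 2 <= (`|t| / 2) ^+ 2.
  by rewrite -[X in X <= _]real_normK ?num_real// lerXn2r ?nnegrE.
have E : (t / 2) *+ 2 = t by rewrite -mulr_natr divfK.
have := cos_mulr2n (t / 2); have := sin_mulr2n (t / 2); rewrite E => -> ->.
have := cos2Dsin2 (t / 2).
move: h; move: (sin _) (cos _) `|t| => a b c h ab.
have -> : (b ^+ 2 *+ 2 - 1 - 1) ^+ 2 + ((b * a) *+ 2 - 0) ^+ 2 =
    4 * (1 - b ^+ 2) ^+ 2 + 4 * b ^+ 2 * a ^+ 2 by ring.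
have -> : b ^+ 2 = 1 - a ^+ 2 by rewrite -ab addrK.
have -> : 4 * (1 - (1 - a ^+ 2)) ^+ 2 + 4 * (1 - a ^+ 2) * a ^+ 2 = 4 * a ^+ 2.
  by ring.
by move: h; rewrite exprMn exprVn => h; lra.
Qed.

(** Real and imaginary parts are the difference quotients at 0 of [cos (t * p)] and [sin (t * p)],
    with limits 0 and [p]. *)
Lemma cvg_cis_quotient p :
  absc (((cis (t * p) - 1) / t%:C) - 'i%C * p%:C) @[t --> 0^'] --> (0 : R).
Proof.
have quot (f : R -> R) (df : R) : is_derive (0 : R) (1 : R) f df ->
    (f t - f 0) / t @[t --> (0 : R)^'] --> df.
  move=> [dv <-]; have -> : (fun t => (f t - f 0) / t) =
      (fun h => h^-1 *: ((f \o shift 0) (h *: 1) - f 0)).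
    by apply/funext => t; rewrite /= /shift /GRing.scale /= mulr1 addr0 mulrC.
  exact: dv.
have dc : (cos (t * p) - 1) / t @[t --> (0 : R)^'] --> (0 : R).
  have := quot _ _ (is_derive_comp_affine (is_derive_cos (p * 0 + 0))).
  rewrite mulr0 addr0 sin0 oppr0 mulr0 cos0.
  rewrite (eq_cvg _ _ (g := fun t => (cos (t * p) - 1) / t))// => t.
  by rewrite addr0 [p * t]mulrC.
have ds : (sin (t * p)) / t @[t --> (0 : R)^'] --> p.
  have := quot _ _ (is_derive_comp_affine (is_derive_sin (p * 0 + 0))).
  rewrite mulr0 addr0 cos0 sin0 mulr1.
  rewrite (eq_cvg _ _ (g := fun t => sin (t * p) / t))// => t.
  by rewrite addr0 subr0 [p * t]mulrC.
have E (t : R) : absc (((cis (t * p) - 1) / t%:C) - 'i%C * p%:C) =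
    Num.sqrt (((cos (t * p) - 1) / t) ^+ 2 + (sin (t * p) / t - p) ^+ 2).
  rewrite -[LHS]ger0_norm ?absc_ge0// -sqrtr_sqr absc_sqr; congr Num.sqrt.
  have -> : (cis (t * p) - 1) / t%:C - 'i%C * p%:C =
      ((cos (t * p) - 1) / t) +i* (sin (t * p) / t - p).
    have -> : (t%:C)^-1 = (t^-1)%:C :> R[i] by rewrite fmorphV.
    apply: eq_complexP; rewrite !(ReD, ReN, ReM, ImD, ImN, ImM) /=; ring.
  by [].
have h : ((cos (t * p) - 1) / t) ^+ 2 + (sin (t * p) / t - p) ^+ 2
    @[t --> (0 : R)^'] --> (0 : R).
  have dp : sin (t * p) / t - p @[t --> (0 : R)^'] --> (0 : R).
    have H : sin (t * p) / t - p @[t --> (0 : R)^'] --> p - p.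
      by apply: cvgB => //; exact: cvg_cst.
    by rewrite subrr in H.
  have sq (g : R -> R) : g t @[t --> (0 : R)^'] --> (0 : R) ->
      g t ^+ 2 @[t --> (0 : R)^'] --> (0 : R).
    move=> g0; have H : g t * g t @[t --> (0 : R)^'] --> (0 : R) * 0.
      by apply: cvgM.
    by rewrite mulr0 in H.
  have H : ((cos (t * p) - 1) / t) ^+ 2 + (sin (t * p) / t - p) ^+ 2
      @[t --> (0 : R)^'] --> (0 : R) + 0.
    by apply: cvgD; exact: sq.
  by rewrite addr0 in H.
under eq_cvg do rewrite E.
have := @cvg_comp _ _ _ _ (@Num.sqrt R) _ _ _ h (@sqrt_continuous R 0).
by rewrite /= sqrtr0.
Qed.

End phase.

Section dnbhs_sequences.
Context {R : realType}.

(** Dominated convergence is about sequences while the derivative is a limit over a real parameter.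
    If the latter failed, bad points within [n.+1%:R^-1] of 0 would form a bad sequence. *)
Lemma ge0_cvge0_dnbhs (X : R -> \bar R) : (forall t, 0 <= X t)%E ->
  (forall u : nat -> R, (forall n, u n != 0) -> u n @[n --> \oo] --> (0 : R) ->
    X (u n) @[n --> \oo] --> 0%E) ->
  X t @[t --> (0 : R)^'] --> 0%E.
Proof.
move=> X0 Xu; apply/ge0_cvge0P => // e e0; apply: contrapT => nXe.
have /choice[u uP] : forall n, exists t, [/\ t != 0, `|t| < n.+1%:R^-1 &
    ~ (X t <= e%:E)%E].
  move=> n; apply: contrapT => nt; apply: nXe.
  exists n.+1%:R^-1 => /=; first by rewrite invr_gt0.
  move=> t /=; rewrite sub0r normrN => tn t0.
  by apply: contrapT => Xt; apply: nt; exists t.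
have u0 : u n @[n --> \oo] --> (0 : R).
  apply/norm_cvg0P; apply: (@squeeze_cvgr _ _ _ _ (cst 0) (@harmonic R)).
  - apply: nearW => n; rewrite normr_ge0 /=; apply: ltW.
    by have [] := uP n.
  - exact: cvg_cst.
  - exact: cvg_harmonic.
have un0 n : u n != 0 by have [] := uP n.
have /(ge0_cvge0P (fun n => X0 (u n))) /(_ e e0) [K _ /(_ K (leqnn K))] := Xu u un0 u0.
by have [] := uP K.
Qed.

End dnbhs_sequences.

Section propagation.
Context {R : realType} (N : nat).
Local Notation mu := (lebesgue_vec R N).
Local Notation V := (N.-tuple R).
Variables (Psi : V -> R) (u : V -> R[i]).
Hypothesis u_L2 : Lp 2%:E u.
Hypothesis Psiu_L2 : Lp 2%:E (fun xi => (Psi xi)%:C * fourier u xi).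

Definition propagate (t : R) : V -> R[i] :=
  fourier_inv (fun xi => cis (t * Psi xi) * fourier u xi).

(* Psi itself need not be measurable: only its values where fourier u does not
   vanish matter, and there it is the quotient of two measurable functions. *)
Lemma measurable_phase : exists (F : V -> R[i]) (q : V -> R),
  [/\ cmeasurable F /\ measurable_fun setT q, (nrm2 mu F < +oo)%E,
      (nrm2 mu (fun x => ((q x)%:C * F x)%R) < +oo)%E &
      {ae mu, forall x, fourier u x = F x /\ (F x = 0 \/ q x = Psi x)}].
Proof.
have [_ /Lp2P[F [mF uF Foo]] _] := fourierP u_L2.
have /Lp2P[P [mP uP Poo]] := Psiu_L2.
(* The quotient P / F with denominator made real; the reciprocal is written as a power so that
   [measurable_powR] applies. *)
pose q x := complex.Re (P x * conjc (F x)) * (absc (F x) ^+ 2) `^ (-1).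
have mq : measurable_fun setT q.
  apply: measurable_funM.
    by apply: (cmeasurableM mP (cmeasurable_conj mF)).1.
  apply: (measurableT_comp (f := fun a => powR a (-1))).
    exact: measurable_powR.
  exact: measurable_absc2.
have qPsi : {ae mu, forall x, fourier u x = F x /\ (F x = 0 \/ q x = Psi x)}.
  move: uF uP; apply: filterS2 => x /(_ I) Fx /(_ I) Px; split=> //.
  have [->|F0] := eqVneq (F x) 0; first by left.
  right; rewrite /q -Px Fx -mulrA mul_conjc -rmorphM ReC powR_inv1 ?sqr_ge0//.
  rewrite mulfK// sqrf_eq0; apply: contra_neq F0; exact: absc0_eq0.
exists F, q; split => //.
rewrite (@ae_eq_nrm2 _ _ _ mu _ P)//.
move: qPsi uP; apply: filterS2 => x [Fx qx] /(_ I) Px _.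
by rewrite -Px Fx; case: qx => ->; rewrite ?mulr0.
Qed.

Lemma propagate_L2 t : Lp 2%:E (fun xi => cis (t * Psi xi) * fourier u xi).
Proof.
have [F [q [[mF mq] Foo _ FP]]] := measurable_phase.
apply/Lp2P; exists (fun x => cis (t * q x) * F x); split.
- apply: cmeasurableM => //; apply: cmeasurable_cis.
  exact: measurable_funM.
- move: FP; apply: filterS => x [-> qx] _.
  by case: qx => ->; rewrite ?mulr0.
by rewrite /nrm2; under eq_integral do rewrite abscM absc_cis mul1r.
Qed.

Lemma is_fourier_propagate t :
  is_fourier 1 (fun xi => cis (t * Psi xi) * fourier u xi) (propagate t).
Proof. exact: fourier_invP (propagate_L2 t). Qed.

Lemma propagate0 : propagate 0 = u %[ae mu].
Proof.
have := is_fourier_propagate 0.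
under eq_fun do rewrite mul0r cis0 mul1r.
move/is_fourier_unique; apply; rewrite -[X in is_fourier X]opprK.
by apply: is_fourier_inv; [rewrite sqrrN expr1n|exact: fourierP].
Qed.

Lemma is_fourierZ s (c : R[i]) (f g : V -> R[i]) : is_fourier s f g ->
  is_fourier s (fun x => c * f x) (fun x => c * g x).
Proof.
(* The multiple [c f] is read as [(c - 1) f + f]. *)
move=> fg; have := is_fourier_linear (c - 1) fg fg.
by apply: is_fourier_ae; apply: aeW => x _; rewrite mulrBl mul1r subrK.
Qed.

Lemma propagate_diff (W : V -> R[i]) :
  is_fourier 1 (fun xi => (Psi xi)%:C * fourier u xi) W ->
  nrm2 mu (fun x => (propagate t x - propagate 0 x) / t%:C - 'i%C * W x)
    @[t --> (0 : R)^'] --> 0%E.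
Proof.
move=> hW; apply: ge0_cvge0_dnbhs => [t|a a0 a_0]; first exact: nrm2_ge0.
have [F [q [[mF mq] Foo qoo FP]]] := measurable_phase.
pose r n x := (cis (a n * q x) - 1) / (a n)%:C - 'i%C * (q x)%:C.
have mr n : cmeasurable (r n).
  apply: cmeasurableB.
    apply: cmeasurableM => //; apply: cmeasurableB => //.
    by apply: cmeasurable_cis; exact: measurable_funM.
  by apply: cmeasurableM => //; exact: cmeasurable_real.
(* One [|q x|] comes from the difference quotient, by [absc_cis_sub1], the other from its limit. As
   [q F] is in L_2, this dominates. *)
have rle n x : absc (r n x) <= 2 * `|q x|.
  apply: (le_trans (abscD _ _)); rewrite abscN !abscM absc_i mul1r absc_real.
  rewrite -fmorphV absc_real normfV mulr_natl mulr2n lerD2r.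
  rewrite ler_pdivrMr ?normr_gt0// mulrC -normrM.
  exact: absc_cis_sub1.
have key n : (nrm2 mu (fun x => ((propagate (a n) x - propagate 0 x) / (a n)%:C -
    'i%C * W x)%R) <= 4%:E * nrm2 mu (fun x => (r n x * F x)%R))%E.
  (* The whole error is one inverse transform, of [r n] times [F], so the L_2 bound moves the claim
     to the frequency side. *)
  have h := is_fourier_linear ((a n)%:C^-1) (is_fourier_linear (-1)
    (is_fourier_propagate 0) (is_fourier_propagate (a n)))
    (is_fourierZ (- 'i%C) hW).
  have := is_fourier_nrm2_le (expr1n _ _) h.
  rewrite (_ : (fun x => _) = (fun x =>
    (propagate (a n) x - propagate 0 x) / (a n)%:C - 'i%C * W x)); last first.
    by apply/funext => x; rewrite mulN1r mulNr mulrC [- _ + _]addrC.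
  move=> /le_trans; apply; rewrite lee_pmul2l//.
  rewrite le_eqVlt; apply/orP; left; apply/eqP; apply: ae_eq_nrm2.
  move: FP; apply: filterS => x [-> qx] _; rewrite /r.
  case: qx => [->|->]; first by rewrite !(mulr0, addr0).
  by rewrite mul0r cis0; ring.
apply: (ge0_cvge0_le _ (nearW _ key)) => [n|]; first exact: nrm2_ge0.
have -> : 0%E = (4%:E * 0)%E :> \bar R by rewrite mule0.
apply: cvgeZl => //; apply: (@dominated_integral_cvg0 _ _ _ mu
  (fun n x => absc (r n x * F x) ^+ 2) (fun x => 4 * absc ((q x)%:C * F x) ^+ 2)).
- by move=> n; apply: measurable_absc2; exact: cmeasurableM.
- by move=> n x; exact: sqr_ge0.
- apply: aeW => x.
  have h : absc (r n x) @[n --> \oo] --> (0 : R).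
    apply: (@cvg_comp _ _ _ a (fun t => absc (((cis (t * q x) - 1) / t%:C) -
      'i%C * (q x)%:C)) _ ((0 : R)^')); last exact: cvg_cis_quotient.
    move=> A [d /= d0 dA]; have /cvgr0_norm_lt /(_ d d0) := a_0.
    apply: filterS => n an; apply: dA => //=.
    by rewrite sub0r normrN.
  have H : (absc (r n x) * absc (F x)) * (absc (r n x) * absc (F x))
      @[n --> \oo] --> (0 * absc (F x)) * (0 * absc (F x)).
    by apply: cvgM; apply: cvgM => //; exact: cvg_cst.
  rewrite !mul0r in H; under eq_cvg do rewrite abscM expr2; exact: H.
- apply/integrableP; split.
    apply/measurable_EFinP; apply: measurable_funM => //.
    by apply: measurable_absc2; apply: cmeasurableM => //; exact: cmeasurable_real.
  have E x : `|(4 * absc ((q x)%:C * F x) ^+ 2)%:E|%E =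
      (4%:E * (absc ((q x)%:C * F x) ^+ 2)%:E)%E.
    rewrite abse_EFin ger0_norm ?EFinM//.
    by apply: mulr_ge0; rewrite ?sqr_ge0.
  under eq_integral do rewrite E.
  rewrite ge0_integralZl_EFin//.
  + by rewrite lte_mul_pinfty ?lee_fin.
  + by move=> x _; rewrite lee_fin sqr_ge0.
  + apply/measurable_EFinP.
    by apply: measurable_absc2; apply: cmeasurableM => //; exact: cmeasurable_real.
- move=> n x; rewrite !abscM !exprMn absc_real [leRHS]mulrA.
  rewrite ler_wpM2r ?sqr_ge0//.
  have -> : 4 * `|q x| ^+ 2 = (2 * `|q x|) ^+ 2 by ring.
  by rewrite lerXn2r ?nnegrE ?absc_ge0 ?mulr_ge0.
Qed.

End propagation.

(** Exact expansion of the squared modulus, for [a] the value at time 0, [w] the derivative and [r]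
    the error of the difference quotient. *)
Lemma absc_sqr_expand (R : realType) (t : R) (a w r : R[i]) : t != 0 ->
  (absc (a + t%:C * (w + r)) ^+ 2 - absc a ^+ 2) / t -
    2 * complex.Re (conjc a * w) =
  2 * complex.Re (conjc a * r) + t * absc (w + r) ^+ 2.
Proof.
move=> t0; rewrite !absc_sqr !(ReD, ImD, ReM, ImM, Re_conjc, Im_conjc) ReC ImC.
by field.
Qed.

(** * Differentiating a squared modulus in L_1 *)

Section intensity_derivative.
Context {R : realType} (N : nat).
Local Notation mu := (lebesgue_vec R N).
Local Notation V := (N.-tuple R).

Lemma Lp1_cintegrable (f g : V -> R[i]) : f = g %[ae mu] -> cintegrable mu g ->
  Lp 1%:E f.
Proof.
move=> fg [mg goo]; apply: (ae_eq_Lp (ae_eq_sym fg)); split.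
  by apply/lebesgue_measurableP; exists g => //; exact: ae_eq_refl.
rewrite /normLp Lnorm1.
by under eq_integral do rewrite abse_EFin ger0_norm ?absc_ge0//.
Qed.

Lemma has_L1_derivative_ae (I : R -> V -> R) (D D' : V -> R[i]) :
  D = D' %[ae mu] -> has_L1_derivative_at0 I D -> has_L1_derivative_at0 I D'.
Proof.
move=> DD' [IL DL ID]; split=> //; first exact: ae_eq_Lp DL.
rewrite (eq_cvg _ _ (g := fun t => normLp 1%:E (fun x =>
  (diff_quotient I t x)%:C - D x))) // => t.
apply: ae_eq_normLp; move: DD'.
by apply: filterS => x /(_ Logic.I) -> _.
Qed.

(* |U t|^2 - |U 0|^2 = 2 t Re (conj (U 0) (W + r)) + t^2 |W + r|^2, where r tends
   to 0 in L_2. *)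
Lemma has_L1_derivative_sqr (U : R -> V -> R[i]) (W : V -> R[i]) :
  (forall t, Lp 2%:E (U t)) -> Lp 2%:E W ->
  nrm2 mu (fun x => (U t x - U 0 x) / t%:C - W x) @[t --> (0 : R)^'] --> 0%E ->
  has_L1_derivative_at0 (fun t x => absc (U t x) ^+ 2)
    (fun x => (2 * complex.Re (conjc (U 0 x) * W x))%:C).
Proof.
move=> UL /Lp2P[W' [mW WW' Woo]] UW.
have /choice[U' U'P] : forall t, exists g,
    [/\ cmeasurable g, U t = g %[ae mu] & (nrm2 mu g < +oo)%E].
  by move=> t; apply/Lp2P.
have mU t : cmeasurable (U' t) by have [] := U'P t.
have UU' t : U t = U' t %[ae mu] by have [] := U'P t.
have Uoo t : (nrm2 mu (U' t) < +oo)%E by have [] := U'P t.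
pose r t x := (U' t x - U' 0 x) / t%:C - W' x.
have mr t : cmeasurable (r t).
  apply: cmeasurableB => //; apply: cmeasurableM => //; exact: cmeasurableB.
have rcvg : nrm2 mu (r t) @[t --> (0 : R)^'] --> 0%E.
  rewrite (eq_cvg _ _ (g := fun t => nrm2 mu
    (fun x => (U t x - U 0 x) / t%:C - W x))) // => t.
  apply: ae_eq_nrm2; apply: (filterS3 _ _ (UU' t) (UU' 0) WW') => x.
  by rewrite /r => /(_ I) -> /(_ I) -> /(_ I) -> _.
pose D' x : R[i] := (2 * complex.Re (conjc (U' 0 x) * W' x))%:C.
have DD' : (fun x => (2 * complex.Re (conjc (U 0 x) * W x))%:C) = D' %[ae mu].
  by move: (UU' 0) WW'; apply: filterS2 => x /(_ I) -> /(_ I) -> _.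
split.
- move=> t; apply: (@Lp1_cintegrable _ (fun x => (absc (U' t x) ^+ 2)%:C)).
    by move: (UU' t); apply: filterS => x /(_ I) -> _.
  split; first by apply: cmeasurable_real; exact: measurable_absc2.
  apply: le_lt_trans (Uoo t); rewrite le_eqVlt; apply/orP; left; apply/eqP.
  by apply: eq_integral => x _; rewrite absc_real ger0_norm ?sqr_ge0.
- apply: (Lp1_cintegrable DD').
  have ci : cintegrable mu (fun x => 2%:C * (conjc (U' 0 x) * W' x)).
    apply: cintegrableZ; apply: cintegrable_mul => //.
      exact: cmeasurable_conj.
    by rewrite nrm2_conj.
  apply: (@cintegrable_le _ _ _ _ (fun x => absc (2%:C * (conjc (U' 0 x) * W' x)))).
  + apply: cmeasurable_real; apply: measurable_funM => //.
    exact: (cmeasurableM (cmeasurable_conj (mU 0)) mW).1.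
  + exact: measurable_absc ci.1.
  + move=> x; rewrite absc_real normrM abscM absc_real ler_wpM2l//.
    exact: normr_Re_le.
  + exact: ci.2.
have Woo' : nrm2 mu W' \is a fin_num by rewrite ge0_fin_numE ?nrm2_ge0.
pose M := fine (nrm2 mu W').
have M0 : 0 <= M by rewrite fine_ge0 ?nrm2_ge0.
have rU := integral_absc_mul_cvg0 (FF := dnbhs_filter (0 : R)) mr (mU 0) (Uoo 0) rcvg.
have q0 t : (0 <= normLp 1%:E (fun x => ((diff_quotient (fun t x =>
    absc (U t x) ^+ 2) t x)%:C - (2 * complex.Re (conjc (U 0 x) * W x))%:C)%R))%E.
  exact: Lnorm_ge0.
apply/ge0_cvge0P => // e e0.
have I0 t : (0 <= \int[mu]_x (absc (r t x * U' 0 x)%R)%:E)%E.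
  by apply: integral_ge0 => x _; rewrite lee_fin absc_ge0.
move/(ge0_cvge0P I0): rU => rU.
move/(ge0_cvge0P (fun t => nrm2_ge0 mu _)): rcvg => rcvg.
have e4 : 0 < e / 4 by rewrite divr_gt0.
(* The cross term gets [e / 2]. The quadratic term is at most [2 * |t| * (M + 1)], because
   [nrm2 mu (r t)] is eventually at most 1, and this size of [t] makes it at most [e / 2] too. *)
have eM : 0 < e / (4 * (M + 1)) by rewrite divr_gt0// mulr_gt0// ltr_pwDr.
near=> t.
have t0 : t != 0 by near: t; exact: nbhs_dnbhs_neq.
have rUt : (\int[mu]_x (absc (r t x * U' 0 x)%R)%:E <= (e / 4)%:E)%E.
  by near: t; exact: rU.
have rt : (nrm2 mu (r t) <= 1%:E)%E by near: t; exact: rcvg.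
have te : `|t| <= e / (4 * (M + 1)).
  near: t; exists (e / (4 * (M + 1))) => // y /=.
  by rewrite sub0r normrN => /ltW.
rewrite /normLp Lnorm1.
have mA : measurable_fun setT (fun x => absc (r t x * U' 0 x)).
  by apply: measurable_absc; exact: cmeasurableM.
have mB (f : V -> R[i]) (c : R) : cmeasurable f ->
    measurable_fun setT (fun x => (c * absc (f x) ^+ 2)%:E).
  move=> mf; apply/measurable_EFinP; apply: measurable_funM => //.
  exact: measurable_absc2.
apply: (@le_trans _ _ (\int[mu]_x ((2 * absc (r t x * U' 0 x))%:E +
    ((2 * `|t| * absc (W' x) ^+ 2)%:E + (2 * `|t| * absc (r t x) ^+ 2)%:E)))%E).
  apply: ge0_ae_le_integral => [x|x|].
  - exact: abse_ge0.
  - rewrite -!EFinD lee_fin; apply: addr_ge0; first by rewrite mulr_ge0 ?absc_ge0.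
    by apply: addr_ge0; apply: mulr_ge0; rewrite ?sqr_ge0// mulr_ge0.
  apply: (filterS3 _ _ (UU' t) (UU' 0) WW') => x /(_ I) utx /(_ I) u0x /(_ I) wx.
  rewrite /diff_quotient utx u0x wx -rmorphB absc_real.
  have E : (absc (U' t x) ^+ 2 - absc (U' 0 x) ^+ 2) / t -
      2 * complex.Re (conjc (U' 0 x) * W' x) =
      2 * complex.Re (conjc (U' 0 x) * r t x) + t * absc (W' x + r t x) ^+ 2.
    have -> : U' t x = U' 0 x + t%:C * (W' x + r t x).
      have tC : t%:C != 0 :> R[i] by rewrite fmorph_eq0.
      have -> : W' x + r t x = (U' t x - U' 0 x) / t%:C by rewrite addrC subrK.
      by rewrite mulrC (divfK tC) addrC subrK.
    exact: absc_sqr_expand.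
  rewrite E -!EFinD lee_fin normr_id.
  apply: (le_trans (ler_normD _ _)); apply: lerD.
    rewrite normrM (@ger0_norm _ 2)// ler_wpM2l//.
    apply: le_trans (normr_Re_le _) _.
    by rewrite !abscM absc_conj mulrC.
  rewrite normrM (@ger0_norm _ (_ ^+ 2)) ?sqr_ge0//.
  apply: le_trans (ler_wpM2l (normr_ge0 t) (sqr_abscD_le _ _)) _.
  by rewrite mulrDr !mulrA ![_ * 2]mulrC.
rewrite ge0_integralD//; last 4 first.
- by move=> x _; rewrite lee_fin mulr_ge0 ?absc_ge0.
- by apply/measurable_EFinP; exact: measurable_funM.
- move=> x _; rewrite -EFinD lee_fin.
  by apply: addr_ge0; apply: mulr_ge0; rewrite ?sqr_ge0// mulr_ge0.
- by apply: emeasurable_funD; exact: mB.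
rewrite ge0_integralD//; last 4 first.
- by move=> x _; rewrite lee_fin; apply: mulr_ge0; rewrite ?sqr_ge0// mulr_ge0.
- exact: mB.
- by move=> x _; rewrite lee_fin; apply: mulr_ge0; rewrite ?sqr_ge0// mulr_ge0.
- exact: mB.
under eq_integral do rewrite EFinM.
rewrite ge0_integralZl_EFin//; last 2 first.
- by move=> x _; rewrite lee_fin absc_ge0.
- exact/measurable_EFinP.
have Z (f : V -> R[i]) : cmeasurable f ->
    (\int[mu]_x (2 * `|t| * absc (f x) ^+ 2)%:E = (2 * `|t|)%:E * nrm2 mu f)%E.
  move=> mf; rewrite /nrm2 -ge0_integralZl_EFin ?mulr_ge0//.
  - by move=> x _; rewrite lee_fin sqr_ge0.
  - by apply/measurable_EFinP; exact: measurable_absc2.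
rewrite !Z// -[nrm2 mu W']fineK// -/M.
apply: (@le_trans _ _ (2%:E * (e / 4)%:E +
    ((2 * `|t|)%:E * M%:E + (2 * `|t|)%:E * 1%:E))%E).
  apply: leeD; first by rewrite lee_pmul2l.
  by apply: leeD => //; apply: lee_wpmul2l; rewrite ?lee_fin ?mulr_ge0.
rewrite -!EFinM -!EFinD lee_fin.
have M1 : 0 < M + 1 by rewrite ltr_pwDr.
have : `|t| * (M + 1) <= e / 4.
  by rewrite -ler_pdivlMr// -[leRHS]mulrA -invfM.
by move=> h; lra.
Unshelve. all: end_near. Qed.

End intensity_derivative.

(** * Parity of the multiplier *)

Section multiplier.
Context {R : realType} (N : nat).
Local Notation mu := (lebesgue_vec R N).
Local Notation V := (N.-tuple R).

Lemma multiplier_opP (Psi : V -> R) (f : V -> R[i]) : multiplier_dom Psi f ->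
  is_fourier 1 (fun xi => (Psi xi)%:C * fourier f xi) (multiplier_op Psi f).
Proof.
move=> [_ fdom].
exact: (xgetPex _ (P := [set w | is_fourier 1 (fun xi => _) w])).
Qed.

(** With [e] equal to 1 or -1, both parities are treated at once. For real [f], conjugating the
    transform is the same as reflecting it, so reflecting [Psi] times the transform amounts to
    conjugating it and multiplying by [e]; the inverse transform inherits the relation. *)
Lemma multiplier_op_conj (e : R) (Psi : V -> R) (f : V -> R[i]) :
  e ^+ 2 = 1 -> (forall xi, Psi (opp_vec xi) = e * Psi xi) ->
  (forall x, conjc (f x) = f x) -> multiplier_dom Psi f ->
  {ae mu, forall x,
    conjc (multiplier_op Psi f x) = e%:C * multiplier_op Psi f x}.
Proof.
move=> e1 Psie fR fdom; have [fL _] := fdom.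
have wP := multiplier_opP fdom; set w := multiplier_op Psi f in wP *.
set g := fourier f in wP *; have gP : is_fourier (-1) f g := fourierP fL.
have cg : (fun xi => conjc (g xi)) = (fun xi => g (opp_vec xi)) %[ae mu].
  have := is_fourier_conj gP; under eq_fun do rewrite fR.
  by move/is_fourier_unique; apply; exact: is_fourier_opp.
have one1 : (1 : R) ^+ 2 = 1 by rewrite expr1n.
have N1 : (- (-1) : R) ^+ 2 = 1 by rewrite opprK expr1n.
(* [is_fourier_opp] reflects the second argument of the relation; to reflect the first one, the
   relation is inverted before and after. *)
have := is_fourier_inv N1 (is_fourier_opp (is_fourier_inv one1 wP)).
rewrite opprK => Hw.
have cw := is_fourierZ e%:C (is_fourier_conj wP).
have HH : (fun xi => (Psi (opp_vec xi))%:C * g (opp_vec xi)) =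
    (fun xi => e%:C * conjc ((Psi xi)%:C * g xi)) %[ae mu].
  move: cg; apply: filterS => xi /(_ I) <- _.
  by rewrite Psie conjcM conjc_real rmorphM mulrA.
have := is_fourier_unique (is_fourier_ae HH (ae_eq_refl _ _ _) Hw) cw.
apply: filterS => x /(_ I) wx.
by rewrite {2}wx mulrA -rmorphM -expr2 e1 mul1r.
Qed.

End multiplier.

Section intensity.
Context {R : realType} (N : nat) (n : R) (Omega : set (N.-tuple R)).
Variables phi Psi : N.-tuple R -> R.
Local Notation mu := (lebesgue_vec R N).
Local Notation V := (N.-tuple R).
Local Notation fcos := (fun x => (\1_Omega x * cos (phi x))%:C).
Local Notation fsin := (fun x => (\1_Omega x * sin (phi x))%:C).
Hypothesis n_gt0 : 0 < n.
Hypothesis cos_dom : multiplier_dom Psi fcos.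
Hypothesis sin_dom : multiplier_dom Psi fsin.

Let u (x : V) : R[i] := (Num.sqrt n * \1_Omega x)%:C * cis (- phi x).

Lemma is_fourier_pupil : is_fourier (-1) u (fun xi =>
  (Num.sqrt n)%:C * (- 'i%C * fourier fsin xi + fourier fcos xi)).
Proof.
have [fcP _] := cos_dom; have [fsP _] := sin_dom.
have := is_fourierZ (Num.sqrt n)%:C
  (is_fourier_linear (- 'i%C) (fourierP fsP) (fourierP fcP)).
apply: is_fourier_ae (ae_eq_refl _ _ _); apply: aeW => x _ /=.
rewrite /u /cis cosN sinN.
by apply: eq_complexP; rewrite !(ReD, ReN, ReM, ImD, ImN, ImM) /=; ring.
Qed.

(** Supplies the W of [propagate_diff], assembled by linearity from the two domain hypotheses. *)
Lemma is_fourier_Psi_pupil : is_fourier 1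
  (fun xi => (Psi xi)%:C * fourier u xi)
  (fun x => (Num.sqrt n)%:C *
    (- 'i%C * multiplier_op Psi fsin x + multiplier_op Psi fcos x)).
Proof.
have := is_fourierZ (Num.sqrt n)%:C (is_fourier_linear (- 'i%C)
  (multiplier_opP sin_dom) (multiplier_opP cos_dom)).
apply: is_fourier_ae (ae_eq_refl _ _ _).
have [uL _ _] := is_fourier_pupil.
have := is_fourier_unique is_fourier_pupil (fourierP uL).
apply: filterS => xi /(_ I) <- _.
rewrite [RHS]mulrCA; congr (_ * _).
by rewrite [RHS]mulrDr; congr (_ + _); exact: mulrCA.
Qed.

(** Inversion makes the propagation at time 0 the identity, and the phase factor of the pupil has
    modulus one. *)
Lemma intensity0 :
  {ae mu, forall x, intensity n Omega phi Psi 0 x = n * \1_Omega x}.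
Proof.
have [uL _ _] := is_fourier_pupil; have [PuL _ _] := is_fourier_Psi_pupil.
have := propagate0 uL PuL; apply: filterS => x /(_ I) ux.
rewrite /intensity -/(propagate Psi u 0 x) ux.
rewrite abscM absc_cis mulr1 absc_real real_normK ?num_real//.
rewrite exprMn sqr_sqrtr ?ltW// indicE; case: (x \in Omega).
  by rewrite expr1n.
by rewrite expr0n.
Qed.

(** The form common to both parities: conj u is sqrt n times the indicator times [cis (phi x)], and
    i W is sqrt n (G s + i G c). *)
Lemma intensity_L1_derivative : has_L1_derivative_at0 (intensity n Omega phi Psi)
  (fun x => (2 * n * \1_Omega x * complex.Re (cis (phi x) *
    (multiplier_op Psi fsin x + 'i%C * multiplier_op Psi fcos x)))%:C).
Proof.
have [uL _ _] := is_fourier_pupil.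
have WP := is_fourier_Psi_pupil; have [PuL _ _] := WP.
have [_ iWL _] := is_fourierZ 'i%C WP.
have UL t : Lp 2%:E (propagate Psi u t).
  by have [] := is_fourier_propagate uL PuL t.
have := has_L1_derivative_sqr UL iWL (propagate_diff uL PuL WP).
apply: has_L1_derivative_ae.
have := propagate0 uL PuL; apply: filterS => x /(_ I) ->  _.
have n2 : Num.sqrt n * Num.sqrt n = n by rewrite -expr2 sqr_sqrtr ?ltW.
rewrite -[in RHS]n2 /u.
move: (multiplier_op Psi fsin x) (multiplier_op Psi fcos x) => [a b] [c d].
rewrite /cis cosN sinN !(ReD, ReN, ReM, ImD, ImN, ImM, Re_conjc, Im_conjc) /=.
by congr (_%:C); ring.
Qed.

End intensity.

Theorem theorem4p2 (R : realType) (N : nat) (n : R)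
    (Omega : set (N.-tuple R)) (phi Psi : N.-tuple R -> R)
    (n_gt0 : 0 < n)
    (pupil_L2 : Lp 2%:E (fun x => (\1_Omega x)%:C * cis (- phi x)))
    (Psi_pupil_L2 : Lp 2%:E (fun xi => (Psi xi)%:C *
       fourier (fun x => (\1_Omega x)%:C * cis (- phi x)) xi))
    (cos_dom : multiplier_dom Psi (fun x => (\1_Omega x * cos (phi x))%:C))
    (sin_dom : multiplier_dom Psi (fun x => (\1_Omega x * sin (phi x))%:C)) :
  let I := intensity n Omega phi Psi in
  let Gcos := multiplier_op Psi (fun x => (\1_Omega x * cos (phi x))%:C) in
  let Gsin := multiplier_op Psi (fun x => (\1_Omega x * sin (phi x))%:C) in
  ((forall xi, Psi (opp_vec xi) = Psi xi) ->
     {ae lebesgue_vec R N, forall x,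
        I 1 x - n * \1_Omega x = diff_quotient I 1 x} /\
     has_L1_derivative_at0 I (fun x =>
       - (2 * n * \1_Omega x * sin (phi x))%:C * Gcos x
       + (2 * n * \1_Omega x * cos (phi x))%:C * Gsin x)) /\
  ((forall xi, Psi (opp_vec xi) = - Psi xi) ->
     {ae lebesgue_vec R N, forall x,
        I 1 x - n * \1_Omega x = diff_quotient I 1 x} /\
     has_L1_derivative_at0 I (fun x =>
       'i%C * ((2 * n * \1_Omega x * cos (phi x))%:C * Gcos x
               + (2 * n * \1_Omega x * sin (phi x))%:C * Gsin x))).
Proof.
move=> I Gcos Gsin.
have quotient1 : {ae lebesgue_vec R N, forall x,
    I 1 x - n * \1_Omega x = diff_quotient I 1 x}.
  have := intensity0 n_gt0 cos_dom sin_dom; apply: filterS => x Ix.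
  by rewrite /diff_quotient divr1 -Ix.
have real_conj (g : N.-tuple R -> R) x : conjc (g x)%:C = (g x)%:C :> R[i].
  exact: conjc_real.
split=> PsiN; split=> //.
(* [Gcos] and [Gsin] equal their conjugates, so the real part of cis phi (G s + i G c) is cos phi G
   s - sin phi G c. *)
- have PsiE xi : Psi (opp_vec xi) = 1 * Psi xi by rewrite mul1r.
  apply: has_L1_derivative_ae (intensity_L1_derivative n_gt0 cos_dom sin_dom).
  have Gc := multiplier_op_conj (expr1n _ 2) PsiE (real_conj _) cos_dom.
  have Gs := multiplier_op_conj (expr1n _ 2) PsiE (real_conj _) sin_dom.
  move: Gc Gs; apply: filterS2 => x; rewrite -/(Gcos x) -/(Gsin x).
  case: (Gcos x) (Gsin x) => [a b] [c d] [_ bN] [_ dN] _.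
  have b0 : b = 0 by lra.
  have d0 : d = 0 by lra.
  by apply: eq_complexP; rewrite !(ReD, ReN, ReM, ImD, ImN, ImM) /= b0 d0; ring.
(* Now [Gcos] and [Gsin] are opposite to their conjugates, and the same real part is i (cos phi G c
   + sin phi G s). *)
- have PsiE xi : Psi (opp_vec xi) = -1 * Psi xi by rewrite mulN1r.
  have N1 : (-1 : R) ^+ 2 = 1 by rewrite sqrrN expr1n.
  apply: has_L1_derivative_ae (intensity_L1_derivative n_gt0 cos_dom sin_dom).
  have Gc := multiplier_op_conj N1 PsiE (real_conj _) cos_dom.
  have Gs := multiplier_op_conj N1 PsiE (real_conj _) sin_dom.
  move: Gc Gs; apply: filterS2 => x; rewrite -/(Gcos x) -/(Gsin x).
  case: (Gcos x) (Gsin x) => [a b] [c d] [aN _] [cN _] _.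
   have a0 : a = 0 by lra.
  have c0 : c = 0 by lra.
  by apply: eq_complexP; rewrite !(ReD, ReN, ReM, ImD, ImN, ImM) /= a0 c0; ring.
Qed.
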